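(* Let $A$ be a Hopf algebra with bijective antipode and let $(\Lambda^1,\omega)$ define a generalised bicovariant first order differential calculus on $A$, i.e. $\Lambda^1$ is a right $A$-crossed module and $\omega:A^+\to\Lambda^1$ a crossed module morphism. Then $\Omega_{sh}(A)=A\#\mathrm{Sh}_-(\Lambda^1)$ is a strongly bicovariant differential exterior algebra on $A$ with $$\mathrm{d}(a\otimes v_1\otimes\cdots\otimes v_n)=a_{(1)}\otimes\omega(\pi(a_{(2)}))\bullet_-(v_1\otimes\cdots\otimes v_n)+a\otimes\delta(v_1\otimes\cdots\otimes v_n),$$ where $\delta:\mathrm{Sh}_-(\Lambda^1)\to\mathrm{Sh}_-(\Lambda^1)$ is defined recursively (with $\delta(1)=0$) by $$\delta(v_1\otimes\cdots\otimes v_n)=\delta(v_1\otimes\cdots\otimes v_{n-1})\otimes v_n+(-1)^n(v_1)_0\otimes\cdots\otimes(v_n)_0\otimes\omega(\pi((v_1)_1\cdots(v_n)_1))$$ for any $v_1\otimes\cdots\otimes v_n\in\mathrm{Sh}_-(\Lambda^1)$. Moreover, $\Omega_{sh}(A)$ is inner by $\theta\in\Lambda^1$ if and only if $\theta$ makes $(\Lambda^1,\omega)$ inner and $\Psi(v\otimes\theta)=\theta\otimes v$ for any $v\in\Lambda^1$.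
   Context: We work over a field $k$ of characteristic not $2$. $A^+=\ker\epsilon$, $\pi(a)=a-\epsilon(a)1$. A right $A$-crossed module is a vector space $V$ with right action $\triangleleft$ and right coaction $\Delta_Rv=v_0\otimes v_1$ of $A$ such that $\Delta_R(v\triangleleft a)=v_0\triangleleft a_{(2)}\otimes(Sa_{(1)})v_1a_{(3)}$; these form a braided category with $\Psi(v\otimes w)=w_0\otimes v\triangleleft w_1$. $A^+$ is a crossed module by $a\triangleleft b=ab$, $\Delta_R(a)=a_{(2)}\otimes(Sa_{(1)})a_{(3)}$. The first order calculus of $(\Lambda^1,\omega)$ is $\Omega^1=A\otimes\Lambda^1$, $\mathrm{d}a=a_{(1)}\otimes\omega(\pi(a_{(2)}))$; $\theta\in\Lambda^1$ makes it inner if $\omega(a)=\theta\triangleleft a$ for all $a\in A^+$. $\mathrm{Sh}_-(V)$ is the braided-super Hopf algebra that is the tensor space $\oplus_nV^{\otimes n}$ with deconcatenation coproduct $\underline\Delta(v_1\otimes\cdots\otimes v_n)=\sum_{i=0}^n(v_1\otimes\cdots\otimes v_i)\underline\otimes(v_{i+1}\otimes\cdots\otimes v_n)$, counit zero in positive degree, and product $(v_1\otimes\cdots\otimes v_r)\bullet_-(v_{r+1}\otimes\cdots\otimes v_n)=\binom{n}{r};-\Psi$ applied to $v_1\otimes\cdots\otimes v_n$, where the braided binomials $\left(\binom{n}{r};\Psi\right):V^{\otimes n}\to V^{\otimes n}$ are defined by $$\left(\tbinom{n}{r};\Psi\right)=\left(\left(\tbinom{n-1}{r-1};\Psi\right)\otimes\mathrm{id}\right)\Psi_{n-1}\cdots\Psi_{r+1}\Psi_r+\left(\tbinom{n-1}{r};\Psi\right)\otimes\mathrm{id},\quad\left(\tbinom{n}{0};\Psi\right)=\mathrm{id},\quad\left(\tbinom{n}{r};\Psi\right)=0\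 (r>n),$$ $\Psi_i$ being $\Psi$ acting in tensor factors $i,i+1$. For a braided-super Hopf algebra $\Lambda$ in the category of right $A$-crossed modules, $A\#\Lambda$ is the super-Hopf algebra $A\otimes\Lambda$ with $(a\otimes\eta)(b\otimes\zeta)=ab_{(1)}\otimes(\eta\triangleleft b_{(2)})\zeta$ and $\Delta(a\otimes\eta)=a_{(1)}\otimes(\eta^1)_0\otimes a_{(2)}(\eta^1)_1\otimes\eta^2$, where $\underline\Delta\eta=\eta^1\otimes\eta^2$. A strongly bicovariant differential exterior algebra over $A$ is a graded super-Hopf algebra $\Omega=\oplus_{n\ge0}\Omega^n$ with $\Omega^0=A$ (parity given by the degree) with a degree $1$ map $\mathrm{d}$ with $\mathrm{d}^2=0$ that is a super-derivation and a super-coderivation, $\Delta\mathrm{d}=(\mathrm{d}\otimes\mathrm{id}+(-1)^{|\ |}\otimes\mathrm{d})\Delta$. It is inner by $\theta\in\Omega^1$ if $\mathrm{d}u=\theta u-(-1)^{|u|}u\theta$ for all homogeneous $u$. *)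

(* Defs.v *)
From HB Require Import structures.
From mathcomp Require Import all_boot all_algebra.
From mathcomp Require Import boolp classical_sets fsbigop.
From mathcomp Require Import freeg.

Set Implicit Arguments.
Unset Strict Implicit.
Unset Printing Implicit Defensive.

Import GRing.Theory.
Local Open Scope ring_scope.
Local Open Scope quotient_scope.

Section FreeQuotient.
Variables (k : fieldType) (X : choiceType) (R : {freeg X / k} -> Prop).
Local Notation F := {freeg X / k}.

Definition relspan : {pred F} := fun x =>
  `[< forall S : F -> Prop, S 0 ->
      (forall c u v, S u -> S v -> S (c *: u + v)) ->
      (forall u, R u -> S u) -> S x >].

Lemma relspanP x : reflect (forall S : F -> Prop, S 0 ->
    (forall c u v, S u -> S v -> S (c *: u + v)) ->
    (forall u, R u -> S u) -> S x) (x \in relspan).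
Proof. exact: asboolP. Qed.

Fact relspan_linear : GRing.linear_closed relspan.
Proof.
move=> c u v /relspanP hu /relspanP hv; apply/relspanP => S S0 SD SR.
exact: SD (hu _ S0 SD SR) (hv _ S0 SD SR).
Qed.

Fact relspan_zmod : zmod_closed relspan.
Proof.
split=> [|u v hu hv]; first by apply/relspanP => S.
by rewrite addrC -scaleN1r; exact: relspan_linear.
Qed.
HB.instance Definition _ := GRing.isZmodClosed.Build F relspan relspan_zmod.

Lemma relspanZ c u : u \in relspan -> c *: u \in relspan.
Proof. by move=> hu; rewrite -[_ *: _]addr0 relspan_linear ?rpred0. Qed.

Lemma rel_relspan u : R u -> u \in relspan.
Proof. by move=> hu; apply/relspanP => S _ _; apply. Qed.

Definition freequot := Quotient.quot (relspan : zmodClosed F).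
HB.instance Definition _ := GRing.Zmodule.on freequot.
HB.instance Definition _ := Quotient.on freequot.

Definition fqpi : F -> freequot := \pi.
Definition fqscale (c : k) (x : freequot) : freequot := fqpi (c *: repr x).

Lemma fqpiP u v : reflect (fqpi u = fqpi v) (u - v \in relspan).
Proof.
by rewrite (@Quotient.idealrBE _ (relspan : zmodClosed F)); exact: eqP.
Qed.

Lemma fqpiD u v : fqpi (u + v) = fqpi u + fqpi v.
Proof. exact: (@Quotient.pi_add _ (relspan : zmodClosed F)). Qed.

Lemma fqpiZ c u : fqpi (c *: u) = fqscale c (fqpi u).
Proof.
apply/fqpiP; rewrite -scalerBr; apply: relspanZ; apply/fqpiP.
by rewrite /fqpi reprK.
Qed.

Lemma fqpi_surj x : fqpi (repr x) = x. Proof. exact: reprK. Qed.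

Fact fqscaleA b c x : fqscale b (fqscale c x) = fqscale (b * c) x.
Proof. by rewrite -[x]fqpi_surj -!fqpiZ scalerA. Qed.
Fact fqscale1 : left_id 1 fqscale.
Proof. by move=> x; rewrite -[x]fqpi_surj -!fqpiZ scale1r. Qed.
Fact fqscaleDr : right_distributive fqscale +%R.
Proof.
by move=> c x y; rewrite -[x]fqpi_surj -[y]fqpi_surj -fqpiD -!fqpiZ scalerDr fqpiD.
Qed.
Fact fqscaleDl x : {morph fqscale^~ x : b c / b + c}.
Proof. by move=> b c; rewrite -[x]fqpi_surj -!fqpiZ scalerDl fqpiD. Qed.
HB.instance Definition _ :=
  GRing.Zmodule_isLmodule.Build k freequot fqscaleA fqscale1 fqscaleDr fqscaleDl.

Fact fqpi_linear : linear fqpi.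
Proof. by move=> c u v; rewrite fqpiD fqpiZ. Qed.
HB.instance Definition _ := GRing.isLinear.Build k F freequot _ fqpi fqpi_linear.

Definition fqgen (x : X) : freequot := fqpi [freeg [:: (1, x)]].

Definition fqlift (M : lmodType k) (f : X -> M) (x : freequot) : M :=
  fglift f (repr x).

Section Lift.
Variables (M : lmodType k) (f : X -> M).

Fact fglift_linear : linear (fglift f : F -> M).
Proof.
have hD : {morph (fglift f : F -> M) : u v / u + v}.
  move=> u v; have fB := @lift_is_additive k X M f.
  have f0 : fglift f 0 = 0 by have := fB 0 0; rewrite !subrr.
  have fN w : fglift f (- w) = - fglift f w by rewrite -sub0r fB f0 sub0r.
  by rewrite -[v]opprK fB !fN.
have h0 : fglift f (0 : F) = 0 by apply: (addrI (fglift f (0 : F))); rewrite -hD !addr0.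
have hs (I : Type) (r : seq I) (G : I -> F) :
    fglift f (\sum_(i <- r) G i) = \sum_(i <- r) fglift f (G i).
  exact: (big_morph (fglift f) hD h0).
move=> c u v; rewrite hD; congr (_ + _).
rewrite -[in RHS](freeg_sumE u) hs scaler_sumr /=.
rewrite [c *: u]/(fgscale c u) hs.
by apply: eq_bigr => z _; rewrite !liftU scalerA.
Qed.

Hypothesis fR : forall u, R u -> fglift f u = 0.

Lemma fqlift_pi u : fqlift f (fqpi u) = fglift f u.
Proof.
have fl := fglift_linear.
have f0 : fglift f (0 : F) = 0.
  by have := fl (-1) 0 0; rewrite scaler0 addr0 scaleN1r addNr.
have h w : w \in relspan -> fglift f w = 0.
  move=> /relspanP /(_ (fun w => fglift f w = 0)); apply=> // c x y hx hy.
  by rewrite fl hx hy scaler0 addr0.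
rewrite /fqlift; apply/eqP; rewrite -subr_eq0; apply/eqP.
have -> : fglift f (repr (fqpi u)) - fglift f u
    = fglift f (-1 *: u + repr (fqpi u)).
  by rewrite fl scaleN1r addrC.
by apply: h; rewrite scaleN1r addrC; apply/fqpiP; rewrite fqpi_surj.
Qed.

Lemma fqlift_linear : linear (fqlift f).
Proof.
move=> c x y; rewrite -[x]fqpi_surj -[y]fqpi_surj -linearP /= !fqlift_pi.
exact: fglift_linear.
Qed.

Lemma fqlift_gen x : fqlift f (fqgen x) = f x.
Proof. by rewrite fqlift_pi liftU scale1r. Qed.
End Lift.

Lemma fq_gen_sum (x : freequot) :
  exists r : seq (k * X), x = \sum_(i <- r) i.1 *: fqgen i.2.
Proof.
exists [seq (coeff z (repr x), z) | z <- dom (repr x)].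
rewrite big_map -{1}[x]fqpi_surj -{1}[repr x]freeg_sumE linear_sum /=.
apply: eq_bigr => z _; rewrite /fqgen -linearZ /=; congr (fqpi _).
by apply/eqP/freeg_eqP => t; rewrite coeffZ !coeffU mul1r.
Qed.
End FreeQuotient.

Section Tensor.
Variables (k : fieldType) (V W : lmodType k).
Local Notation gen v w := [freeg [:: (1 : k, (v, w) : V * W)]].

Inductive tensor_rel : {freeg (V * W)%type / k} -> Prop :=
| TensorRelL c v v' w :
    tensor_rel (gen (c *: v + v') w - (c *: gen v w + gen v' w))
| TensorRelR c v w w' :
    tensor_rel (gen v (c *: w + w') - (c *: gen v w + gen v w')).

Definition tensor := freequot tensor_rel.
HB.instance Definition _ := GRing.Lmodule.on tensor.

Definition pure (v : V) (w : W) : tensor := fqgen tensor_rel (v, w).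

(* For a bilinear f this is the linear map V (x) W -> M induced by f, so that *)
(* tsum x f is the Sweedler-style sum of the f v w over x = sum v (x) w; for  *)
(* other f it depends on the representative of x (see tsum_pure below).       *)
Definition tsum (M : lmodType k) (x : tensor) (f : V -> W -> M) : M :=
  fqlift (fun vw => f vw.1 vw.2) x.

Definition bilinear_map (M : lmodType k) (f : V -> W -> M) : Prop :=
  (forall w, linear (f^~ w)) /\ (forall v, linear (f v)).
End Tensor.

Notation "v \ot w" := (pure v w) (at level 40, left associativity) : ring_scope.
Notation "\sw_ ( a , b <- x ) E" := (tsum x (fun a b => E))
  (at level 41, a name, b name, x at level 99, E at level 41,
   format "'[' \sw_ ( a ,  b  <-  x ) '/  '  E ']'") : ring_scope.

Section TensorTheory.
Variables (k : fieldType) (V W : lmodType k).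

Lemma pure_bilinear : bilinear_map (@pure k V W).
Proof.
split=> [w c v v'|v c w w'].
  rewrite /pure /fqgen -linearP; apply/fqpiP/rel_relspan; exact: TensorRelL.
by rewrite /pure /fqgen -linearP; apply/fqpiP/rel_relspan; exact: TensorRelR.
Qed.

Section Lift.
Variables (M : lmodType k) (f : V -> W -> M).
Hypothesis fL : bilinear_map f.

Let f' (vw : (V * W)%type) := f vw.1 vw.2.
Let fglB c u v :
  fglift f' (c *: u + v) = c *: fglift f' u + fglift f' v :> M.
Proof. exact: fglift_linear. Qed.

Let f_rel u : tensor_rel u -> fglift f' u = 0.
Proof.
have hB a b : fglift f' (a - b) = fglift f' a - fglift f' b.
  have -> : a - b = (-1) *: b + a by rewrite scaleN1r addrC.
  by rewrite fglB scaleN1r addrC.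
have [f1 f2] := fL.
by case=> [c v v' w|c v w w']; rewrite hB fglB !liftU !scale1r /f' /= ?f1 ?f2 subrr.
Qed.

Lemma tsum_linear : linear (fun x => tsum x f).
Proof. exact: fqlift_linear f_rel. Qed.

Lemma tsum_pure v w : tsum (v \ot w) f = f v w.
Proof. exact: (fqlift_gen f_rel). Qed.
End Lift.
End TensorTheory.

Section TensorSpace.
Variables (k : fieldType) (V : lmodType k).
Local Notation gen s := [freeg [:: (1 : k, s : seq V)]].

Inductive word_rel : {freeg (seq V) / k} -> Prop :=
| WordRel s t c v w :
    word_rel (gen (s ++ (c *: v + w) :: t)
              - (c *: gen (s ++ v :: t) + gen (s ++ w :: t))).

(* The tensor space of V, direct sum of the V^{(x) n}: tw [:: v1; ...; vn] is *)
(* the pure tensor v1 (x) ... (x) vn, and tw [::] is the unit of V^{(x) 0}.   *)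
Definition tspace := freequot word_rel.
HB.instance Definition _ := GRing.Lmodule.on tspace.

Definition tw (s : seq V) : tspace := fqgen word_rel s.

(* As for tsum, this is the induced linear map when f is multilinear. *)
Definition wsum (M : lmodType k) (x : tspace) (f : seq V -> M) : M := fqlift f x.

Definition multilinear (M : lmodType k) (f : seq V -> M) : Prop :=
  forall s t c v w,
    f (s ++ (c *: v + w) :: t) = c *: f (s ++ v :: t) + f (s ++ w :: t).
End TensorSpace.

Notation "\words_ ( s <- x ) E" := (wsum x (fun s => E))
  (at level 41, s name, x at level 99, E at level 41,
   format "'[' \words_ ( s  <-  x ) '/  '  E ']'") : ring_scope.

Section TensorSpaceTheory.
Variables (k : fieldType) (V : lmodType k).

Lemma tw_multilinear : multilinear (@tw k V).
Proof.
move=> s t c v w; rewrite /tw /fqgen -linearP; apply/fqpiP/rel_relspan.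
exact: WordRel.
Qed.

Section Lift.
Variables (M : lmodType k) (f : seq V -> M).
Hypothesis fL : multilinear f.

Let fglB c u v :
  fglift f (c *: u + v) = c *: fglift f u + fglift f v :> M.
Proof. exact: fglift_linear. Qed.

Let f_rel u : word_rel u -> fglift f u = 0.
Proof.
have hB a b : fglift f (a - b) = fglift f a - fglift f b.
  have -> : a - b = (-1) *: b + a by rewrite scaleN1r addrC.
  by rewrite fglB scaleN1r addrC.
by case=> s t c v w; rewrite hB fglB !liftU !scale1r fL subrr.
Qed.

Lemma wsum_linear : linear (fun x => wsum x f).
Proof. exact: fqlift_linear f_rel. Qed.

Lemma wsum_tw s : wsum (tw s) f = f s.
Proof. exact: (fqlift_gen f_rel). Qed.
End Lift.
End TensorSpaceTheory.

Record hopfAlgebra (k : fieldType) := HopfAlgebra {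
  hopf_sort :> algType k;
  Delta : {linear hopf_sort -> tensor hopf_sort hopf_sort};
  eps : {scalar hopf_sort};
  antipode : {linear hopf_sort -> hopf_sort};
  DeltaA : forall a,
    \sw_(a1, a2 <- Delta a) \sw_(b, c <- Delta a1) b \ot (c \ot a2) =
    \sw_(a1, a2 <- Delta a) \sw_(b, c <- Delta a2) a1 \ot (b \ot c);
  Delta_epsl : forall a, \sw_(a1, a2 <- Delta a) eps a1 *: a2 = a;
  Delta_epsr : forall a, \sw_(a1, a2 <- Delta a) eps a2 *: a1 = a;
  Delta1 : Delta 1 = 1 \ot 1;
  DeltaM : forall a b, Delta (a * b) =
    \sw_(a1, a2 <- Delta a) \sw_(b1, b2 <- Delta b) (a1 * b1) \ot (a2 * b2);
  eps1 : eps 1 = 1;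
  epsM : forall a b, eps (a * b) = eps a * eps b;
  antipodel : forall a, \sw_(a1, a2 <- Delta a) antipode a1 * a2 = (eps a)%:A;
  antipoder : forall a, \sw_(a1, a2 <- Delta a) a1 * antipode a2 = (eps a)%:A
}.

Arguments Delta {k h}.
Arguments eps {k h}.
Arguments antipode {k h}.

Section Augmentation.
Variables (k : fieldType) (A : hopfAlgebra k).

Definition aug_pred : {pred A} := fun a => eps a == 0.

Fact aug_submod : GRing.submod_closed aug_pred.
Proof.
split=> [|c a b]; rewrite !unfold_in /aug_pred ?linear0 // linearP /=.
by move=> /eqP -> /eqP ->; rewrite mulr0 addr0.
Qed.
HB.instance Definition _ := GRing.isSubmodClosed.Build k A aug_pred aug_submod.

Record aug := Aug { aug_val : A; _ : aug_val \in aug_pred }.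
HB.instance Definition _ := [isSub for aug_val].
HB.instance Definition _ := [Choice of aug by <:].
HB.instance Definition _ := [SubChoice_isSubLmodule of aug by <:].

Fact aug_proj_subproof (a : A) : a - (eps a)%:A \in aug_pred.
Proof.
by rewrite unfold_in /aug_pred linearB linearZ /= eps1 mulr1 subrr.
Qed.
Definition aug_proj (a : A) : aug := Aug (aug_proj_subproof a).

Fact aug_mul_subproof (a : aug) (b : A) : aug_val a * b \in aug_pred.
Proof. by case: a => a /= /eqP ha; rewrite unfold_in /aug_pred epsM ha mul0r. Qed.
Definition aug_mul (a : aug) (b : A) : aug := Aug (aug_mul_subproof a b).
End Augmentation.

Record crossedData (k : fieldType) (A : hopfAlgebra k) := CrossedData {
  cd_sort :> lmodType k;
  act : cd_sort -> A -> cd_sort;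
  coact : cd_sort -> tensor cd_sort A
}.

Arguments act {k A c}.
Arguments coact {k A c}.

Record crossed_module (k : fieldType) (A : hopfAlgebra k) (V : crossedData A) :
  Prop := CrossedModule {
  act_bilinear : bilinear_map (@act _ _ V);
  act1 : forall v : V, act v 1 = v;
  actM : forall (v : V) a b, act v (a * b) = act (act v a) b;
  coact_linear : linear (@coact _ _ V);
  coactA : forall v : V,
    \sw_(v0, v1 <- coact v) \sw_(w, a <- coact v0) w \ot (a \ot v1) =
    \sw_(v0, v1 <- coact v) \sw_(a, b <- Delta v1) v0 \ot (a \ot b);
  coact_eps : forall v : V, \sw_(v0, v1 <- coact v) eps v1 *: v0 = v;
  coact_act : forall (v : V) (a : A), coact (act v a) =
    \sw_(v0, v1 <- coact v) \sw_(a1, a' <- Delta a) \sw_(a2, a3 <- Delta a')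
      act v0 a2 \ot (antipode a1 * v1 * a3)
}.

Record crossed_morphism (k : fieldType) (A : hopfAlgebra k)
  (V W : crossedData A) (f : V -> W) : Prop := CrossedMorphism {
  crossed_morphism_linear : linear f;
  crossed_morphism_act : forall v a, f (act v a) = act (f v) a;
  crossed_morphism_coact : forall v,
    coact (f v) = \sw_(v0, v1 <- coact v) f v0 \ot v1
}.

Section Braiding.
Variables (k : fieldType) (A : hopfAlgebra k) (V : crossedData A).

Definition braid (x : tensor V V) : tensor V V :=
  \sw_(v, w <- x) \sw_(w0, w1 <- coact w) w0 \ot act v w1.
End Braiding.

Section AugCrossed.
Variables (k : fieldType) (A : hopfAlgebra k).

(* For a in A^+ the element a_(2) (x) (S a_(1)) a_(3) lies in A^+ (x) A, and  *)
(* aug_proj, being the identity on A^+, only corestricts it (aug_coactE).     *)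
Definition aug_coact (a : aug A) : tensor (aug A) A :=
  \sw_(a1, a' <- Delta (aug_val a)) \sw_(a2, a3 <- Delta a')
    aug_proj a2 \ot (antipode a1 * a3).

Definition aug_crossed : crossedData A :=
  @CrossedData k A (aug A) (@aug_mul k A) aug_coact.
End AugCrossed.

Section WordOperators.
Variables (k : fieldType) (V : lmodType k).
Implicit Types (s t : seq V) (x y : tspace V).

Definition tcat x y : tspace V :=
  \words_(s <- x) \words_(t <- y) tw (s ++ t).

(* psi acting in the tensor factors i, i+1, the first factor being number 1.  *)
Definition op_at (psi : tensor V V -> tensor V V) (i : nat) x : tspace V :=
  \words_(s <- x)
    if drop i.-1 s is v :: w :: t then
      \sw_(v', w' <- psi (v \ot w)) tw (take i.-1 s ++ v' :: w' :: t)
    else 0.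

(* f (x) id on the tensor powers of positive degree.                          *)
Definition op_tensor_id (f : tspace V -> tspace V) x : tspace V :=
  \words_(s <- x)
    if s is v :: t then tcat (f (tw (belast v t))) (tw [:: last v t]) else 0.

(* ((n choose r); psi), to be applied to V^{(x) n} only; the foldl is the     *)
(* composite psi_{n-1} ... psi_{r+1} psi_r, in which psi_r acts first.        *)
Fixpoint braided_binomial (psi : tensor V V -> tensor V V) (n r : nat) x :
    tspace V :=
  match r, n with
  | 0, _ => x
  | _.+1, 0 => 0
  | r'.+1, n'.+1 =>
    if (n < r)%N then 0 else
    op_tensor_id (braided_binomial psi n' r')
      (foldl (fun y i => op_at psi i y) x (iota r (n - r)))
    + op_tensor_id (braided_binomial psi n' r) x
  end.

Definition tspace_proj (n : nat) x : tspace V :=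
  \words_(s <- x) if size s == n then tw s else 0.
End WordOperators.

(* The data of a graded braided-super Hopf algebra in the right A-crossed     *)
(* modules, of parity given by the degree; braided_comp n is the projection   *)
(* to the component of degree n.                                              *)
Record braidedData (k : fieldType) (A : hopfAlgebra k) := BraidedData {
  braided_crossed :> crossedData A;
  braided_comp : nat -> braided_crossed -> braided_crossed;
  braided_mul : braided_crossed -> braided_crossed -> braided_crossed;
  braided_one : braided_crossed;
  braided_Delta : braided_crossed -> tensor braided_crossed braided_crossed;
  braided_eps : braided_crossed -> k
}.

Section Shuffle.
Variables (k : fieldType) (A : hopfAlgebra k) (V : crossedData A).
Implicit Types (s t : seq V) (x y : tspace V).

Fixpoint word_act s (a : A) : tspace V :=
  if s is v :: t then
    \sw_(a1, a2 <- Delta a) tcat (tw [:: act v a1]) (word_act t a2)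
  else eps a *: tw [::].

Fixpoint word_coact s : tensor (tspace V) A :=
  if s is v :: t then
    \sw_(v0, v1 <- coact v) \sw_(y, b <- word_coact t)
      tcat (tw [:: v0]) y \ot (v1 * b)
  else tw [::] \ot 1.

Definition tspace_crossed : crossedData A :=
  @CrossedData k A (tspace V) (fun x a => \words_(s <- x) word_act s a)
    (fun x => \words_(s <- x) word_coact s).

Definition sh_mul x y : tspace V :=
  \words_(s <- x) \words_(t <- y)
    braided_binomial (fun z => - braid z) (size s + size t) (size s) (tw (s ++ t)).

Definition sh_Delta x : tensor (tspace V) (tspace V) :=
  \words_(s <- x) \sum_(i < (size s).+1) tw (take i s) \ot tw (drop i s).

Definition sh_eps x : k := \words_(s <- x) ((s == [::])%:R : k^o).

Definition Sh : braidedData A :=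
  @BraidedData k A tspace_crossed (@tspace_proj k V) sh_mul (tw [::])
    sh_Delta sh_eps.
End Shuffle.

(* The data of a graded super-Hopf algebra: gcomp n is the projection to the  *)
(* component of degree n.                                                     *)
Record gradedData (k : fieldType) := GradedData {
  gsort :> lmodType k;
  gcomp : nat -> gsort -> gsort;
  gmul : gsort -> gsort -> gsort;
  gone : gsort;
  gDelta : gsort -> tensor gsort gsort;
  geps : gsort -> k
}.

Arguments gcomp {k g}.
Arguments gmul {k g}.
Arguments gone {k g}.
Arguments gDelta {k g}.
Arguments geps {k g}.

Section GradedSuperHopf.
Variables (k : fieldType) (H : gradedData k).
Implicit Types (u v w : H).

Definition gdeg (n : nat) u : Prop := gcomp n u = u.

(* u |-> (-1)^{|u|} u *)
Definition gsign u : H := \sum_(n \in [set: nat]) (-1) ^+ n *: gcomp n u.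

(* (a (x) b)(c (x) d) = (-1)^{|b||c|} ac (x) bd *)
Definition super_mul (x y : tensor H H) : tensor H H :=
  \sw_(a, b <- x) \sw_(c, d <- y)
    \sum_(i \in [set: nat]) \sum_(j \in [set: nat])
      (-1) ^+ (i * j) *: (gmul a (gcomp j c) \ot gmul (gcomp i b) d).

Record grading : Prop := Grading {
  gcomp_linear : forall n, linear (gcomp n : H -> H);
  gcomp_proj : forall m n u, gcomp m (gcomp n u) = if m == n then gcomp n u else 0;
  gcomp_sum : forall u, exists N, u = \sum_(n < N) gcomp n u
}.

Record graded_algebra : Prop := GradedAlgebra {
  gmul_bilinear : bilinear_map (@gmul _ H);
  gmulA : associative (@gmul _ H);
  gmul1 : left_id gone (@gmul _ H);
  gmulr1 : right_id gone (@gmul _ H);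
  gone_deg : gdeg 0 gone;
  gmul_deg : forall m n u v, gdeg m u -> gdeg n v -> gdeg (m + n) (gmul u v)
}.

Record graded_coalgebra : Prop := GradedCoalgebra {
  gDelta_linear : linear (@gDelta _ H);
  geps_linear : scalar (geps : H -> k);
  gDeltaA : forall u,
    \sw_(a, b <- gDelta u) \sw_(c, d <- gDelta a) c \ot (d \ot b) =
    \sw_(a, b <- gDelta u) \sw_(c, d <- gDelta b) a \ot (c \ot d);
  gDelta_epsl : forall u, \sw_(a, b <- gDelta u) geps a *: b = u;
  gDelta_epsr : forall u, \sw_(a, b <- gDelta u) geps b *: a = u;
  gDelta_deg : forall n u, gdeg n u ->
    gDelta u =
      \sum_(i < n.+1) \sw_(a, b <- gDelta u) gcomp i a \ot gcomp (n - i) b;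
  geps_deg : forall n u, gdeg n u -> (0 < n)%N -> geps u = 0
}.

Record graded_super_hopf : Prop := GradedSuperHopf {
  gsh_grading : grading;
  gsh_algebra : graded_algebra;
  gsh_coalgebra : graded_coalgebra;
  gDelta1 : gDelta (gone : H) = gone \ot gone;
  gDeltaM : forall u v, gDelta (gmul u v) = super_mul (gDelta u) (gDelta v);
  geps1 : geps (gone : H) = 1;
  gepsM : forall u v, geps (gmul u v) = geps u * geps v;
  gsh_antipode : exists S : H -> H,
    [/\ linear S,
        forall n u, gdeg n u -> gdeg n (S u),
        forall u, \sw_(a, b <- gDelta u) gmul (S a) b = geps u *: gone
      & forall u, \sw_(a, b <- gDelta u) gmul a (S b) = geps u *: gone]
}.

(* iota identifies the Hopf algebra A with the component of degree 0.         *)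
Record degree_zero_part (A : hopfAlgebra k) (iota : A -> H) : Prop :=
  DegreeZeroPart {
  iota_linear : linear iota;
  iota_inj : injective iota;
  iota_deg : forall u, gdeg 0 u <-> exists a, u = iota a;
  iota1 : iota 1 = gone;
  iotaM : forall a b, iota (a * b) = gmul (iota a) (iota b);
  iota_Delta : forall a,
    gDelta (iota a) = \sw_(a1, a2 <- Delta a) iota a1 \ot iota a2;
  iota_eps : forall a, geps (iota a) = eps a
}.

Record strongly_bicovariant (A : hopfAlgebra k) (iota : A -> H) (d : H -> H) :
  Prop := StronglyBicovariant {
  sb_super_hopf : graded_super_hopf;
  sb_degree0 : degree_zero_part iota;
  sb_linear : linear d;
  sb_degree : forall n u, gdeg n u -> gdeg n.+1 (d u);
  sb_square : forall u, d (d u) = 0;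
  sb_derivation : forall n u v, gdeg n u ->
    d (gmul u v) = gmul (d u) v + (-1) ^+ n *: gmul u (d v);
  sb_coderivation : forall u, gDelta (d u) =
    \sw_(a, b <- gDelta u) (d a \ot b + gsign a \ot d b)
}.

Definition inner_by (d : H -> H) (theta : H) : Prop :=
  forall n u, gdeg n u -> d u = gmul theta u - (-1) ^+ n *: gmul u theta.
End GradedSuperHopf.

Section Bosonisation.
Variables (k : fieldType) (A : hopfAlgebra k) (L : braidedData A).
Local Notation AL := (tensor A L).

Definition boson_comp (n : nat) (u : AL) : AL :=
  \sw_(a, eta <- u) a \ot braided_comp n eta.

Definition boson_mul (u v : AL) : AL :=
  \sw_(a, eta <- u) \sw_(b, zeta <- v) \sw_(b1, b2 <- Delta b)
    (a * b1) \ot braided_mul (act eta b2) zeta.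

Definition boson_Delta (u : AL) : tensor AL AL :=
  \sw_(a, eta <- u) \sw_(a1, a2 <- Delta a)
  \sw_(eta1, eta2 <- braided_Delta eta) \sw_(eta10, eta11 <- coact eta1)
    (a1 \ot eta10) \ot ((a2 * eta11) \ot eta2).

Definition boson_eps (u : AL) : k :=
  \sw_(a, eta <- u) (eps a * braided_eps eta : k^o).

Definition boson : gradedData k :=
  @GradedData k AL boson_comp boson_mul (1 \ot braided_one L)
    boson_Delta boson_eps.
End Bosonisation.

Section ShuffleCalculus.
Variables (k : fieldType) (A : hopfAlgebra k) (L : crossedData A).
Variable omega : aug A -> L.

Definition generalised_fo_calculus : Prop :=
  crossed_module L /\ @crossed_morphism k A (aug_crossed A) L omega.

Definition inner_fo_calculus (theta : L) : Prop :=
  forall a : aug A, omega a = act theta (aug_val a).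

Definition Omega_sh : gradedData k := boson (Sh L).

(* delta on words; the recursion removes the last letter, hence the reversal. *)
Fixpoint delta_rev (s : seq L) : tspace L :=
  if s is v :: t then
    tcat (delta_rev t) (tw [:: v])
    + (-1) ^+ size s *: \sw_(y, b <- word_coact (rev s))
                          tcat y (tw [:: omega (aug_proj b)])
  else 0.

Definition sh_delta (x : tspace L) : tspace L := \words_(s <- x) delta_rev (rev s).

Definition sh_d (u : Omega_sh) : Omega_sh :=
  \sw_(a, x <- (u : tensor A (tspace L)))
    ((\sw_(a1, a2 <- Delta a) a1 \ot sh_mul (tw [:: omega (aug_proj a2)]) x)
     + a \ot sh_delta x).
End ShuffleCalculus.
Section Multilinearity.
Variables (k : fieldType).
Implicit Types (V W M N : lmodType k).

Lemma fqlift_family (X : choiceType) (R : {freeg X / k} -> Prop) N M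
    (F : N -> X -> M) (x : freequot R) :
  (forall z, linear (F^~ z)) -> linear (fun n => fqlift (F n) x).
Proof.
move=> hF c u v; rewrite /fqlift -(Freeg_enum (repr x)) !fglift_Freeg /prelift.
rewrite scaler_sumr -big_split /=; apply: eq_bigr => z _.
by rewrite hF scalerDr !scalerA [c * _]mulrC.
Qed.

Lemma tsum_family V W N M (F : N -> V -> W -> M) (x : tensor V W) :
  (forall v w, linear (fun n => F n v w)) -> linear (fun n => tsum x (F n)).
Proof.
move=> hF; apply: (fqlift_family (F := fun n vw => F n vw.1 vw.2)) => -[v w] /=.
exact: hF.
Qed.

Lemma tsum_comb V W M c (f g h : V -> W -> M) (x : tensor V W) :
  (forall v w, f v w = c *: g v w + h v w) -> tsum x f = c *: tsum x g + tsum x h.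
Proof.
move=> hf; rewrite /tsum /fqlift -(Freeg_enum (repr x)) !fglift_Freeg /prelift.
rewrite scaler_sumr -big_split /=; apply: eq_bigr => z _.
by rewrite hf scalerDr !scalerA [c * _]mulrC.
Qed.

Lemma eq_tsum V W M (f g : V -> W -> M) (x : tensor V W) :
  (forall v w, f v w = g v w) -> tsum x f = tsum x g.
Proof. by move=> fg; congr tsum; apply/funext => v; apply/funext => w. Qed.

Lemma linear_of_tsum V W M N (x : tensor V W) (f : V -> W -> M) (g : M -> N) :
  linear g -> g (tsum x f) = \sw_(v, w <- x) g (f v w).
Proof.
move=> gL; pose g' : {linear M -> N} :=
  HB.pack g (GRing.isLinear.Build k M N _ g gL).
rewrite /tsum /fqlift -(Freeg_enum (repr x)) !fglift_Freeg /prelift.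
rewrite -[g]/(g' : M -> N) linear_sum /=; apply: eq_bigr => z _.
by rewrite [LHS](linearZ_LR g').
Qed.

Lemma purerZ V W c (v : V) (w : W) : v \ot (c *: w) = c *: (v \ot w).
Proof.
have h := (pure_bilinear V W).2 v.
have h0 : v \ot (0 : W) = 0.
  by have := h (-1) 0 0; rewrite scaler0 addr0 scaleN1r addNr.
by rewrite -[c *: w]addr0 h h0 addr0.
Qed.

Lemma wsum_family V N M (F : N -> seq V -> M) (x : tspace V) :
  (forall s, linear (F^~ s)) -> linear (fun n => wsum x (F n)).
Proof. exact: fqlift_family. Qed.

Lemma linear_tsum V W N M (f : V -> W -> M) (g : N -> tensor V W) :
  bilinear_map f -> linear g -> linear (fun n => tsum (g n) f).
Proof. by move=> hf hg c u v; rewrite hg (tsum_linear hf). Qed.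

Lemma linear_purel V W N (f : N -> V) (w : W) :
  linear f -> linear (fun n => f n \ot w).
Proof. by move=> hf c u v; rewrite hf (pure_bilinear V W).1. Qed.

Lemma linear_purer V W N (f : N -> W) (v : V) :
  linear f -> linear (fun n => v \ot f n).
Proof. by move=> hf c u w; rewrite hf (pure_bilinear V W).2. Qed.

Lemma tcat_bilinear V : bilinear_map (@tcat k V).
Proof.
split=> [y|x].
  apply: wsum_linear => s t c v w.
  apply: (wsum_family (F := fun v r => tw ((s ++ v :: t) ++ r))) => r a u u'.
  by rewrite -!catA /= tw_multilinear.
apply: wsum_family => s; apply: wsum_linear => t u c v w.
by rewrite !catA tw_multilinear.
Qed.

Lemma tcat_tw V (s t : seq V) : tcat (tw s) (tw t) = tw (s ++ t).
Proof.
rewrite /tcat wsum_tw; first rewrite wsum_tw //.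
  by move=> p q c v w; rewrite !catA tw_multilinear.
move=> p q c v w; apply: (wsum_family (F := fun v t => tw ((p ++ v :: q) ++ t))).
by move=> r a u u'; rewrite -!catA /= tw_multilinear.
Qed.

Lemma tw1_linear V : linear (fun v : V => tw [:: v]).
Proof. by move=> c u v; exact: (tw_multilinear [::] [::]). Qed.


(* psi in the factors following the first j letters, p being a fixed prefix. *)
Let op_word V (psi : tensor V V -> tensor V V) j (p s : seq V) : tspace V :=
  if drop j s is v :: w :: t then
    \sw_(v', w' <- psi (v \ot w)) tw (p ++ take j s ++ v' :: w' :: t)
  else 0.

Let tw2_bilinear V (p t : seq V) : bilinear_map (fun v w => tw (p ++ v :: w :: t)).
Proof.
split=> [w|v] c u u'; first by rewrite tw_multilinear.
by rewrite -[_ :: _ :: _]cat1s catA tw_multilinear -!catA.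
Qed.

Let op_word_multilinear V (psi : tensor V V -> tensor V V) j p :
  linear psi -> multilinear (op_word psi j p).
Proof.
move=> hpsi s; elim: s j p => [|x s IHs] j p t c v w /=; last first.
  case: j => [|j]; last first.
    have E z : op_word psi j.+1 p (x :: z) = op_word psi j (rcons p x) z.
      rewrite /op_word /=; case: (drop j z) => [|a [|b r]] //.
      by congr tsum; apply/funext => a'; apply/funext => b'; rewrite cat_rcons.
    by rewrite !E IHs.
  rewrite /op_word !drop0 !take0 /=; case: s {IHs} => [|y s] /=.
    apply: (linear_tsum (g := fun z => psi (x \ot z))); first exact: tw2_bilinear.
    by move=> a z z'; rewrite (pure_bilinear V V).2 hpsi.
  apply: (tsum_family (F := fun z a b => tw (p ++ a :: b :: s ++ z :: t))).
  move=> a b e z z'.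
  have E q : p ++ a :: b :: s ++ q = (p ++ a :: b :: s) ++ q by rewrite -catA.
  by rewrite !E tw_multilinear.
rewrite /op_word; case: j => [|j].
  rewrite !drop0 !take0 /=; case: t => [|y t]; first by rewrite scaler0 addr0.
  apply: (linear_tsum (g := fun z => psi (z \ot y))); first exact: tw2_bilinear.
  by move=> a z z'; rewrite (pure_bilinear V V).1 hpsi.
rewrite /=; case: (drop j t) => [|a [|b r]]; rewrite ?scaler0 ?addr0 //.
apply: (tsum_family (F := fun z a' b' => tw (p ++ z :: take j t ++ a' :: b' :: r))).
by move=> a' b' e z z'; rewrite tw_multilinear.
Qed.

Lemma op_at_linear V (psi : tensor V V -> tensor V V) i :
  linear psi -> linear (op_at psi i).
Proof.
by move=> hpsi; apply: wsum_linear; exact: (op_word_multilinear i.-1 [::] hpsi).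
Qed.

Lemma op_tensor_id_multilinear V (f : tspace V -> tspace V) : linear f ->
  multilinear (fun s => if s is v :: t then
    tcat (f (tw (belast v t))) (tw [:: last v t]) else 0).
Proof.
move=> hf; set g := (fun s => _).
have E s v : g (rcons s v) = tcat (f (tw s)) (tw [:: v]).
  by case: s => [|x s] //=; rewrite /g /= belast_rcons last_rcons.
have [hl hr] := @tcat_bilinear V.
move=> s t c v w; case/lastP: t => [|t x].
  by rewrite !cats1 !E tw1_linear hr.
by rewrite -!rcons_cons -!rcons_cat !E tw_multilinear hf hl.
Qed.

Lemma op_tensor_id_linear V (f : tspace V -> tspace V) :
  linear f -> linear (op_tensor_id f).
Proof. by move=> hf; apply: wsum_linear; exact: op_tensor_id_multilinear. Qed.

Lemma op_tensor_id_rcons V (f : tspace V -> tspace V) s v : linear f ->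
  op_tensor_id f (tw (rcons s v)) = tcat (f (tw s)) (tw [:: v]).
Proof.
move=> hf; rewrite /op_tensor_id (wsum_tw (op_tensor_id_multilinear hf)).
by case: s => [|x s] //=; rewrite belast_rcons last_rcons.
Qed.

Lemma braided_binomial_linear V (psi : tensor V V -> tensor V V) n r :
  linear psi -> linear (braided_binomial psi n r).
Proof.
move=> hpsi; elim: n r => [|n IHn] [|r] c u v //=; rewrite ?scaler0 ?addr0 //.
case: ifP => _; first by rewrite scaler0 addr0.
have hfold l : linear (foldl (fun y i => op_at psi i y) ^~ l).
  by elim: l => [|i l IHl] a x y //=; rewrite op_at_linear // IHl.
rewrite hfold !op_tensor_id_linear //; rewrite scalerDr.
by rewrite addrACA.
Qed.
End Multilinearity.

Section CrossedTheory.
Variables (k : fieldType) (A : hopfAlgebra k) (L : crossedData A).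
Hypothesis LX : crossed_module L.

Lemma braid_linear : linear (@braid _ _ L).
Proof.
apply: tsum_linear; have [al ar] := act_bilinear LX; split=> [w|v].
  move=> c v v'.
  apply: (tsum_family (F := fun z a b => a \ot act z b)) => a b.
  exact/linear_purer/al.
apply: linear_tsum; last exact: coact_linear LX.
split=> [b|a]; first exact: linear_purel.
exact/linear_purer/ar.
Qed.

Lemma braid_pure (v w : L) :
  braid (v \ot w) = \sw_(w0, w1 <- coact w) w0 \ot act v w1.
Proof.
rewrite /braid tsum_pure //; have [al ar] := act_bilinear LX; split=> [z|z].
  move=> c x x'.
  apply: (tsum_family (F := fun z a b => a \ot act z b)) => a b.
  exact/linear_purer/al.
apply: linear_tsum; last exact: coact_linear LX.
split=> [b|a]; first exact: linear_purel.
exact/linear_purer/ar.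
Qed.
End CrossedTheory.

Section ShuffleTheory.
Variables (k : fieldType) (A : hopfAlgebra k) (L : crossedData A).
Hypothesis LX : crossed_module L.
Local Notation T := (tspace L).

Let nbraid_linear : linear (fun z => - @braid k A L z).
Proof. by move=> c u v; rewrite (braid_linear LX) opprD scalerN. Qed.

Let sh_word (s t : seq L) : T :=
  braided_binomial (fun z => - braid z) (size s + size t) (size s) (tw (s ++ t)).

Let sh_word_linearl t : multilinear (sh_word ^~ t).
Proof.
move=> p q c v w; rewrite /sh_word !size_cat /= -!catA /= tw_multilinear.
exact: braided_binomial_linear.
Qed.

Let sh_word_linearr s : multilinear (sh_word s).
Proof.
move=> p q c v w; rewrite /sh_word !size_cat /= !catA tw_multilinear.
exact: braided_binomial_linear.
Qed.

Lemma sh_mul_bilinear : bilinear_map (@sh_mul k A L).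
Proof.
split=> [y|x].
  apply: wsum_linear => p q c v w.
  apply: (wsum_family (F := fun v t => sh_word (p ++ v :: q) t)) => t a u u'.
  exact: (sh_word_linearl t p q a u u').
by apply: wsum_family => s; apply: wsum_linear; exact: sh_word_linearr.
Qed.

Lemma sh_mul_tw (s t : seq L) :
  sh_mul (tw s) (tw t) =
  braided_binomial (fun z => - braid z) (size s + size t) (size s) (tw (s ++ t)).
Proof.
rewrite /sh_mul wsum_tw; first by rewrite (wsum_tw (sh_word_linearr s)).
move=> p q c v w.
apply: (wsum_family (F := fun v t => sh_word (p ++ v :: q) t)) => r a u u'.
exact: (sh_word_linearl r p q a u u').
Qed.

Let sh_cut_multilinear : multilinear (fun s : seq L =>
  \sum_(i < (size s).+1) tw (take i s) \ot tw (drop i s)).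
Proof.
move=> s t c v w; rewrite !size_cat /= scaler_sumr -big_split /=.
apply: eq_bigr => i _; rewrite !take_cat !drop_cat.
case: ltnP => [_|]; first by rewrite tw_multilinear (pure_bilinear _ _).2.
case: (i - size s)%N => [|j] _ /=.
  by rewrite (tw_multilinear [::]) (pure_bilinear _ _).2.
by rewrite tw_multilinear (pure_bilinear _ _).1.
Qed.

Lemma sh_Delta_linear : linear (@sh_Delta k A L).
Proof. by apply: wsum_linear; exact: sh_cut_multilinear. Qed.

Lemma sh_Delta_tw (s : seq L) :
  sh_Delta (tw s) = \sum_(i < (size s).+1) tw (take i s) \ot tw (drop i s).
Proof. exact: wsum_tw sh_cut_multilinear _. Qed.

Let word_act_linearr (s : seq L) : linear (word_act s).
Proof.
elim: s => [|v s IHs] /=; first by move=> c a b; rewrite linearP scalerDl scalerA.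
apply: linear_tsum; last exact: linearP.
have [tl tr] := @tcat_bilinear k L; have [al ar] := act_bilinear LX.
split=> [b|a] c x y; first by rewrite ar tw1_linear tl.
by rewrite IHs tr.
Qed.

Let word_act_linearl a : multilinear (fun s : seq L => word_act s a).
Proof.
have [tl tr] := @tcat_bilinear k L; have [al ar] := act_bilinear LX.
move=> s t c v w; elim: s a => [|x s IHs] a /=.
  apply: (tsum_family (F := fun z a1 a2 => tcat (tw [:: act z a1]) (word_act t a2))).
  by move=> a1 a2 e y z; rewrite al tw1_linear tl.
by apply: tsum_comb => a1 a2; rewrite IHs tr.
Qed.

Lemma sh_act_bilinear : bilinear_map (@act k A (tspace_crossed L)).
Proof.
split=> [a|x]; first exact/wsum_linear/word_act_linearl.
exact: (wsum_family (F := fun a s => word_act s a)).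
Qed.

Lemma sh_act_tw (s : seq L) (a : A) :
  act (tw s : tspace_crossed L) a = word_act s a.
Proof. exact: (wsum_tw (word_act_linearl a)). Qed.

Lemma word_coact_multilinear : multilinear (@word_coact k A L).
Proof.
have [tl tr] := @tcat_bilinear k L.
have hb (v0 : L) (v1 : A) :
    bilinear_map (fun y b => tcat (tw [:: v0]) y \ot (v1 * b)).
  split=> [b|y] c u v; first by rewrite tr (pure_bilinear _ _).1.
  by rewrite mulrDr -scalerAr (pure_bilinear _ _).2.
move=> s t c v w; elim: s => [|x s IHs] /=; last first.
  apply: tsum_comb => v0 v1; rewrite IHs; exact: tsum_linear.
apply: (linear_tsum (g := @coact k A L)); last exact: coact_linear LX.
split=> [v1|v0] e y z; apply: tsum_comb => u b.
  by rewrite tw1_linear tl (pure_bilinear _ _).1.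
by rewrite mulrDl -scalerAl (pure_bilinear _ _).2.
Qed.

Lemma sh_coact_linear : linear (@coact k A (tspace_crossed L)).
Proof. exact: wsum_linear word_coact_multilinear. Qed.

Lemma sh_coact_tw (s : seq L) : coact (tw s : tspace_crossed L) = word_coact s.
Proof. exact: wsum_tw word_coact_multilinear _. Qed.

Section Delta.
Variable omega : aug A -> L.
Hypothesis omegaX : crossed_morphism (omega : aug_crossed A -> L).

Lemma aug_proj_linear : linear (@aug_proj k A).
Proof.
move=> c a b; apply: val_inj => /=.
by rewrite linearP /= scalerBr scalerDl scalerA opprD addrACA.
Qed.

Let delta_word (s : seq L) := delta_rev omega (rev s).

Let delta_word_rcons s v : delta_word (rcons s v) =
  tcat (delta_word s) (tw [:: v]) + (-1) ^+ (size s).+1 *: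
    \sw_(y, b <- word_coact (rcons s v)) tcat y (tw [:: omega (aug_proj b)]).
Proof. by rewrite /delta_word rev_rcons /= -rev_rcons revK size_rev. Qed.

Let delta_last_bilinear :
  bilinear_map (fun y b => tcat y (tw [:: omega (aug_proj b)])).
Proof.
have [tl tr] := @tcat_bilinear k L.
split=> [b|y] c u v; first by rewrite tl.
by rewrite aug_proj_linear (crossed_morphism_linear omegaX) tw1_linear tr.
Qed.

Let delta_word_multilinear : multilinear delta_word.
Proof.
have [tl tr] := @tcat_bilinear k L.
move=> s t c v w; elim/last_ind: t => [|t x IHt].
  rewrite !cats1 !delta_word_rcons tw1_linear tr.
  rewrite -!cats1 word_coact_multilinear (tsum_linear delta_last_bilinear).
  by rewrite !scalerDr !scalerA [c * _]mulrC addrACA.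
rewrite -!rcons_cons -!rcons_cat !delta_word_rcons IHt tl !size_cat /=.
rewrite !rcons_cat !rcons_cons word_coact_multilinear.
rewrite (tsum_linear delta_last_bilinear).
by rewrite !scalerDr !scalerA [c * _]mulrC addrACA.
Qed.

Lemma sh_delta_linear : linear (sh_delta omega).
Proof. exact: wsum_linear delta_word_multilinear. Qed.

Lemma sh_delta_nil : sh_delta omega (tw [::]) = 0.
Proof. exact: wsum_tw delta_word_multilinear _. Qed.

Lemma sh_delta_rcons s v : sh_delta omega (tw (rcons s v)) =
  tcat (sh_delta omega (tw s)) (tw [:: v]) + (-1) ^+ (size s).+1 *:
    \sw_(y, b <- word_coact (rcons s v)) tcat y (tw [:: omega (aug_proj b)]).
Proof. by rewrite /sh_delta !(wsum_tw delta_word_multilinear) delta_word_rcons. Qed.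

Lemma sh_d_pure (a : A) (x : tspace L) : sh_d omega (a \ot x) =
  (\sw_(a1, a2 <- Delta a) a1 \ot sh_mul (tw [:: omega (aug_proj a2)]) x)
  + a \ot sh_delta omega x.
Proof.
have [ml mr] := sh_mul_bilinear.
rewrite /sh_d tsum_pure //; split=> [y|b] c u v.
  rewrite (pure_bilinear _ _).1 scalerDr addrACA; congr (_ + _).
  rewrite linearP; apply: (tsum_linear (f := fun a1 a2 => _ \ot _)).
  split=> [a2|a1] e b b'; first by rewrite (pure_bilinear _ _).1.
  rewrite aug_proj_linear (crossed_morphism_linear omegaX) tw1_linear ml.
  by rewrite (pure_bilinear _ _).2.
rewrite sh_delta_linear (pure_bilinear _ _).2 scalerDr addrACA; congr (_ + _).
by apply: tsum_comb => a1 a2; rewrite mr (pure_bilinear _ _).2.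
Qed.
End Delta.
End ShuffleTheory.

Section BosonTheory.
Variables (k : fieldType) (A : hopfAlgebra k) (L : braidedData A).
Hypothesis act_bil : bilinear_map (@act k A L).

Lemma boson_mul_pure (a b : A) (eta zeta : L) :
  bilinear_map (@braided_mul k A L) ->
  boson_mul (a \ot eta) (b \ot zeta) =
  \sw_(b1, b2 <- Delta b) (a * b1) \ot braided_mul (act eta b2) zeta.
Proof.
move=> [ml mr]; have [al ar] := act_bil.
have h (x : A) (y z : L) :
    bilinear_map (fun b1 b2 => (x * b1) \ot braided_mul (act y b2) z).
  split=> [b2|b1] c u v; first by rewrite mulrDr -scalerAr (pure_bilinear _ _).1.
  by rewrite ar ml (pure_bilinear _ _).2.
have h2 (x : A) (y : L) : bilinear_map (fun t z =>
    \sw_(b1, b2 <- Delta t) (x * b1) \ot braided_mul (act y b2) z).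
  split=> [zeta'|b'] c u v; first by rewrite linearP tsum_linear.
  by apply: tsum_comb => b1 b2; rewrite mr (pure_bilinear _ _).2.
rewrite /boson_mul tsum_pure; first by rewrite tsum_pure.
split=> [eta'|a'] c u v; apply: tsum_comb => b' zeta'; apply: tsum_comb => b1 b2.
  by rewrite mulrDl -scalerAl (pure_bilinear _ _).1.
by rewrite al ml (pure_bilinear _ _).2.
Qed.

Lemma boson_Delta_pure (a : A) (eta : L) :
  linear (@coact k A L) -> linear (@braided_Delta k A L) ->
  boson_Delta (a \ot eta) =
  \sw_(a1, a2 <- Delta a) \sw_(eta1, eta2 <- braided_Delta eta)
  \sw_(eta10, eta11 <- coact eta1) (a1 \ot eta10) \ot ((a2 * eta11) \ot eta2).
Proof.
move=> cl dl.
have h (a1 a2 : A) (eta2 : L) : bilinear_map (fun (eta10 : L) (eta11 : A) =>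
    (a1 \ot eta10) \ot ((a2 * eta11) \ot eta2)).
  split=> [b|v] c u w.
    by rewrite (pure_bilinear _ _).2 (pure_bilinear _ _).1.
  by rewrite mulrDr -scalerAr (pure_bilinear A L).1 (pure_bilinear _ _).2.
have h2 (a1 a2 : A) : bilinear_map (fun eta1 eta2 : L =>
    \sw_(eta10, eta11 <- coact eta1) (a1 \ot eta10) \ot ((a2 * eta11) \ot eta2)).
  split=> [v|w] c u u'; first by rewrite cl tsum_linear.
  apply: tsum_comb => v b.
  by rewrite (pure_bilinear A L).2 (pure_bilinear _ _).2.
rewrite /boson_Delta tsum_pure //; split=> [x|b] c u v; last first.
  by apply: tsum_comb => a1 a2; rewrite dl tsum_linear.
rewrite linearP tsum_linear //; split=> [a2|a1] e b b'.
  apply: tsum_comb => eta1 eta2; apply: tsum_comb => p q.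
  by rewrite (pure_bilinear A L).1 (pure_bilinear _ _).1.
apply: tsum_comb => eta1 eta2; apply: tsum_comb => p q.
by rewrite mulrDl -scalerAl (pure_bilinear A L).1 (pure_bilinear _ _).2.
Qed.
End BosonTheory.

Section AugTheory.
Variables (k : fieldType) (A : hopfAlgebra k).

Lemma aug_coactE (a : aug A) :
  \sw_(b, c <- aug_coact a) aug_val b \ot c =
  \sw_(a1, a' <- Delta (aug_val a)) \sw_(a2, a3 <- Delta a')
    a2 \ot (antipode a1 * a3).
Proof.
have hv : bilinear_map (fun (b : aug A) (c : A) => aug_val b \ot c).
  split=> [c|b] e u v; last by rewrite (pure_bilinear _ _).2.
  by have -> : aug_val (e *: u + v) = e *: aug_val u + aug_val v;
    rewrite ?(pure_bilinear _ _).1 // (linearP (val : aug A -> A)).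
have hl := tsum_linear hv.
rewrite /aug_coact (linear_of_tsum _ _ hl) (eq_tsum (g := fun a1 a' =>
  (\sw_(a2, a3 <- Delta a') a2 \ot (antipode a1 * a3))
   - (1 : A) \ot (antipode a1 * a'))); last first.
  move=> a1 a'; rewrite (linear_of_tsum _ _ hl).
  have -> : (1 : A) \ot (antipode a1 * a') =
      \sw_(a2, a3 <- Delta a') (1 : A) \ot (antipode a1 * (eps a2 *: a3)).
    have hm : linear (fun b : A => (1 : A) \ot (antipode a1 * b) : tensor A A).
      by move=> c u v; rewrite mulrDr -scalerAr (pure_bilinear _ _).2.
    by rewrite -[in LHS](Delta_epsl a') (linear_of_tsum _ _ hm).
  rewrite addrC -scaleN1r; apply: tsum_comb => a2 a3.
  rewrite tsum_pure //= -scalerAr.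
  have -> : a2 - (eps a2)%:A = (- eps a2) *: 1 + a2 by rewrite scaleNr addrC.
  by rewrite (pure_bilinear _ _).1 purerZ scalerA mulN1r.
have h1 : linear (fun b : A => (1 : A) \ot b) by move=> c u v; rewrite (pure_bilinear _ _).2.
set E := fun a1 a' : A => \sw_(a2, a3 <- Delta a') a2 \ot (antipode a1 * a3).
transitivity ((-1) *: tsum (Delta (aug_val a)) (fun a1 a' => (1:A) \ot (antipode a1 * a'))
   + tsum (Delta (aug_val a)) E).
  by apply: tsum_comb => a1 a'; rewrite scaleN1r addrC.
have <- := linear_of_tsum (Delta (aug_val a)) (fun a1 a' => antipode a1 * a') h1.
rewrite antipodel.
have /eqP -> : aug_val a \in @aug_pred _ A by case: (a).
rewrite scale0r; have -> : (1:A) \ot (0:A) = 0.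
  by have := h1 (-1) 0 0; rewrite scaler0 addr0 scaleN1r addNr.
by rewrite scaler0 add0r.
Qed.
End AugTheory.

Section SuperTheory.
Variables (k : fieldType) (H : gradedData k).
Hypothesis Hgr : grading H.

Lemma fsbig_nat_bound (M : lmodType k) N (F : nat -> M) :
  (forall i, (N <= i)%N -> F i = 0) ->
  \sum_(i \in [set: nat]) F i = \sum_(i < N) F i.
Proof.
move=> hF; rewrite -(@fsbig_widen _ _ _ _ `I_N) //; first by rewrite fsbig_ord.
move=> i /= [_ /negP]; rewrite -leqNgt; exact: hF.
Qed.

Lemma gcomp_bound (u : H) : exists N, forall i, (N <= i)%N -> gcomp i u = 0.
Proof.
have [N hN] := gcomp_sum Hgr u; exists N => i leNi.
pose g : {linear H -> H} :=
  HB.pack (gcomp i : H -> H) (GRing.isLinear.Build k H H _ _ (gcomp_linear Hgr i)).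
rewrite hN -[gcomp i]/(g : H -> H) linear_sum big1 // => j _.
rewrite /= (gcomp_proj Hgr); case: eqP => // e.
by move: leNi; rewrite e leqNgt ltn_ord.
Qed.

Lemma fsbig_gcomp_linear (M : lmodType k) (G : nat -> H -> M) :
  (forall i, linear (G i)) -> linear (fun u => \sum_(i \in [set: nat]) G i (gcomp i u)).
Proof.
move=> hG c u v; have G0 i : G i 0 = 0.
  by have := hG i (-1) 0 0; rewrite scaler0 addr0 scaleN1r addNr.
have [[N hN] [N' hN']] := (gcomp_bound u, gcomp_bound v).
have hL i := gcomp_linear Hgr i c u v.
rewrite !(@fsbig_nat_bound _ (maxn N N')); first last.
- by move=> i; rewrite geq_max => /andP[? ?]; rewrite hL hN // hN' // scaler0 addr0 G0.
- by move=> i; rewrite geq_max => /andP[? ?]; rewrite hN // G0.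
- by move=> i; rewrite geq_max => /andP[? ?]; rewrite hN' // G0.
by rewrite scaler_sumr -big_split; apply: eq_bigr => i _; rewrite hL hG.
Qed.

Lemma fsbig_gcomp_deg (M : lmodType k) (G : nat -> H -> M) n u :
  (forall i, G i 0 = 0) -> gdeg n u ->
  \sum_(i \in [set: nat]) G i (gcomp i u) = G n u.
Proof.
move=> G0 hu.
rewrite -(@fsbig_widen _ _ _ _ [set n]%classic) ?fsbig_set1 //; first by rewrite hu.
move=> i /= [_ /eqP ne]; rewrite -hu (gcomp_proj Hgr) (negbTE ne); exact: G0.
Qed.

Lemma gsign_deg n (u : H) : gdeg n u -> gsign u = (-1) ^+ n *: u.
Proof.
by apply: (fsbig_gcomp_deg (G := fun i u => (-1) ^+ i *: u)) => i; exact: scaler0.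
Qed.

Lemma super_mul_deg i j (a b c d : H) :
  bilinear_map (@gmul k H) -> gdeg i b -> gdeg j c ->
  super_mul (a \ot b) (c \ot d) =
  (-1) ^+ (i * j) *: (gmul a c \ot gmul b d).
Proof.
move=> [ml mr] hb hc.
pose G a b d i j c : tensor H H := (-1) ^+ (i * j) *: (gmul a c \ot gmul b d).
have Gc a' b' d' m n : linear (G a' b' d' m n).
  by move=> e u v; rewrite /G mr (pure_bilinear H H).1 scalerDr !scalerA mulrC.
have Gb a' d' m n c' : linear (fun b' => G a' b' d' m n c').
  by move=> e u v; rewrite /G ml (pure_bilinear H H).2 scalerDr !scalerA mulrC.
have Gd a' b' m n c' : linear (fun d' => G a' b' d' m n c').
  by move=> e u v; rewrite /G mr (pure_bilinear H H).2 scalerDr !scalerA mulrC.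
have Ga b' d' m n c' : linear (fun a' => G a' b' d' m n c').
  by move=> e u v; rewrite /G ml (pure_bilinear H H).1 scalerDr !scalerA mulrC.
pose G1 a b d i c : tensor H H := \sum_(j \in [set: nat]) G a b d i j (gcomp j c).
have fam (M : lmodType k) (F : H -> nat -> H -> M) (x : H) :
    (forall n, linear (fun y => F y n (gcomp n x))) -> (forall y n, F y n 0 = 0) ->
    linear (fun y => \sum_(n \in [set: nat]) F y n (gcomp n x)).
  move=> hF F0 e u v; have [N hN] := gcomp_bound x.
  rewrite !(@fsbig_nat_bound _ N); try by move=> n /hN ->; exact: F0.
  by rewrite scaler_sumr -big_split; apply: eq_bigr => n _; rewrite hF.
have lin0 (M : lmodType k) (g : H -> M) : linear g -> g 0 = 0.
  by move=> gl; have := gl (-1) 0 0; rewrite scaler0 addr0 scaleN1r addNr.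
have G1c a' b' d' m : linear (G1 a' b' d' m) by exact: fsbig_gcomp_linear.
have G1b a' d' m c' : linear (fun b' => G1 a' b' d' m c').
  by apply: (fam _ (fun b' n x => G a' b' d' m n x)) => // y n; exact/lin0.
have G1d a' b' m c' : linear (fun d' => G1 a' b' d' m c').
  by apply: (fam _ (fun d' n x => G a' b' d' m n x)) => // y n; exact/lin0.
have G1a b' d' m c' : linear (fun a' => G1 a' b' d' m c').
  by apply: (fam _ (fun a' n x => G a' b' d' m n x)) => // y n; exact/lin0.
pose G2 a b c d : tensor H H :=
  \sum_(i \in [set: nat]) G1 a (gcomp i b) d i c.
have G2b a' c' d' : linear (fun b' => G2 a' b' c' d').
  exact: (fsbig_gcomp_linear (G := fun m x => G1 a' x d' m c')).
have G2c a' b' d' : linear (fun c' => G2 a' b' c' d').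
  by apply: (fam _ (fun y n x => G1 a' x d' n y)) => // y n; exact: (lin0 _ _ (G1b _ _ _ _)).
have G2d a' b' c' : linear (G2 a' b' c').
  by apply: (fam _ (fun y n x => G1 a' x y n c')) => // y n; exact: (lin0 _ _ (G1b _ _ _ _)).
have G2a b' c' d' : linear (fun a' => G2 a' b' c' d').
  by apply: (fam _ (fun y n x => G1 y x d' n c')) => // y n; exact: (lin0 _ _ (G1b _ _ _ _)).
have -> : super_mul (a \ot b) (c \ot d) = G2 a b c d.
  rewrite /super_mul.
  rewrite (@tsum_pure _ _ _ _ (fun a' b' => \sw_(c', d' <- c \ot d) G2 a' b' c' d')).
    by rewrite (@tsum_pure _ _ _ _ (fun c' d' => G2 a b c' d')).
  split=> [b'|a'] e u v; apply: tsum_comb => c' d'; [exact: G2a | exact: G2b].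
rewrite /G2 (fsbig_gcomp_deg (G := fun m x => G1 a x d m c) _ hb); last first.
  by move=> m; exact: (lin0 _ _ (G1b _ _ _ _)).
rewrite /G1 (fsbig_gcomp_deg (G := G a b d i) _ hc) // => m; exact: lin0.
Qed.
End SuperTheory.

(* Main.v *)
(* Put H = A # Sh_-(L). An element u of H is determined by its degree zero     *)

(* Why it works. As a vector space, H = A # Sh_-(L) is the direct sum of A and H (x) L: an element
   either has no letters or has a last one. So elements are compared on their component in A
   ([hproj]) and on their last letters ([unsnoc]), and the second comparison only concerns shorter
   elements. This splitting suits the problem because the braided binomials and delta both recurse
   on the last tensor factor. The last letter of u v is that of v, or that of u carried past all of
   v; each crossing costs a sign, makes the crossed letter coact, and lets the resulting element of
   A act on the travelling letter. Thus the product is governed by the rule [unsnoc_hmul], in which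
   only the coaction [hcoact] and the parity [hsign] appear. Similarly, d either works before the
   last letter or appends omega(pi(a)), a being the A-leg of the coaction ([sw_unsnoc_hd]), and a
   cut made by Delta either leaves the last letter on the right or comes after it ([hDelta_snoc]).

   Read on last letters, each axiom reduces to a property of the first order data. The crossed
   module condition makes [hcoact] multiplicative ([hcoact_hmul]); from this follow associativity
   ([hmulA]) and the multiplicativity of Delta ([hDelta_hmul]). That omega is a module map gives the
   cocycle identity [germM], hence the Leibniz rule ([hd_hmul]). That omega is a comodule map makes
   d colinear ([hcoact_hd]). In d(d u) each appended letter then occurs twice, and the two terms
   cancel because d is odd ([hd_hd]); the co-Leibniz rule ([hDelta_hd]) is similar.

   For the inner formula, the last letters of theta u - (-1)^|u| u theta are those of d u exactly
   when omega(pi(a)) is theta acted on by a, minus eps(a) theta, and Psi(x (x) theta) = theta (x) x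
   ([inner_hd]). Conversely, degrees 0 and 1 already force these two conditions ([inner_germ],
   [inner_braid]). The antipode exists because a convolution inverse in degree zero extends along
   the grading ([graded_antipode]). *)
(* part in A and by its last letter map unsnoc u in H (x) L, which splits off  *)
(* the last tensor factor; write r for unsnoc and c for the right coaction     *)
(* hcoact : H -> H (x) A. The recursive definition of the braided binomials    *)
(* becomes the product rule                                                    *)
(*   r (u v) = u r(v) + r(u) . c(sign v),                                      *)
(* where the A-leg of c acts on the letter of r(u), and likewise               *)
(*   r (d u) = (d (x) id) (r u) + (id (x) omega pi) (c (sign u)),              *)
(*   (id (x) r) (Delta u) = (Delta (x) id) (r u),                              *)
(* while r is colinear. Associativity, multiplicativity of Delta, the Leibniz  *)
(* and co-Leibniz rules, d^2 = 0 and the inner formula therefore all follow by *)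
(* induction on the number of letters, by comparing degree zero parts and last *)
(* letters. The antipode of A, extended by zero, inverts the identity for the  *)
(* convolution product in degree zero, and fixed-point iteration along the     *)
(* grading turns this into an inverse in all degrees.                          *)
Require Import Defs.
From mathcomp Require Import all_boot all_algebra.
From mathcomp Require Import boolp classical_sets fsbigop.
From mathcomp Require Import freeg.

Set Implicit Arguments.
Unset Strict Implicit.
Unset Printing Implicit Defensive.

Import GRing.Theory.
Local Open Scope ring_scope.

(** * Linear, bilinear and trilinear maps *)

Section LinearMaps.
Variable k : fieldType.
Implicit Types U V W M N : lmodType k.

(* Linearity with the lmodType structures as indices, so that the tactic lin  *)
(* below can apply lemmas without inferring structures.                       *)
Variant linmap U V (f : U -> V) : Prop := LinMap of linear f.

Lemma linmapP U V (f : U -> V) : linmap f -> linear f.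
Proof. by case. Qed.

Lemma linmap_bilinear U V W (f : U -> V -> W) :
  (forall v, linmap (f^~ v)) -> (forall u, linmap (f u)) -> bilinear_map f.
Proof. by move=> h h'; split=> ?; apply: linmapP. Qed.

Lemma linear_comb V W (f g : V -> W) c u v : linear f -> linear g ->
  f u = g u -> f v = g v -> f (c *: u + v) = g (c *: u + v).
Proof. by move=> fL gL fgu fgv; rewrite fL gL fgu fgv. Qed.

Lemma linmap_comb V W (f g : V -> W) c u v : linmap f -> linmap g ->
  f u = g u -> f v = g v -> f (c *: u + v) = g (c *: u + v).
Proof. by move=> [fL] [gL]; exact: linear_comb. Qed.

Lemma linmap_id V : linmap (fun x : V => x).
Proof. by split. Qed.

Lemma linmap_comp U V W (g : V -> W) (f : U -> V) :
  linmap g -> linmap f -> linmap (fun x => g (f x)).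
Proof. by move=> [gL] [fL]; split=> c x y; rewrite fL gL. Qed.

Lemma linmap_bill U V W M (g : V -> W -> M) (f : U -> V) w :
  bilinear_map g -> linmap f -> linmap (fun x => g (f x) w).
Proof. by move=> [gL _] [fL]; split=> c x y; rewrite fL gL. Qed.

Lemma linmap_bilr U V W M (g : V -> W -> M) (f : U -> W) v :
  bilinear_map g -> linmap f -> linmap (fun x => g v (f x)).
Proof. by move=> [_ gL] [fL]; split=> c x y; rewrite fL gL. Qed.

Lemma linmap_add V W (f g : V -> W) :
  linmap f -> linmap g -> linmap (fun x => f x + g x).
Proof. by move=> [fL] [gL]; split=> c x y; rewrite fL gL scalerDr addrACA. Qed.

Lemma linmap_opp V W (f : V -> W) : linmap f -> linmap (fun x => - f x).
Proof. by move=> [fL]; split=> c x y; rewrite fL opprD scalerN. Qed.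

Lemma linmap_scaler V W (f : V -> W) c : linmap f -> linmap (fun x => c *: f x).
Proof. by move=> [fL]; split=> e x y; rewrite fL scalerDr !scalerA mulrC. Qed.

Lemma linmap_scalel V W (f : V -> k^o) (w : W) :
  linmap f -> linmap (fun x => (f x : k) *: w).
Proof. by move=> [fL]; split=> c x y; rewrite fL scalerDl scalerA. Qed.

Lemma linmap_zero V W : linmap (fun _ : V => 0 : W).
Proof. by split=> c x y; rewrite scaler0 addr0. Qed.

Lemma linmap_sum V W I (r : seq I) (P : pred I) (F : I -> V -> W) :
  (forall i, linmap (F i)) -> linmap (fun x => \sum_(i <- r | P i) F i x).
Proof.
move=> FL; split=> c x y; rewrite scaler_sumr -big_split.
by apply: eq_bigr => i _; exact: linmapP.
Qed.

Lemma linmap_tsum U V W M (f : V -> W -> M) (g : U -> tensor V W) :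
  bilinear_map f -> linmap g -> linmap (fun x => tsum (g x) f).
Proof. by move=> hf [hg]; split; exact: linear_tsum. Qed.

(** The summand need not be bilinear in the summation variables: over the chosen representative of
    [x] the sum is a fixed finite combination of values of [F n]. *)
Lemma linmap_tsum_family V W N M (F : N -> V -> W -> M) (x : tensor V W) :
  (forall v w, linmap (fun n => F n v w)) -> linmap (fun n => tsum x (F n)).
Proof. by move=> hF; split; apply: tsum_family => v w; exact: linmapP. Qed.

Lemma lin0 V W (f : V -> W) : linear f -> f 0 = 0.
Proof. by move=> fL; have := fL (-1) 0 0; rewrite scaler0 addr0 scaleN1r addNr. Qed.

Lemma linZ V W (f : V -> W) c x : linear f -> f (c *: x) = c *: f x.
Proof. by move=> fL; rewrite -[c *: x]addr0 fL (lin0 fL) addr0. Qed.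

Lemma linN V W (f : V -> W) x : linear f -> f (- x) = - f x.
Proof. by move=> fL; rewrite -scaleN1r linZ // scaleN1r. Qed.

Lemma linD V W (f : V -> W) x y : linear f -> f (x + y) = f x + f y.
Proof. by move=> fL; rewrite -[x]scale1r fL !scale1r. Qed.

Lemma lin_sum V W (f : V -> W) I (r : seq I) (P : pred I) (F : I -> V) :
  linear f -> f (\sum_(i <- r | P i) F i) = \sum_(i <- r | P i) f (F i).
Proof.
move=> fL; apply: (big_morph f) => [x y|]; first exact: linD.
exact: lin0.
Qed.

Lemma mul_bilinear (B : algType k) : bilinear_map (@GRing.mul B).
Proof.
split=> [w|v] c x y; first by rewrite mulrDl scalerAl.
by rewrite mulrDr scalerAr.
Qed.

Lemma linmap_mull U (B : algType k) (f : U -> B) b :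
  linmap f -> linmap (fun x => f x * b).
Proof. by move=> [fL]; split=> c x y; rewrite fL mulrDl scalerAl. Qed.

Lemma linmap_mulr U (B : algType k) (f : U -> B) b :
  linmap f -> linmap (fun x => b * f x).
Proof. by move=> [fL]; split=> c x y; rewrite fL mulrDr scalerAr. Qed.

Lemma linmap_tw1 U V (f : U -> V) : linmap f -> linmap (fun u => tw [:: f u]).
Proof. by move=> [fL]; split=> c x y; rewrite fL tw1_linear. Qed.

Lemma bilZl U V W (f : U -> V -> W) c x y :
  bilinear_map f -> f (c *: x) y = c *: f x y.
Proof. by move=> [fL _]; exact: (linZ c x (fL y)). Qed.

Lemma bilZr U V W (f : U -> V -> W) c x y :
  bilinear_map f -> f x (c *: y) = c *: f x y.
Proof. by move=> [_ fL]; exact: (linZ c y (fL x)). Qed.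

Lemma bilDl U V W (f : U -> V -> W) x x' y :
  bilinear_map f -> f (x + x') y = f x y + f x' y.
Proof. by move=> [fL _]; exact: (linD x x' (fL y)). Qed.

Lemma bilDr U V W (f : U -> V -> W) x y y' :
  bilinear_map f -> f x (y + y') = f x y + f x y'.
Proof. by move=> [_ fL]; exact: (linD y y' (fL x)). Qed.

Lemma bilNl U V W (f : U -> V -> W) x y : bilinear_map f -> f (- x) y = - f x y.
Proof. by move=> [fL _]; exact: (linN x (fL y)). Qed.

Lemma bilNr U V W (f : U -> V -> W) x y : bilinear_map f -> f x (- y) = - f x y.
Proof. by move=> [_ fL]; exact: (linN y (fL x)). Qed.

Lemma bil0l U V W (f : U -> V -> W) y : bilinear_map f -> f 0 y = 0.
Proof. by move=> [fL _]; exact: (lin0 (fL y)). Qed.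

Lemma bil0r U V W (f : U -> V -> W) x : bilinear_map f -> f x 0 = 0.
Proof. by move=> [_ fL]; exact: (lin0 (fL x)). Qed.

Lemma linmap_Delta (A : hopfAlgebra k) : linmap (Delta : A -> tensor A A).
Proof. by split; exact: linearP. Qed.

Lemma linmap_eps (A : hopfAlgebra k) : linmap (eps : A -> k^o).
Proof. by split; exact: linearP. Qed.

Lemma linmap_eps_comp U (A : hopfAlgebra k) (f : U -> A) :
  linmap f -> @linmap U k^o (fun x => eps (f x)).
Proof. by move=> [fL]; split=> c x y; rewrite fL linearP. Qed.

Lemma linmap_antipode (A : hopfAlgebra k) : linmap (antipode : A -> A).
Proof. by split; exact: linearP. Qed.
End LinearMaps.
Arguments linear_comb {k V W f g c u v}.
Arguments linmap_comb {k V W f g c u v}.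

Definition trilinear_map (k : fieldType) (U V W M : lmodType k)
    (F : U -> V -> W -> M) : Prop :=
  (forall a, bilinear_map (F a)) /\ (forall b c, linear (fun a => F a b c)).

Lemma linmap_trilinear (k : fieldType) (U V W M : lmodType k)
    (F : U -> V -> W -> M) :
  (forall a, bilinear_map (F a)) -> (forall b c, linmap (fun a => F a b c)) ->
  trilinear_map F.
Proof. by move=> h h'; split=> // b c; exact: linmapP. Qed.

Lemma trilinear_bil (k : fieldType) (U V W M : lmodType k)
    (F : U -> V -> W -> M) a : trilinear_map F -> bilinear_map (F a).
Proof. by case. Qed.

Lemma linmap_tri (k : fieldType) (N U V W M : lmodType k)
    (F : U -> V -> W -> M) (f : N -> U) b c :
  trilinear_map F -> linmap f -> linmap (fun x => F (f x) b c).
Proof. by move=> [_ FL] [fL]; split=> e x y; rewrite fL FL. Qed.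

(* Automated proofs of linearity *)
Create HintDb lin discriminated.
#[export] Hint Constants Opaque : lin.
#[export] Hint Resolve pure_bilinear mul_bilinear tcat_bilinear : lin.
#[export] Hint Resolve linmap_id linmap_zero linmap_Delta linmap_eps linmap_antipode : lin.

#[export] Hint Extern 2 (bilinear_map (_ _)) =>
  simple eapply trilinear_bil; eassumption : lin.

(* The binder lin_arg of the patterns must not be the name of a hypothesis:   *)
(* Ltac would confuse the two in the terms that it matches.                   *)
Ltac lin_step :=
  lazymatch goal with
  | |- bilinear_map _ => apply: linmap_bilinear; cbv beta
  | |- trilinear_map _ => apply: linmap_trilinear; cbv beta
  | |- forall _, _ => intro; cbv beta
  | |- GRing.linear_for _ _ => apply: linmapP; cbv beta
  | |- @linmap ?k ?U ?V ?F =>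
    change (@linmap k U V (fun lin_arg => F lin_arg)); cbv beta;
    lazymatch goal with
    | |- linmap (fun lin_arg => lin_arg) => exact: linmap_id
    | |- linmap (fun lin_arg => tsum _ _) =>
      first [ apply: linmap_tsum; cbv beta | apply: linmap_tsum_family; cbv beta ]
    | |- linmap (fun lin_arg => \sum_(_ <- _ | _) _) => apply: linmap_sum; cbv beta
    | |- linmap (fun lin_arg => GRing.add _ _) => apply: linmap_add
    | |- linmap (fun lin_arg => GRing.opp _) => apply: linmap_opp
    | |- linmap (fun lin_arg => GRing.scale _ _) =>
      first [ apply: linmap_scaler | apply: linmap_scalel ]
    | |- linmap (fun lin_arg => GRing.mul _ _) =>
      first [ apply: linmap_mull | apply: linmap_mulr ]
    | |- linmap (fun lin_arg => tw (_ :: _)) => apply: linmap_tw1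
    | |- linmap (fun lin_arg => @GRing.Linear.sort _ _ _ _ (@eps _ _) _) =>
      apply: linmap_eps_comp
    | |- linmap (fun lin_arg => ?g (@?f lin_arg)) =>
      first
      [ eapply (linmap_comp (g := g) (f := f)); [solve [auto 2 with lin nocore]|]
      | lazymatch goal with
        | |- linmap (fun lin_arg => ?h (@?e lin_arg) (@?f lin_arg)) =>
          first
          [ eapply (linmap_bill (g := h) (f := e)); [solve [auto 2 with lin nocore]|]
          | eapply (linmap_bilr (g := h) (f := f)); [solve [auto 2 with lin nocore]|]
          | lazymatch goal with
            | |- linmap (fun lin_arg => ?h (@?d lin_arg) (@?e lin_arg) (@?f lin_arg)) =>
              eapply (linmap_tri (F := h) (f := d)); [eassumption|]
            end ]
        end ]
    end
  end.
(** Follows the syntax of the map down to constants whose linearity is registered in the database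
    [lin], or to trilinear maps among the hypotheses. Bilinear and trilinear goals are split into
    linearity in each variable. *)
Ltac lin := first [ lin_step; [lin ..] | solve [ auto 2 with lin nocore ] ].

(** * Rules for Sweedler sums *)

Section SweedlerSums.
Variable k : fieldType.
Implicit Types U V W M N : lmodType k.

(** One list serves all [M] and [f], since it is read off from the chosen representative of [x].
    Hence exchanging, adding and scaling Sweedler sums needs no bilinearity; only a change of the
    tensor itself does. *)
Lemma tsum_repr V W (x : tensor V W) :
  exists r : seq (k * (V * W)),
    forall M (f : V -> W -> M), tsum x f = \sum_(i <- r) i.1 *: f i.2.1 i.2.2.
Proof.
exists (fgenum (repr x)) => M f.
by rewrite /tsum /fqlift -[in LHS](Freeg_enum (repr x)) fglift_Freeg.
Qed.

Lemma tsumC V W V' W' M (x : tensor V W) (y : tensor V' W')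
    (F : V -> W -> V' -> W' -> M) :
  \sw_(a, b <- x) \sw_(c, d <- y) F a b c d =
  \sw_(c, d <- y) \sw_(a, b <- x) F a b c d.
Proof.
have [[r hr] [s hs]] := (tsum_repr x, tsum_repr y); rewrite hr hs.
under eq_bigr do rewrite hs scaler_sumr.
under [RHS]eq_bigr do rewrite hr scaler_sumr.
rewrite exchange_big /=; apply: eq_bigr => i _; apply: eq_bigr => j _.
by rewrite !scalerA mulrC.
Qed.

Lemma tsum_add V W M (x : tensor V W) (f g : V -> W -> M) :
  \sw_(a, b <- x) (f a b + g a b) = tsum x f + tsum x g.
Proof.
by rewrite -[tsum x f]scale1r; apply: tsum_comb => v w; rewrite scale1r.
Qed.

Lemma tsum_zero V W M (x : tensor V W) : \sw_(a, b <- x) (0 : M) = 0.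
Proof. by have [r ->] := tsum_repr x; rewrite big1 // => i _; rewrite scaler0. Qed.

Lemma tsum_scale V W M (x : tensor V W) c (f : V -> W -> M) :
  \sw_(a, b <- x) (c *: f a b) = c *: tsum x f.
Proof.
by rewrite -[RHS]addr0 -(tsum_zero M x); apply: tsum_comb => v w; rewrite addr0.
Qed.

Lemma tsum_opp V W M (x : tensor V W) (f : V -> W -> M) :
  \sw_(a, b <- x) (- f a b) = - tsum x f.
Proof. by rewrite -scaleN1r -tsum_scale; apply: eq_tsum => a b; rewrite scaleN1r. Qed.

(** Pure tensors span. The zero tensor, needed for the empty combination, is the difference of a
    pure tensor with itself. *)
Lemma tensor_ind V W (P : tensor V W -> Prop) :
  (forall c u v, P u -> P v -> P (c *: u + v)) ->
  (forall v w, P (v \ot w)) -> forall x, P x.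
Proof.
move=> PL Pp x; have [r ->] := fq_gen_sum x.
have P0 : P 0 by rewrite -(subrr (0 \ot 0)) addrC -scaleN1r; apply: PL.
elim: r => [|i r IHr]; first by rewrite big_nil.
rewrite big_cons; apply: PL => //; case: i => c [v w]; exact: Pp.
Qed.

Lemma tspace_ind V (P : tspace V -> Prop) :
  (forall c u v, P u -> P v -> P (c *: u + v)) ->
  (forall s, P (tw s)) -> forall x, P x.
Proof.
move=> PL Pp x; have [r ->] := fq_gen_sum x.
have P0 : P 0 by rewrite -(subrr (tw [::])) addrC -scaleN1r; apply: PL.
elim: r => [|i r IHr]; first by rewrite big_nil.
rewrite big_cons; apply: PL => //; exact: Pp.
Qed.

Lemma tspace_ext V M (f g : tspace V -> M) : linmap f -> linmap g ->
  (forall s, f (tw s) = g (tw s)) -> f =1 g.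
Proof.
by move=> [fL] [gL] fg; apply: tspace_ind => // c u v hu hv; rewrite fL gL hu hv.
Qed.

Lemma tsum_pure_id V W (x : tensor V W) : \sw_(a, b <- x) a \ot b = x.
Proof.
elim/tensor_ind: x => [c u v hu hv|v w]; last by rewrite tsum_pure //; lin.
by rewrite tsum_linear ?hu ?hv //; lin.
Qed.

Lemma tsum_tsum V W V' W' M (x : tensor V W) (G : V -> W -> tensor V' W')
    (f : V' -> W' -> M) : bilinear_map f ->
  tsum (tsum x G) f = \sw_(a, b <- x) tsum (G a b) f.
Proof.
by move=> fL; rewrite (@linear_of_tsum _ _ _ _ _ x G (fun z => tsum z f)) //; lin.
Qed.

Lemma tsum0 V W M (f : V -> W -> M) : bilinear_map f -> tsum 0 f = 0.
Proof. by move=> /tsum_linear/lin0. Qed.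

Lemma tsumDl V W M (f : V -> W -> M) x y : bilinear_map f ->
  tsum (x + y) f = tsum x f + tsum y f.
Proof. by move=> /tsum_linear h; exact: linD h. Qed.

Lemma tsumZl V W M (f : V -> W -> M) c x : bilinear_map f ->
  tsum (c *: x) f = c *: tsum x f.
Proof. by move=> /tsum_linear h; exact: linZ h. Qed.

Lemma tsumNl V W M (f : V -> W -> M) x : bilinear_map f ->
  tsum (- x) f = - tsum x f.
Proof. by move=> /tsum_linear h; exact: linN h. Qed.

(* Lifts an equality of threefold tensors to Sweedler sums of any trilinear F. *)
Lemma tsum3E U V W M (F : U -> V -> W -> M) (I J I' J' : lmodType k)
    (x : tensor I J) (y : I -> J -> tensor I' J')
    (f : I -> J -> I' -> J' -> U) (g : I -> J -> I' -> J' -> V)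
    (h : I -> J -> I' -> J' -> W) : trilinear_map F ->
  \sw_(a, bc <- \sw_(i, j <- x) \sw_(i', j' <- y i j)
        f i j i' j' \ot (g i j i' j' \ot h i j i' j')) \sw_(b, c <- bc) F a b c =
  \sw_(i, j <- x) \sw_(i', j' <- y i j) F (f i j i' j') (g i j i' j') (h i j i' j').
Proof.
move=> [F1 F2].
have FL : bilinear_map (fun a bc => \sw_(b, c <- bc) F a b c).
  split=> [bc|a]; last exact: tsum_linear.
  by apply: tsum_family => b c; exact: F2.
rewrite tsum_tsum //; apply: eq_tsum => i j; rewrite tsum_tsum //.
by apply: eq_tsum => i' j'; rewrite tsum_pure // tsum_pure.
Qed.
End SweedlerSums.

(** * Hopf algebra axioms inside Sweedler sums *)

Section SweedlerHopf.
Variables (k : fieldType) (A : hopfAlgebra k).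
Implicit Types (M : lmodType k) (a : A).

(** The axiom is an equality in A (x) (A (x) A); by the universal property it passes to every
    trilinear [F]. The other coassociativity laws below are transported in the same way. *)
Lemma sw_DeltaA M (F : A -> A -> A -> M) a : trilinear_map F ->
  \sw_(a1, a2 <- Delta a) \sw_(b, c <- Delta a1) F b c a2 =
  \sw_(a1, a2 <- Delta a) \sw_(b, c <- Delta a2) F a1 b c.
Proof.
move=> FL; rewrite -(tsum3E _ _ (fun _ _ b _ => b) (fun _ _ _ c => c) (fun _ a2 _ _ =>
  a2) FL).
by rewrite DeltaA tsum3E.
Qed.

Lemma sw_epsl M (f : A -> M) a : linear f ->
  \sw_(a1, a2 <- Delta a) eps a1 *: f a2 = f a.
Proof.
move=> fL; rewrite -[in RHS](Delta_epsl a) (linear_of_tsum _ _ fL).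
by apply: eq_tsum => a1 a2; rewrite linZ.
Qed.

Lemma sw_epsr M (f : A -> M) a : linear f ->
  \sw_(a1, a2 <- Delta a) eps a2 *: f a1 = f a.
Proof.
move=> fL; rewrite -[in RHS](Delta_epsr a) (linear_of_tsum _ _ fL).
by apply: eq_tsum => a1 a2; rewrite linZ.
Qed.

Lemma sw_antipoder M (f : A -> M) a : linear f ->
  \sw_(a1, a2 <- Delta a) f (a1 * antipode a2) = eps a *: f 1.
Proof. by move=> fL; rewrite -(linear_of_tsum _ _ fL) antipoder linZ. Qed.
End SweedlerHopf.

Opaque pure tsum tw wsum.

(** * Words and the shuffle product, read from the last letter *)

Section Words.
Variables (k : fieldType) (A : hopfAlgebra k) (L : crossedData A).
Hypothesis LX : crossed_module L.
Local Notation T := (tspace L).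

Let act_bil : bilinear_map (@act k A L) := act_bilinear LX.
Let linmap_coact : linmap (@coact k A L) := LinMap (coact_linear LX).
Local Hint Resolve act_bil linmap_coact : lin.

Lemma tcatA (V : lmodType k) : associative (@tcat k V).
Proof.
have tb := @tcat_bilinear k V.
elim/tspace_ind => [c u v hu hv y z|s y z]; first by rewrite !tb.1 hu hv.
elim/tspace_ind: y => [c u v hu hv|t]; first by rewrite !(tb.1, tb.2) hu hv.
elim/tspace_ind: z => [c u v hu hv|r]; first by rewrite !tb.2 hu hv.
by rewrite !tcat_tw catA.
Qed.

Lemma tw_rcons (V : lmodType k) (s : seq V) v : tw (rcons s v) = tcat (tw s) (tw [:: v]).
Proof. by rewrite tcat_tw cats1. Qed.

Lemma tcat1x (V : lmodType k) (x : tspace V) : tcat (tw [::]) x = x.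
Proof.
elim/tspace_ind: x => [c u v hu hv|s]; first by rewrite (tcat_bilinear V).2 hu hv.
by rewrite tcat_tw.
Qed.

Lemma tcatx1 (V : lmodType k) (x : tspace V) : tcat x (tw [::]) = x.
Proof.
elim/tspace_ind: x => [c u v hu hv|s]; first by rewrite (tcat_bilinear V).1 hu hv.
by rewrite tcat_tw cats0.
Qed.

Lemma tspace_snoc_ind (V : lmodType k) (P : tspace V -> Prop) :
  (forall c u v, P u -> P v -> P (c *: u + v)) ->
  P (tw [::]) -> (forall x v, P x -> P (tcat x (tw [:: v]))) -> forall x, P x.
Proof.
move=> PL P1 PS; apply: tspace_ind => //; elim/last_ind => // s v Ps.
by rewrite tw_rcons; apply: PS.
Qed.

(** [word_coact] and [word_act] recurse on the first letter, while the rest of the proof removes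
    last letters. The two readings agree by associativity of A here and by coassociativity in
    [word_act_rcons]. *)
Lemma word_coact_rcons (s : seq L) v : word_coact (rcons s v) =
  \sw_(y, b <- word_coact s) \sw_(v0, v1 <- coact v)
    tcat y (tw [:: v0]) \ot (b * v1) :> tensor T A.
Proof.
elim: s => [|x s IHs] /=.
  rewrite [RHS]tsum_pure; last by lin.
  apply: eq_tsum => v0 v1; rewrite tsum_pure; last by lin.
  by rewrite tcatx1 tcat1x mulr1 mul1r.
rewrite [RHS]tsum_tsum; last by lin.
apply: eq_tsum => x0 x1; rewrite IHs !tsum_tsum; try by lin.
apply: eq_tsum => y b; rewrite tsum_tsum; last by lin.
rewrite [RHS]tsum_pure; last by lin.
apply: eq_tsum => v0 v1; rewrite tsum_pure; last by lin.
by rewrite tcatA mulrA.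
Qed.

Lemma linmap_word_act (s : seq L) : linmap (word_act s).
Proof.
split=> c u v; have := (sh_act_bilinear LX).2 (tw s) c u v.
by rewrite !sh_act_tw.
Qed.
Local Hint Resolve linmap_word_act : lin.

Lemma word_act_rcons (s : seq L) v (a : A) : word_act (rcons s v) a =
  \sw_(a1, a2 <- Delta a) tcat (word_act s a1) (tw [:: act v a2]).
Proof.
elim: s a => [|x s IHs] a /=.
  have E a1 a2 : eps a1 *: tw [:: act v a2] = tcat (eps a1 *: tw [::]) (tw [:: act v a2]).
    by rewrite (bilZl _ _ _ (tcat_bilinear L)) tcat1x.
  under [RHS]eq_tsum => a1 a2 do rewrite -E.
  rewrite (@sw_epsl _ _ _ (fun a => tw [:: act v a])); last by lin.
  rewrite -[RHS](@sw_epsr _ _ _ (fun a => tw [:: act v a])); last by lin.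
  by apply: eq_tsum => a1 a2; rewrite (bilZr _ _ _ (tcat_bilinear L)) tcatx1.
under eq_tsum => a1 a2 do rewrite IHs.
have E a1 a2 : tcat (tw [:: act x a1])
    (\sw_(b, c <- Delta a2) tcat (word_act s b) (tw [:: act v c])) =
    \sw_(b, c <- Delta a2) tcat (tcat (tw [:: act x a1]) (word_act s b)) (tw [:: act v c]).
  rewrite (linear_of_tsum _ _ ((tcat_bilinear L).2 _)).
  by apply: eq_tsum => b c; rewrite tcatA.
under eq_tsum => a1 a2 do rewrite E.
rewrite -(@sw_DeltaA _ _ _ (fun a b c => tcat (tcat
  (tw [:: act x a]) (word_act s b)) (tw [:: act v c])) a); last by lin.
by apply: eq_tsum => a1 a2; rewrite (linear_of_tsum _ _ ((tcat_bilinear L).1 _)).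
Qed.

Let wpair (z : tensor L L) : T := \sw_(a, b <- z) tw [:: a; b].

Let linmap_wpair : linmap wpair.
Proof.
apply: linmap_tsum; last exact: linmap_id.
have E (a b : L) : tw [:: a; b] = tcat (tw [:: a]) (tw [:: b]) by rewrite tcat_tw.
have -> : (fun a b : L => tw [:: a; b]) = (fun a b : L => tcat (tw [:: a]) (tw [:: b])).
  by apply/funext => a; apply/funext => b.
lin.
Qed.
Local Hint Resolve linmap_wpair : lin.

Lemma op_at_tw (psi : tensor L L -> tensor L L) (s t : seq L) v w : linear psi ->
  op_at psi (size s).+1 (tw (s ++ v :: w :: t)) =
  \sw_(v', w' <- psi (v \ot w)) tw (s ++ v' :: w' :: t).
Proof.
move=> psiL; have psiL' := LinMap psiL.
(* The summand of [op_at], rewritten with concatenations so that [lin] can see its dependence on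
   each letter. *)
pose F (j : nat) (s : seq L) := if drop j s is v :: w :: t then
  tcat (tcat (tw (take j s)) (wpair (psi (v \ot w)))) (tw t) else 0.
have FE j r : (if drop j r is v :: w :: t then
    \sw_(v', w' <- psi (v \ot w)) tw (take j r ++ v' :: w' :: t) else 0) = F j r.
  rewrite /F; case: (drop j r) => [|a [|b q]] //.
  have h : linear (fun z => tcat (tcat (tw (take j r)) z) (tw q)) by lin.
  rewrite (linear_of_tsum _ _ h); apply: eq_tsum => a' b'.
  by rewrite !tcat_tw -catA.
have FL j : multilinear (F j).
  move=> p q c x y; rewrite /F !take_cat !drop_cat; case: ltnP => [lt_jp|le_pj].
    case: (drop j p) => [|a [|b r]] /=.
    - case: q => [|b q]; first by rewrite scaler0 addr0.
      have h : linear (fun z => tcat (tcat (tw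
        (take j p)) (wpair (psi (z \ot b)))) (tw q)) by lin.
      by rewrite h.
    - have h : linear (fun z => tcat (tcat (tw
        (take j p)) (wpair (psi (a \ot z)))) (tw q)) by lin.
      by rewrite h.
    by rewrite tw_multilinear (tcat_bilinear L).2.
  case: (j - size p)%N => [|i] /=.
    case: q => [|b q]; first by rewrite scaler0 addr0.
    have h : linear (fun z => tcat (tcat (tw (p ++ [::])) (wpair (psi (z \ot b)))) (tw
      q)) by lin.
    by rewrite h.
  case: (drop i q) => [|a [|b r]]; rewrite ?scaler0 ?addr0 //.
  by rewrite tw_multilinear !(tcat_bilinear L).1.
have -> : op_at psi (size s).+1 (tw (s ++ v :: w :: t)) = wsum (tw
  (s ++ v :: w :: t)) (F (size s)).
  by congr wsum; apply/funext => r; exact: FE.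
by rewrite wsum_tw // -FE drop_size_cat // take_size_cat.
Qed.

Let nbraid : tensor L L -> tensor L L := fun z => - braid z.

Let nbraid_linear : linear nbraid.
Proof. by move=> c u v; rewrite /nbraid (braid_linear LX) opprD scalerN. Qed.

Let foldl_op_at_linear l : linear (fun x => foldl (fun y i => op_at nbraid i y) x l).
Proof.
elim: l => [|i l IHl] c x y //=.
by rewrite (op_at_linear _ nbraid_linear) IHl.
Qed.

(** The composite of braidings in the binomial recursion carries [x] to the right end. Each crossing
    gives a sign and a coaction of the crossed letter, whose A-leg acts on [x]; successive actions
    multiply to the A-leg of the coaction of the whole word [t]. *)
Lemma braid_past_word (s t : seq L) x :
  foldl (fun y i => op_at nbraid i y) (tw (s ++ x :: t)) (iota (size s).+1 (size t)) =
  (-1) ^+ size t *: \sw_(y, b <- word_coact t) tcat (tcat (tw s) y) (tw [:: act x b]).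
Proof.
elim: t s x => [|v t IHt] s x /=.
  rewrite tsum_pure; last by lin.
  by rewrite expr0 scale1r tcatx1 act1 // tcat_tw.
have bilE : bilinear_map (fun a b : L => tw (s ++ a :: b :: t)).
  have -> : (fun a b : L => tw (s ++ a :: b :: t)) =
      (fun a b => tcat (tcat (tw s) (tw [:: a])) (tcat (tw [:: b]) (tw t))).
    by apply/funext => a; apply/funext => b; rewrite !tcat_tw -catA.
  by lin.
rewrite op_at_tw // -[nbraid (x \ot v)]/(- braid (x \ot v)) braid_pure //
  (tsumNl _ bilE) (tsum_tsum _ _ bilE).
rewrite (linN _ (foldl_op_at_linear _)) (linear_of_tsum _ _ (foldl_op_at_linear _)).
rewrite exprS mulN1r scaleNr; congr (- _).
rewrite tsum_tsum; last by lin.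
rewrite -tsum_scale; apply: eq_tsum => v0 v1.
rewrite (tsum_pure bilE) tsum_tsum; last by lin.
rewrite -cat_rcons -[(size s).+2]/((size s).+1.+1) -(size_rcons s v0) IHt; congr (_ *: _).
apply: eq_tsum => y b; rewrite tsum_pure; last by lin.
by rewrite tw_rcons !tcatA (actM LX).
Qed.

Lemma tspace_proj_tw n (s : seq L) :
  tspace_proj n (tw s) = if size s == n then tw s else 0.
Proof.
rewrite /tspace_proj wsum_tw // => p q c v w; rewrite !size_cat /=.
by case: ifP => _; rewrite ?tw_multilinear ?scaler0 ?addr0.
Qed.

Lemma linmap_tspace_proj n : linmap (@tspace_proj k L n).
Proof.
split; apply: wsum_linear => p q c v w; rewrite !size_cat /=.
by case: ifP => _; rewrite ?tw_multilinear ?scaler0 ?addr0.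
Qed.
Local Hint Resolve linmap_tspace_proj : lin.

Lemma tspace_projS n x (v : L) :
  tspace_proj n.+1 (tcat x (tw [:: v])) = tcat (tspace_proj n x) (tw [:: v]).
Proof.
elim/tspace_ind: x => [c x y hx hy|s].
  by rewrite !(tcat_bilinear L).1 !(linmapP (linmap_tspace_proj _)) (tcat_bilinear L).1
    hx hy.
rewrite -tw_rcons !tspace_proj_tw size_rcons eqSS; case: ifP => _;
  first by rewrite tw_rcons.
by rewrite (bil0l _ (tcat_bilinear L)).
Qed.

Lemma tspace_proj0S x (v : L) : tspace_proj 0 (tcat x (tw [:: v])) = 0.
Proof.
elim/tspace_ind: x => [c x y hx hy|s].
  by rewrite (tcat_bilinear L).1 (linmapP (linmap_tspace_proj _)) hx hy scaler0 addr0.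
by rewrite -tw_rcons tspace_proj_tw size_rcons.
Qed.

(** The coaction preserves length. In this form it lets a length be inserted where a braided
    binomial with fixed parameters meets a Sweedler leg of unspecified length. *)
Lemma word_coact_proj (s : seq L) :
  word_coact s = \sw_(y, b <- word_coact s) tspace_proj (size s) y \ot b :> tensor T A.
Proof.
elim/last_ind: s => [|s v IHs].
  by rewrite /= tsum_pure ?tspace_proj_tw //; lin.
rewrite word_coact_rcons size_rcons [RHS]tsum_tsum; last by lin.
rewrite [in LHS]IHs tsum_tsum; last by lin.
apply: eq_tsum => y b; rewrite tsum_pure; last by lin.
rewrite tsum_tsum; last by lin.
apply: eq_tsum => v0 v1; rewrite tsum_pure; last by lin.
by rewrite tspace_projS.
Qed.

Let nbinom n r : linear (braided_binomial nbraid n r).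
Proof. exact: braided_binomial_linear. Qed.

Lemma sh_mul1x (x : T) : sh_mul (tw [::]) x = x.
Proof.
elim/tspace_ind: x => [c u v hu hv|s].
  by rewrite (sh_mul_bilinear LX).2 hu hv.
by rewrite sh_mul_tw //=; case: (size s).
Qed.

Lemma op_tensor_id_tcat (f : T -> T) x v : linear f ->
  op_tensor_id f (tcat x (tw [:: v])) = tcat (f x) (tw [:: v]).
Proof.
move=> fL; elim/tspace_ind: x => [c x y hx hy|s].
  by rewrite fL !(tcat_bilinear L).1 (op_tensor_id_linear fL) hx hy.
by rewrite -tw_rcons op_tensor_id_rcons.
Qed.

Lemma braided_binomial_small n r x : (n < r)%N -> braided_binomial nbraid n r x = 0.
Proof. by case: n r => [|n] [|r] //= ->. Qed.

Lemma sh_mul_rcons1 (s : seq L) v :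
  sh_mul (tw (rcons s v)) (tw [::]) = tcat (sh_mul (tw s) (tw [::])) (tw [:: v]).
Proof.
rewrite !sh_mul_tw // !addn0 !cats0 size_rcons /= ltnn subnn /=.
rewrite !op_tensor_id_rcons //; try exact: nbinom.
rewrite -/nbraid [X in _ + tcat X _]braided_binomial_small // (bil0l _ (tcat_bilinear L)).
by rewrite addr0.
Qed.

(** The two summands of the binomial recursion: either [w] stays last, or [v] is carried past all of
    [rcons t w] by [braid_past_word]. *)
Lemma sh_mul_rcons (s t : seq L) v w :
  sh_mul (tw (rcons s v)) (tw (rcons t w)) =
  tcat (sh_mul (tw (rcons s v)) (tw t)) (tw [:: w]) + (-1) ^+ (size t).+1 *:
    \sw_(y, b <- word_coact (rcons t w)) tcat (sh_mul (tw s) y) (tw [:: act v b]).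
Proof.
have E : (size (rcons s v) + size (rcons t w) = (size s + (size t).+1).+1)%N.
  by rewrite !size_rcons addSn.
rewrite [LHS]sh_mul_tw // E size_rcons /= ltnS ltnNge leq_addr /=.
rewrite subSS addKn cat_rcons -/nbraid -(size_rcons t w) braid_past_word addrC size_rcons.
congr (_ + _).
  rewrite -cat_rcons -rcons_cat op_tensor_id_rcons; last exact: nbinom.
  by rewrite sh_mul_tw // size_rcons addSnnS.
have lin_op : linear (op_tensor_id (braided_binomial nbraid (size s +
  (size t).+1) (size s))).
  exact/op_tensor_id_linear/nbinom.
rewrite (linZ _ _ lin_op); congr (_ *: _); rewrite (linear_of_tsum _ _ lin_op).
have op_bil : bilinear_map (fun y b => op_tensor_id
    (braided_binomial nbraid (size s + (size t).+1) (size s))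
    (tcat (tcat (tw s) y) (tw [:: act v b]))).
  have := LinMap lin_op; set f := op_tensor_id _ => fL; lin.
have mul_bil := sh_mul_bilinear LX.
have sh_bil : bilinear_map (fun y b => tcat (sh_mul (tw s) y) (tw [:: act v b])).
  by lin.
(* The recursion fixes the binomial parameters by the length of [rcons t w], whereas [sh_mul] reads
   them off its arguments. The inserted projection keeps only the words on which both agree. *)
rewrite word_coact_proj (tsum_tsum _ _ op_bil) (tsum_tsum _ _ sh_bil).
apply: eq_tsum => y b; rewrite (tsum_pure op_bil) (tsum_pure sh_bil).
rewrite op_tensor_id_tcat; last exact: nbinom.
congr tcat; rewrite size_rcons.
elim/tspace_ind: y => [c x y hx hy|r].
  rewrite (linmapP (linmap_tspace_proj _)) (tcat_bilinear L).2 nbinom hx hy.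
  by rewrite (sh_mul_bilinear LX).2.
rewrite tspace_proj_tw; case: eqP => [<-|_].
  by rewrite tcat_tw sh_mul_tw.
by rewrite (bil0r _ (tcat_bilinear L)) (lin0 (nbinom _ _)) (bil0r _ mul_bil).
Qed.

(** The value 0 on the empty word makes the product rules below hold without a separate case for
    degree zero. *)
Definition unsnoc_word (s : seq L) : tensor T L :=
  if s is v :: t then tw (belast v t) \ot last v t else 0.

Definition tunsnoc (x : T) : tensor T L := wsum x unsnoc_word.

Lemma unsnoc_word_rcons (s : seq L) v : unsnoc_word (rcons s v) = tw s \ot v.
Proof. by case: s => //= x s; rewrite belast_rcons last_rcons. Qed.

Lemma unsnoc_word_multilinear : multilinear unsnoc_word.
Proof.
move=> s t c v w; case/lastP: t => [|t x].
  by rewrite !cats1 !unsnoc_word_rcons (pure_bilinear _ _).2.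
rewrite -!rcons_cons -!rcons_cat !unsnoc_word_rcons tw_multilinear.
exact: (pure_bilinear _ _).1.
Qed.

Lemma linmap_tunsnoc : linmap tunsnoc.
Proof. split; exact: wsum_linear unsnoc_word_multilinear. Qed.

Lemma tunsnoc1 : tunsnoc (tw [::]) = 0.
Proof. exact: (wsum_tw unsnoc_word_multilinear). Qed.

Lemma tunsnoc_tcat x v : tunsnoc (tcat x (tw [:: v])) = x \ot v.
Proof.
elim/tspace_ind: x => [c x y hx hy|s].
  by rewrite (tcat_bilinear L).1 (linmapP linmap_tunsnoc) hx hy (pure_bilinear _ _).1.
by rewrite -tw_rcons /tunsnoc (wsum_tw unsnoc_word_multilinear) unsnoc_word_rcons.
Qed.

Definition tsign (x : T) : T := \words_(s <- x) (-1) ^+ size s *: tw s.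

Lemma signed_tw_multilinear : multilinear (fun s : seq L => (-1) ^+ size s *: tw s).
Proof.
by move=> s t c v w; rewrite !size_cat /= tw_multilinear scalerDr !scalerA mulrC.
Qed.

Lemma linmap_tsign : linmap tsign.
Proof. split; exact: wsum_linear signed_tw_multilinear. Qed.

Lemma tsign_tw s : tsign (tw s) = (-1) ^+ size s *: tw s.
Proof. exact: (wsum_tw signed_tw_multilinear). Qed.

Lemma tsign_tcat x v : tsign (tcat x (tw [:: v])) = - tcat (tsign x) (tw [:: v]).
Proof.
elim/tspace_ind: x => [c x y hx hy|s].
  by rewrite !((tcat_bilinear L).1, linmapP linmap_tsign) hx hy opprD scalerN.
rewrite -tw_rcons !tsign_tw size_rcons exprS mulN1r scaleNr tw_rcons.
by rewrite (bilZl _ _ _ (tcat_bilinear L)).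
Qed.

Let sh_coact_lin : linmap (@coact k A (tspace_crossed L)) := LinMap (sh_coact_linear LX).
Let mul_bil := sh_mul_bilinear LX.
Local Hint Resolve linmap_tsign linmap_tunsnoc sh_coact_lin mul_bil : lin.

(** [sh_mul_rcons] freed from words, so that it is linear in [x] and [y]. If [y] has no letters the
    first sum is empty and the second one returns the letter [v]. *)
Lemma sh_mul_snoc (x y : T) v :
  sh_mul (tcat x (tw [:: v])) y =
  \sw_(y', w <- tunsnoc y) tcat (sh_mul (tcat x (tw [:: v])) y') (tw [:: w])
  + \sw_(y0, y1 <- @coact k A (tspace_crossed L) (tsign y))
      tcat (sh_mul x y0) (tw [:: act v y1]).
Proof.
pose lhs x y := sh_mul (tcat x (tw [:: v])) y.
pose rhs x y := \sw_(y', w <- tunsnoc y) tcat (sh_mul (tcat x (tw [:: v])) y') (tw [:: w])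
  + \sw_(y0, y1 <- @coact k A (tspace_crossed L) (tsign y))
      tcat (sh_mul x y0) (tw [:: act v y1]).
have lL : bilinear_map lhs by rewrite /lhs; lin.
have rL : bilinear_map rhs by rewrite /rhs; lin.
rewrite -/(lhs x y) -/(rhs x y).
elim/tspace_ind: x => [c x x' hx hx'|s];
  first exact: (linear_comb (lL.1 y) (rL.1 y) hx hx').
elim/tspace_ind: y => [c y y' hy hy'|t];
  first exact: (linear_comb (lL.2 (tw s)) (rL.2 (tw s)) hy hy').
rewrite /lhs /rhs -tw_rcons; case/lastP: t => [|t w].
  rewrite tunsnoc1 tsum0 ?add0r; last by lin.
  rewrite tsign_tw expr0 scale1r sh_coact_tw //= tsum_pure; last by lin.
  by rewrite act1 // sh_mul_rcons1.
rewrite sh_mul_rcons (tw_rcons t) tunsnoc_tcat tsum_pure; last by lin.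
rewrite -(tw_rcons t) tsign_tw size_rcons (linZ _ _ (sh_coact_linear LX)) tsumZl;
  last by lin.
by rewrite sh_coact_tw.
Qed.
End Words.

(** * The algebra A # Sh_-(L), letter by letter *)

Section Letters.
Variables (k : fieldType) (A : hopfAlgebra k) (L : crossedData A).
Hypothesis LX : crossed_module L.
Local Notation T := (tspace L).
Local Notation H := (tensor A (tspace L)).
Local Notation wact := (@act k A (tspace_crossed L)).
Local Notation wcoact := (@coact k A (tspace_crossed L)).

Let act_bil : bilinear_map (@act k A L) := act_bilinear LX.
Let coact_lin : linmap (@coact k A L) := LinMap (coact_linear LX).
Let wact_bil : bilinear_map wact := sh_act_bilinear LX.
Let wcoact_lin : linmap wcoact := LinMap (sh_coact_linear LX).
Let sh_mul_bil : bilinear_map (@sh_mul k A L) := sh_mul_bilinear LX.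
Let tunsnoc_lin : linmap (@tunsnoc _ _ L) := linmap_tunsnoc L.
Let tsign_lin : linmap (@tsign _ _ L) := linmap_tsign L.
Local Hint Resolve act_bil coact_lin wact_bil wcoact_lin sh_mul_bil
  tunsnoc_lin tsign_lin : lin.

Lemma wact1 a : wact (tw [::]) a = eps a *: tw [::].
Proof. by rewrite sh_act_tw. Qed.

Lemma wact_snoc x v a :
  wact (tcat x (tw [:: v])) a = \sw_(a1, a2 <- Delta a) tcat (wact x a1) (tw [:: act v a2]).
Proof.
elim/tspace_ind: x => [c x y hx hy|s].
  rewrite (tcat_bilinear L).1 wact_bil.1 hx hy -tsum_scale -tsum_add.
  by apply: eq_tsum => a1 a2; rewrite wact_bil.1 (tcat_bilinear L).1.
rewrite -tw_rcons sh_act_tw // word_act_rcons //.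
by apply: eq_tsum => a1 a2; rewrite sh_act_tw.
Qed.

Lemma wcoact1 : wcoact (tw [::]) = tw [::] \ot 1.
Proof. by rewrite sh_coact_tw. Qed.

Lemma wcoact_snoc x v : wcoact (tcat x (tw [:: v])) =
  \sw_(y, b <- wcoact x) \sw_(v0, v1 <- coact v) tcat y (tw [:: v0]) \ot (b * v1).
Proof.
elim/tspace_ind: x => [c x y hx hy|s].
  rewrite (tcat_bilinear L).1 (linmapP wcoact_lin) hx hy.
  by rewrite (linmapP wcoact_lin) tsumDl ?tsumZl //; lin.
by rewrite -tw_rcons !sh_coact_tw // word_coact_rcons.
Qed.

Definition hbase (a : A) : H := a \ot tw [::].
Definition snoc_def (u : H) (v : L) : H := \sw_(a, x <- u) a \ot tcat x (tw [:: v]).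
Definition hproj_def (u : H) : A := \sw_(a, x <- u) (@sh_eps k A L x) *: (a : A).
Definition unsnoc_def (u : H) : tensor H L :=
  \sw_(a, x <- u) \sw_(y, v <- @tunsnoc k A L x) (a \ot y) \ot v.
Definition hsign_def (u : H) : H := \sw_(a, x <- u) a \ot @tsign k A L x.
(** This is the coproduct of H with its right leg projected to A, as [sw_hDelta_hproj] shows. *)
Definition hcoact_def (u : H) : tensor H A :=
  \sw_(a, x <- u) \sw_(a1, a2 <- Delta a) \sw_(x0, x1 <- wcoact x)
    (a1 \ot x0) \ot (a2 * x1).

(** Locking makes these maps atoms for unification and for [lin]; they are handled through their
    linearity and their values on [hbase], [snoc] and pure tensors. *)
Fact snoc_key : unit. Proof. exact: tt. Qed.
Definition snoc : H -> L -> H := locked_with snoc_key snoc_def.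
Fact hproj_key : unit. Proof. exact: tt. Qed.
Definition hproj : H -> A := locked_with hproj_key hproj_def.
Fact unsnoc_key : unit. Proof. exact: tt. Qed.
Definition unsnoc : H -> tensor H L := locked_with unsnoc_key unsnoc_def.
Fact hsign_key : unit. Proof. exact: tt. Qed.
Definition hsign : H -> H := locked_with hsign_key hsign_def.
Fact hcoact_key : unit. Proof. exact: tt. Qed.
Definition hcoact : H -> tensor H A := locked_with hcoact_key hcoact_def.
Fact hmul_key : unit. Proof. exact: tt. Qed.
Definition hmul : H -> H -> H := locked_with hmul_key (@boson_mul k A (Sh L)).

Lemma snocE : snoc = snoc_def. Proof. exact: locked_withE. Qed.
Lemma hprojE : hproj = hproj_def. Proof. exact: locked_withE. Qed.
Lemma unsnocE : unsnoc = unsnoc_def. Proof. exact: locked_withE. Qed.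
Lemma hsignE : hsign = hsign_def. Proof. exact: locked_withE. Qed.
Lemma hcoactE : hcoact = hcoact_def. Proof. exact: locked_withE. Qed.
Lemma hmulE : hmul = @boson_mul k A (Sh L). Proof. exact: locked_withE. Qed.

Lemma eps_word_multilinear : multilinear (fun s : seq L => ((s == [::])%:R : k^o)).
Proof.
by move=> s t c v w; case: s => [|x s] /=; rewrite ?scaler0 ?addr0.
Qed.

Lemma linmap_sh_eps : linmap (@sh_eps k A L : T -> k^o).
Proof. split; exact: wsum_linear eps_word_multilinear. Qed.
Local Hint Extern 1 (linmap (@sh_eps _ _ _)) => exact: linmap_sh_eps : lin.

Lemma sh_eps_tw s : @sh_eps k A L (tw s) = (s == [::])%:R.
Proof. exact: (wsum_tw eps_word_multilinear). Qed.

Lemma sh_eps_snoc x v : @sh_eps k A L (tcat x (tw [:: v])) = 0.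
Proof.
elim/tspace_ind: x => [c x y hx hy|s].
  by rewrite (tcat_bilinear L).1 (linmapP linmap_sh_eps) hx hy scaler0 addr0.
by rewrite -tw_rcons sh_eps_tw; case: s.
Qed.

Lemma snoc_pure a x v : snoc (a \ot x) v = a \ot tcat x (tw [:: v]).
Proof. by rewrite snocE /snoc_def tsum_pure //; lin. Qed.

Lemma snoc_bilinear : bilinear_map snoc.
Proof. by rewrite snocE /snoc_def; lin. Qed.

Lemma linmap_hbase : linmap hbase. Proof. by rewrite /hbase; lin. Qed.
Lemma linmap_hproj : linmap hproj. Proof. by rewrite hprojE /hproj_def; lin. Qed.
Lemma linmap_unsnoc : linmap unsnoc. Proof. by rewrite unsnocE /unsnoc_def; lin. Qed.
Lemma linmap_hsign : linmap hsign. Proof. by rewrite hsignE /hsign_def; lin. Qed.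
Lemma linmap_hcoact : linmap hcoact. Proof. by rewrite hcoactE /hcoact_def; lin. Qed.
Lemma hmul_bilinear : bilinear_map hmul.
Proof.
have h : bilinear_map (fun u v : H => \sw_(a, x <- u) \sw_(b, y <- v)
    \sw_(b1, b2 <- Delta b) (a * b1) \ot sh_mul (wact x b2) y) by lin.
by rewrite hmulE; exact: h.
Qed.
Local Hint Resolve snoc_bilinear linmap_hbase linmap_hproj linmap_unsnoc
  linmap_hsign linmap_hcoact hmul_bilinear : lin.

Lemma letter_ind (P : H -> Prop) :
  (forall c u v, P u -> P v -> P (c *: u + v)) ->
  (forall a, P (hbase a)) -> (forall u x, P u -> P (snoc u x)) -> forall u, P u.
Proof.
move=> PL Pb Ps; apply: tensor_ind => // a x.
elim/tspace_snoc_ind: x => [c x y hx hy| |x v hx].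
- by rewrite (pure_bilinear _ _).2; apply: PL.
- exact: Pb.
- by rewrite -snoc_pure; apply: Ps.
Qed.

Lemma letter_ext (M : lmodType k) (f g : H -> M) : linmap f -> linmap g ->
  (forall a, f (hbase a) = g (hbase a)) ->
  (forall u x, f u = g u -> f (snoc u x) = g (snoc u x)) -> f =1 g.
Proof.
by move=> [fL] [gL] fb fs; apply: letter_ind => // c u v hu hv; rewrite fL gL hu hv.
Qed.

Lemma hproj_base a : hproj (hbase a) = a.
Proof. by rewrite hprojE /hproj_def tsum_pure ?sh_eps_tw ?scale1r //; lin. Qed.

Lemma hproj_snoc u v : hproj (snoc u v) = 0.
Proof.
rewrite hprojE /hproj_def snocE /snoc_def tsum_tsum; last by lin.
rewrite -[RHS](tsum_zero _ u); apply: eq_tsum => a x.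
by rewrite tsum_pure ?sh_eps_snoc ?scale0r //; lin.
Qed.

Lemma unsnoc_base a : unsnoc (hbase a) = 0.
Proof. by rewrite unsnocE /unsnoc_def tsum_pure ?tunsnoc1 ?tsum0 //; lin. Qed.

Lemma unsnoc_snoc u v : unsnoc (snoc u v) = u \ot v.
Proof.
rewrite unsnocE /unsnoc_def snocE /snoc_def tsum_tsum; last by lin.
rewrite -[in RHS](tsum_pure_id u) (@linear_of_tsum _ _ _ _ _ u _ (fun u => u \ot v));
  last by lin.
by apply: eq_tsum => a x; rewrite tsum_pure ?tunsnoc_tcat ?tsum_pure //; lin.
Qed.

(** The decomposition of H into A and H (x) L. It makes [hproj] and [unsnoc] jointly injective
    ([hproj_unsnoc_inj]), which is how identities in H are proved below. *)
Lemma letter_split u : u = hbase (hproj u) + \sw_(u', x <- unsnoc u) snoc u' x.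
Proof.
have h : linmap (fun u => hbase (hproj u) + \sw_(u', x <- unsnoc u) snoc u' x) by lin.
elim/letter_ind: u => [c u v hu hv|a|u x _].
- exact: (linmap_comb (linmap_id _) h hu hv).
- by rewrite hproj_base unsnoc_base tsum0 ?addr0 //; lin.
- by rewrite hproj_snoc unsnoc_snoc tsum_pure ?(lin0 (linmapP linmap_hbase)) ?add0r //; lin.
Qed.

Lemma hsign_base a : hsign (hbase a) = hbase a.
Proof. by rewrite hsignE /hsign_def tsum_pure ?tsign_tw ?expr0 ?scale1r //; lin. Qed.

Lemma hsign_snoc u v : hsign (snoc u v) = - snoc (hsign u) v.
Proof.
rewrite hsignE /hsign_def snocE /snoc_def !tsum_tsum; try by lin.
rewrite -tsum_opp; apply: eq_tsum => a x; rewrite !tsum_pure; try by lin.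
by rewrite tsign_tcat // (bilNr _ _ (pure_bilinear _ _)).
Qed.

Lemma hcoact_base a : hcoact (hbase a) = \sw_(a1, a2 <- Delta a) hbase a1 \ot a2.
Proof.
rewrite hcoactE /hcoact_def tsum_pure; last by lin.
apply: eq_tsum => a1 a2; rewrite wcoact1 tsum_pure ?mulr1 //; lin.
Qed.

Lemma hcoact_snoc u v : hcoact (snoc u v) =
  \sw_(u0, u1 <- hcoact u) \sw_(v0, v1 <- coact v) snoc u0 v0 \ot (u1 * v1).
Proof.
rewrite hcoactE /hcoact_def {1}snocE /snoc_def !tsum_tsum; try by lin.
apply: eq_tsum => a x; rewrite tsum_pure ?tsum_tsum; try by lin.
apply: eq_tsum => a1 a2; rewrite wcoact_snoc !tsum_tsum; try by lin.
apply: eq_tsum => x0 x1; rewrite tsum_tsum ?tsum_pure; try by lin.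
apply: eq_tsum => v0 v1; rewrite tsum_pure ?snoc_pure ?mulrA //; by lin.
Qed.

Lemma hmul_pure a b x y : hmul (a \ot x) (b \ot y) =
  \sw_(b1, b2 <- Delta b) (a * b1) \ot sh_mul (wact x b2) y.
Proof. by rewrite hmulE; exact: (@boson_mul_pure k A (Sh L) wact_bil a b x y
  sh_mul_bil). Qed.

Lemma hmul_base a b : hmul (hbase a) (hbase b) = hbase (a * b).
Proof.
rewrite hmul_pure -[RHS](@sw_epsr _ _ _ (fun b => hbase (a * b))); last by lin.
apply: eq_tsum => b1 b2; rewrite wact1 (bilZl _ _ _ sh_mul_bil) sh_mul1x //.
by rewrite (bilZr _ _ _ (pure_bilinear _ _)).
Qed.

Lemma hmul_base_pure a b x : hmul (hbase a) (b \ot x) = (a * b) \ot x.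
Proof.
rewrite hmul_pure -[RHS](@sw_epsr _ _ _ (fun b => (a * b) \ot x)); last by lin.
apply: eq_tsum => b1 b2; rewrite wact1 (bilZl _ _ _ sh_mul_bil) sh_mul1x //.
by rewrite (bilZr _ _ _ (pure_bilinear _ _)).
Qed.

Lemma hmul_base_snoc a v y : hmul (hbase a) (snoc v y) = snoc (hmul (hbase a) v) y.
Proof.
elim/tensor_ind: v => [c u v hu hv|b x].
  by rewrite snoc_bilinear.1 hmul_bilinear.2 hu hv hmul_bilinear.2 snoc_bilinear.1.
by rewrite snoc_pure !hmul_base_pure snoc_pure.
Qed.

Lemma unsnoc_pure a x :
  unsnoc (a \ot x) = \sw_(y, v <- tunsnoc x) (a \ot y) \ot v.
Proof. by rewrite unsnocE /unsnoc_def tsum_pure //; lin. Qed.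

Lemma hsign_pure a x : hsign (a \ot x) = a \ot tsign x.
Proof. by rewrite hsignE /hsign_def tsum_pure //; lin. Qed.

Lemma hcoact_pure a x : hcoact (a \ot x) =
  \sw_(a1, a2 <- Delta a) \sw_(x0, x1 <- wcoact x) (a1 \ot x0) \ot (a2 * x1).
Proof. by rewrite hcoactE /hcoact_def tsum_pure //; lin. Qed.

(** Two elements of A act on the letter [x]: a leg of b, from the smash product, and the A-leg of
    the coaction of the word Y, from the braiding. For v = b (x) Y their product is the A-leg of
    [hcoact v], by coassociativity. *)
Lemma hmul_snoc u x v : hmul (snoc u x) v =
  \sw_(v', y <- unsnoc v) snoc (hmul (snoc u x) v') y
  + \sw_(v0, v1 <- hcoact (hsign v)) snoc (hmul u v0) (act x v1).
Proof.
pose lhs u v := hmul (snoc u x) v.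
pose rhs u v := \sw_(v', y <- unsnoc v) snoc (hmul (snoc u x) v') y
  + \sw_(v0, v1 <- hcoact (hsign v)) snoc (hmul u v0) (act x v1).
have lL : bilinear_map lhs by rewrite /lhs; lin.
have rL : bilinear_map rhs by rewrite /rhs; lin.
rewrite -/(lhs u v) -/(rhs u v).
elim/tensor_ind: u => [c u u' hu hu'|a X];
  first exact: (linear_comb (lL.1 v) (rL.1 v) hu hu').
elim/tensor_ind: v => [c v v' hv hv'|b Y].
  exact: (linear_comb (lL.2 (a \ot X)) (rL.2 (a \ot X)) hv hv').
rewrite /lhs /rhs snoc_pure hmul_pure.
have E b1 b2 : (a * b1) \ot sh_mul (wact (tcat X (tw [:: x])) b2) Y =
  \sw_(y', y <- tunsnoc Y) snoc ((a * b1) \ot sh_mul (wact (tcat X (tw [:: x])) b2) y') y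
  + \sw_(c1, c2 <- Delta b2) \sw_(y0, y1 <- wcoact (tsign Y))
      snoc ((a * b1) \ot sh_mul (wact X c1) y0) (act x (c2 * y1)).
  have E1 z : \sw_(y', y <- tunsnoc Y) snoc ((a * b1) \ot sh_mul z y') y =
      (a * b1) \ot \sw_(y', y <- tunsnoc Y) tcat (sh_mul z y') (tw [:: y]).
    rewrite (@linear_of_tsum _ _ _ _ _ _ _ (fun z => (a * b1) \ot z)); last by lin.
    by apply: eq_tsum => y' y; rewrite snoc_pure.
  rewrite E1 {E1} wact_snoc.
  rewrite (@linear_of_tsum _ _ _ _ _ _ _ (fun z => (a * b1) \ot sh_mul z Y)); last by lin.
  rewrite (@linear_of_tsum _ _ _ _ _ _ _ (fun z => (a * b1) \ot
     \sw_(y', y <- tunsnoc Y) tcat (sh_mul z y') (tw [:: y]))); last by lin.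
  rewrite -tsum_add; apply: eq_tsum => c1 c2; rewrite sh_mul_snoc //.
  rewrite (bilDr _ _ _ (pure_bilinear _ _)); congr (_ + _).
  rewrite (@linear_of_tsum _ _ _ _ _ _ _ (fun z => (a * b1) \ot z)); last by lin.
  by apply: eq_tsum => y0 y1; rewrite snoc_pure (actM LX).
under eq_tsum => b1 b2 do rewrite E.
rewrite tsum_add; congr (_ + _).
  rewrite tsumC unsnoc_pure tsum_tsum; last by lin.
  apply: eq_tsum => y' y; rewrite tsum_pure; last by lin.
  rewrite hmul_pure.
  by rewrite (@linear_of_tsum _ _ _ _ _ _ _ (fun z => snoc z y)) //; lin.
rewrite hsign_pure hcoact_pure tsum_tsum; last by lin.
rewrite -(@sw_DeltaA _ _ _ (fun b1 c1 c2 => \sw_(y0, y1 <- wcoact (tsign Y))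
   snoc ((a * b1) \ot sh_mul (wact X c1) y0) (act x (c2 * y1))) b); last by lin.
apply: eq_tsum => b1 b2; rewrite tsumC tsum_tsum; last by lin.
apply: eq_tsum => y0 y1; rewrite tsum_pure; last by lin.
rewrite hmul_pure.
by rewrite (@linear_of_tsum _ _ _ _ _ _ _ (fun z => snoc z (act x (b2 * y1)))) //; lin.
Qed.

Lemma hproj_unsnoc_inj u v : hproj u = hproj v -> unsnoc u = unsnoc v -> u = v.
Proof. by move=> h1 h2; rewrite (letter_split u) (letter_split v) h1 h2. Qed.

Lemma hproj_sum (V W : lmodType k) (x : tensor V W) f :
  hproj (tsum x f) = \sw_(a, b <- x) hproj (f a b).
Proof. by rewrite (linear_of_tsum _ _ (linmapP linmap_hproj)). Qed.

Lemma unsnoc_sum (V W : lmodType k) (x : tensor V W) f :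
  unsnoc (tsum x f) = \sw_(a, b <- x) unsnoc (f a b).
Proof. by rewrite (linear_of_tsum _ _ (linmapP linmap_unsnoc)). Qed.

(** The rule behind all identities for the product. For [u] in A the second sum is empty and left
    multiplication by [u] leaves last letters alone; otherwise this is [hmul_snoc]. *)
Lemma unsnoc_hmul u v : unsnoc (hmul u v) =
  \sw_(v', y <- unsnoc v) hmul u v' \ot y
  + \sw_(u', x <- unsnoc u) \sw_(v0, v1 <- hcoact (hsign v)) hmul u' v0 \ot act x v1.
Proof.
pose lhs u v := unsnoc (hmul u v).
pose rhs u v := \sw_(v', y <- unsnoc v) hmul u v' \ot y
  + \sw_(u', x <- unsnoc u) \sw_(v0, v1 <- hcoact (hsign v)) hmul u' v0 \ot act x v1.
have lL : bilinear_map lhs by rewrite /lhs; lin.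
have rL : bilinear_map rhs by rewrite /rhs; lin.
rewrite -/(lhs u v) -/(rhs u v).
elim/letter_ind: u => [c u u' hu hu'|a|u x _];
  first exact: (linear_comb (lL.1 v) (rL.1 v) hu hu').
  rewrite /lhs /rhs unsnoc_base [X in _ + X]tsum0 ?addr0; last by lin.
  elim/letter_ind: v => [c v v' hv hv'|b|v y _].
  - have gL : linmap (fun v => \sw_(v', y <- unsnoc v) hmul (hbase a) v' \ot y) by lin.
    exact: (linear_comb (lL.2 (hbase a)) (linmapP gL) hv hv').
  - by rewrite hmul_base !unsnoc_base tsum0 //; lin.
  - by rewrite hmul_base_snoc !unsnoc_snoc tsum_pure //; lin.
rewrite /lhs /rhs hmul_snoc (linD _ _ (linmapP linmap_unsnoc)).
rewrite (unsnoc_sum (unsnoc v)) (unsnoc_sum (hcoact _)); congr (_ + _).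
  by apply: eq_tsum => v' y; rewrite unsnoc_snoc.
rewrite unsnoc_snoc tsum_pure; last by lin.
by apply: eq_tsum => v0 v1; rewrite unsnoc_snoc.
Qed.

Lemma hproj_hmul u v : hproj (hmul u v) = hproj u * hproj v.
Proof.
pose lhs u v := hproj (hmul u v); pose rhs u v := hproj u * hproj v.
have lL : bilinear_map lhs by rewrite /lhs; lin.
have rL : bilinear_map rhs by rewrite /rhs; lin.
rewrite -/(lhs u v) -/(rhs u v).
elim/letter_ind: u => [c u u' hu hu'|a|u x _];
  first exact: (linear_comb (lL.1 v) (rL.1 v) hu hu').
  elim/letter_ind: v => [c v v' hv hv'|b|v y _];
    first exact: (linear_comb (lL.2 (hbase a)) (rL.2 (hbase a)) hv hv').
  - by rewrite /lhs /rhs hmul_base !hproj_base.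
  - by rewrite /lhs /rhs hmul_base_snoc !hproj_snoc mulr0.
rewrite /lhs /rhs hmul_snoc (linD _ _ (linmapP linmap_hproj)).
rewrite (hproj_sum (unsnoc v)) (hproj_sum (hcoact _)).
rewrite hproj_snoc mul0r -[RHS]addr0; congr (_ + _).
  by rewrite -[RHS](tsum_zero _ (unsnoc v)); apply: eq_tsum => ? ?; rewrite hproj_snoc.
rewrite -[RHS](tsum_zero _ (hcoact (hsign v))).
by apply: eq_tsum => ? ?; rewrite hproj_snoc.
Qed.
End Letters.

(** * Convolution inverses along a grading *)

Section GradedAntipode.
Variables (k : fieldType) (H : gradedData k).
Hypotheses (Hgr : grading H) (Halg : graded_algebra H) (Hco : graded_coalgebra H).
Implicit Types (f g h : H -> H) (u : H).

Let mul_bil : bilinear_map (@gmul k H) := gmul_bilinear Halg.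
Let Delta_lin : linmap (@gDelta k H) := LinMap (gDelta_linear Hco).
Let comp_lin n : linmap (@gcomp k H n) := LinMap (gcomp_linear Hgr n).
Local Hint Resolve mul_bil Delta_lin comp_lin : lin.

Definition conv f g u : H := \sw_(a, b <- gDelta u) gmul (f a) (g b).
Definition conv1 u : H := geps u *: gone.
Definition graded_map f := forall n u, gdeg n u -> gdeg n (f u).

Lemma linmap_conv f g : linmap f -> linmap g -> linmap (conv f g).
Proof. by move=> fL gL; rewrite /conv; lin. Qed.

Lemma linmap_geps : @linmap k H k^o (@geps k H).
Proof. split; exact: geps_linear Hco. Qed.

Lemma linmap_conv1 : linmap conv1.
Proof. by rewrite /conv1; apply: linmap_scalel; exact: linmap_geps. Qed.

Lemma sw_gDeltaA (M : lmodType k) (F : H -> H -> H -> M) u : trilinear_map F ->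
  \sw_(a, b <- gDelta u) \sw_(c, d <- gDelta a) F c d b =
  \sw_(a, b <- gDelta u) \sw_(c, d <- gDelta b) F a c d.
Proof.
move=> FL; rewrite -(tsum3E _ _ (fun _ _ b _ => b) (fun _ _ _ c => c) (fun _ a2 _ _ =>
  a2) FL).
by rewrite (gDeltaA Hco) tsum3E.
Qed.

Lemma convA f g h : linmap f -> linmap g -> linmap h ->
  conv (conv f g) h =1 conv f (conv g h).
Proof.
move=> fL gL hL u; rewrite /conv.
transitivity (\sw_(a, b <- gDelta u) \sw_(c, d <- gDelta a) gmul (f c) (gmul (g d) (h b))).
  apply: eq_tsum => a b.
  rewrite (@linear_of_tsum _ _ _ _ _ _ _ (fun z => gmul z (h b))); last by lin.
  by apply: eq_tsum => c d; rewrite (gmulA Halg).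
rewrite (sw_gDeltaA (F := fun c d b => gmul (f c) (gmul (g d) (h b)))); last by lin.
apply: eq_tsum => a b.
by rewrite (@linear_of_tsum _ _ _ _ _ _ _ (fun z => gmul (f a) z)) //; lin.
Qed.

Lemma conv1l f : linmap f -> conv conv1 f =1 f.
Proof.
move=> [fL] u; rewrite -[in RHS](gDelta_epsl Hco u) (linear_of_tsum _ _ fL).
apply: eq_tsum => a b.
by rewrite (bilZl _ _ _ mul_bil) (gmul1 Halg) (linZ _ _ fL).
Qed.

Lemma conv1r f : linmap f -> conv f conv1 =1 f.
Proof.
move=> [fL] u; rewrite -[in RHS](gDelta_epsr Hco u) (linear_of_tsum _ _ fL).
apply: eq_tsum => a b.
by rewrite (bilZr _ _ _ mul_bil) (gmulr1 Halg) (linZ _ _ fL).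
Qed.

Lemma conv_deg f g n u : linmap f -> linmap g -> gdeg n u -> conv f g u =
  \sum_(i < n.+1) \sw_(a, b <- gDelta u) gmul (f (gcomp i a)) (g (gcomp (n - i)%N b)).
Proof.
move=> fL gL hu; have FL : bilinear_map (fun a b => gmul (f a) (g b)) by lin.
rewrite /conv {1}(gDelta_deg Hco hu) (lin_sum _ _ _ (tsum_linear FL)).
by apply: eq_bigr => i _; rewrite tsum_tsum //; apply: eq_tsum => *; rewrite tsum_pure.
Qed.

Lemma gdeg_comp n u : gdeg n (gcomp n u).
Proof. by rewrite /gdeg (gcomp_proj Hgr) eqxx. Qed.

Lemma gdeg_linear n c u v : gdeg n u -> gdeg n v -> gdeg n (c *: u + v).
Proof. by rewrite /gdeg (gcomp_linear Hgr) => -> ->. Qed.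

Lemma gdeg0 n : gdeg n (0 : H).
Proof. exact: (lin0 (gcomp_linear Hgr n)). Qed.

Lemma gdeg_sum n I (r : seq I) (F : I -> H) :
  (forall i, gdeg n (F i)) -> gdeg n (\sum_(i <- r) F i).
Proof.
move=> FD; rewrite /gdeg (lin_sum _ _ _ (gcomp_linear Hgr n)).
by apply: eq_bigr => i _; exact: FD.
Qed.

Lemma gdeg_tsum n (V W : lmodType k) (x : tensor V W) (F : V -> W -> H) :
  (forall a b, gdeg n (F a b)) -> gdeg n (tsum x F).
Proof.
by move=> FD; rewrite /gdeg (linear_of_tsum _ _ (gcomp_linear Hgr n)); apply: eq_tsum.
Qed.

Lemma graded_conv f g : linmap f -> linmap g -> graded_map f -> graded_map g ->
  graded_map (conv f g).
Proof.
move=> fL gL fD gD n u hu; rewrite (conv_deg fL gL hu).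
apply: gdeg_sum => i; apply: gdeg_tsum => a b.
have := gmul_deg Halg (fD _ _ (gdeg_comp i a)) (gD _ _ (gdeg_comp (n - i)%N b)).
by rewrite subnKC // -ltnS.
Qed.

Lemma graded_conv1 : graded_map conv1.
Proof.
move=> [|n] u hu; first by rewrite /gdeg /conv1
  (linZ _ _ (gcomp_linear Hgr 0)) (gone_deg Halg).
by rewrite /conv1 (geps_deg Hco hu) // scale0r; exact: gdeg0.
Qed.

Lemma graded_ext f g : linmap f -> linmap g ->
  (forall n u, gdeg n u -> f u = g u) -> f =1 g.
Proof.
move=> [fL] [gL] fg u; have [N ->] := gcomp_sum Hgr u.
rewrite (lin_sum _ _ _ fL) (lin_sum _ _ _ gL); apply: eq_bigr => i _.
exact/fg/gdeg_comp.
Qed.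

Section LeftInverse.
Variables f g : H -> H.
Hypotheses (fL : linmap f) (gL : linmap g) (fD : graded_map f) (gD : graded_map g).
Hypothesis fg0 : forall u, gdeg 0 u -> conv f g u = conv1 u.

Let err u := conv f g u - conv1 u.

Let errL : linmap err.
Proof. by apply: linmap_add; [exact: linmap_conv|exact/linmap_opp/linmap_conv1]. Qed.

Let err0 u : gdeg 0 u -> err u = 0.
Proof. by move=> hu; rewrite /err fg0 // subrr. Qed.

Let errD : graded_map err.
Proof.
move=> n u hu; rewrite /err addrC -scaleN1r; apply: gdeg_linear.
  exact: graded_conv1.
exact: graded_conv.
Qed.

(* err vanishes in degree 0, so that conv err only sees lower degrees. *)
Let conv_err h h' n u : linmap h -> linmap h' -> gdeg n u ->
  (forall m v, (m < n)%N -> gdeg m v -> h v = h' v) -> conv err h u = conv err h' u.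
Proof.
move=> hL hL' hu hh; rewrite !(conv_deg errL _ hu) //; apply: eq_bigr => -[[|i] /= lt_in] _.
  apply: eq_tsum => a b; rewrite err0; last exact: gdeg_comp.
  by rewrite !(bil0l _ mul_bil).
apply: eq_tsum => a b; congr gmul; apply: (hh (n - i.+1)%N); last exact: gdeg_comp.
by rewrite ltn_subrL /=; apply: leq_ltn_trans (leq0n i) _.
Qed.

(* The solution of x + err * x = f, by fixed-point iteration. *)
Let iterate := fix iterate m : H -> H :=
  if m is m'.+1 then fun u => f u - conv err (iterate m') u else fun _ => 0.

Let iterateL m : linmap (iterate m).
Proof.
elim: m => [|m IHm]; first exact: linmap_zero.
apply: linmap_add => //; apply: linmap_opp; exact: linmap_conv.
Qed.

Let iterateD m : graded_map (iterate m).
Proof.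
elim: m => [|m IHm] n u hu; first exact: gdeg0.
rewrite /= addrC -scaleN1r; apply: gdeg_linear; last exact: fD.
by apply: graded_conv.
Qed.

Let iterate_stable n m u : gdeg n u -> (n < m)%N -> iterate m u = iterate n.+1 u.
Proof.
elim/ltn_ind: n m u => n IHn [//|m] u hu; rewrite ltnS => le_nm /=.
congr (_ - _); apply: (conv_err (iterateL m) (iterateL n) hu) => j v lt_jn hv.
by rewrite !(IHn j lt_jn _ v hv) // (leq_trans lt_jn).
Qed.

(** The component of degree n needs n + 1 iterations, so no single iterate serves all degrees. The
    sum is finite on each element. *)
Let linv u := \sum_(n \in [set: nat]) iterate n.+1 (gcomp n u).

Let linvL : linmap linv.
Proof.
by split; apply: (fsbig_gcomp_linear Hgr (G := fun n => iterate n.+1)) => i; exact: linmapP.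
Qed.

Let linv_deg n u : gdeg n u -> linv u = iterate n.+1 u.
Proof.
apply: (fsbig_gcomp_deg Hgr (G := fun n => iterate n.+1)) => i.
exact: (lin0 (linmapP (iterateL _))).
Qed.

Let linv_eq u : linv u = f u - conv err linv u.
Proof.
apply: (graded_ext (f := linv) (g := fun u => f u - conv err linv u)) => //.
  by apply: linmap_add => //; apply: linmap_opp; exact: linmap_conv.
move=> n {}u hu; rewrite (linv_deg hu) /=; congr (_ - _).
apply: (conv_err (iterateL n) linvL hu) => m v lt_mn hv.
by rewrite (linv_deg hv) (iterate_stable hv).
Qed.

(** The solution x of x + err * x = f, that is of (f * g) * x = f, is a left inverse of g. It exists
    and keeps its degree zero values f because err = f * g - 1 vanishes in degree zero. *)
Lemma conv_left_inverse : exists x, [/\ linmap x, graded_map x,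
  forall u, gdeg 0 u -> x u = f u & conv x g =1 conv1].
Proof.
have xgL : linmap (fun u => conv linv g u - conv1 u).
  by apply: linmap_add; [exact: linmap_conv|exact/linmap_opp/linmap_conv1].
exists linv; split => //.
- by move=> n u hu; rewrite (linv_deg hu); exact: iterateD.
- move=> u hu; rewrite (linv_deg hu) /=.
  have -> : conv err (fun=> 0) u = 0; last by rewrite subr0.
  rewrite /conv -[RHS](tsum_zero _ (gDelta u)); apply: eq_tsum => a b.
  exact: (bil0r _ mul_bil).
move=> u; apply/eqP; rewrite -subr_eq0; apply/eqP.
(* For y = linv * g - 1 the equation of [linv] and associativity give y = - err * y. Since err
   vanishes in degree zero, the value of y in degree n only depends on lower degrees, so y = 0 by
   strong induction. *)
have xg_eq v : conv linv g v - conv1 v = - conv err (fun u => conv linv g u - conv1 u) v.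
  have -> : conv err (fun u => conv linv g u - conv1 u) v =
      conv err (conv linv g) v - conv err conv1 v.
    rewrite /conv -tsum_opp -tsum_add; apply: eq_tsum => a b.
    by rewrite (bilDr _ _ _ mul_bil) (bilNr _ _ mul_bil).
  rewrite conv1r // -convA //.
  have -> : conv linv g v = conv f g v - conv (conv err linv) g v.
    rewrite /conv -tsum_opp -tsum_add; apply: eq_tsum => a b.
    by rewrite {1}linv_eq (bilDl _ _ _ mul_bil) (bilNl _ _ mul_bil).
  by rewrite opprB /err addrAC.
apply: (graded_ext xgL (@linmap_zero k H H)).
elim/ltn_ind => n IHn v hv; rewrite xg_eq.
rewrite (conv_err xgL (@linmap_zero k H H) hv) => [|m w lt_mn hw]; last exact: IHn hw.
apply/eqP; rewrite oppr_eq0 /conv; apply/eqP.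
rewrite -[RHS](tsum_zero _ (gDelta v)); apply: eq_tsum => a b.
exact: (bil0r _ mul_bil).
Qed.
End LeftInverse.

(** [S] is a left inverse of the identity and itself has a left inverse x. Then x = x * (S * id) =
    (x * S) * id = id, so [S] is also a right inverse. *)
Lemma graded_antipode (S0 : H -> H) : linmap S0 -> graded_map S0 ->
  (forall u, gdeg 0 u -> conv S0 id u = conv1 u) ->
  (forall u, gdeg 0 u -> conv id S0 u = conv1 u) ->
  exists S : H -> H, [/\ linear S, graded_map S,
    conv S id =1 conv1 & conv id S =1 conv1].
Proof.
move=> S0L S0D S0l S0r.
have idL := @linmap_id k H; have idD : graded_map id by [].
have [S [SL SD S_S0 Sl]] := conv_left_inverse S0L idL S0D idD S0l.
(* On degree zero the coproduct only involves degree zero, where [S] and [S0] agree. *)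
have Sr0 u : gdeg 0 u -> conv id S u = conv1 u.
  move=> hu; rewrite -S0r // !(conv_deg _ _ hu) //; apply: eq_bigr => i _.
  apply: eq_tsum => a b; congr gmul; apply: S_S0.
  rewrite (_ : (0 - i)%N = 0%N) ?sub0n //; exact: gdeg_comp.
have [x [xL _ _ xl]] := conv_left_inverse idL SL idD SD Sr0.
have x_id : x =1 id.
  move=> u; rewrite -[LHS](conv1r xL) -[RHS](conv1l idL).
  transitivity (conv x (conv S id) u).
    by apply: eq_tsum => a b; rewrite Sl.
  by rewrite -convA //; apply: eq_tsum => a b; rewrite xl.
exists S; split=> //; first exact: linmapP.
move=> u; rewrite -xl; apply: eq_tsum => a b.
by rewrite x_id.
Qed.
End GradedAntipode.

(** * The coaction of A and the associativity of the product *)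

Section Calculus.
Variables (k : fieldType) (A : hopfAlgebra k) (L : crossedData A).
Hypothesis LX : crossed_module L.
Local Notation T := (tspace L).
Local Notation H := (tensor A (tspace L)).
Local Notation hbase := (@hbase k A L).
Local Notation snoc := (@snoc k A L).
Local Notation hproj := (@hproj k A L).
Local Notation unsnoc := (@unsnoc k A L).
Local Notation hsign := (@hsign k A L).
Local Notation hcoact := (@hcoact k A L).
Local Notation hmul := (@hmul k A L).

Let act_bil : bilinear_map (@act k A L) := act_bilinear LX.
Let coact_lin : linmap (@coact k A L) := LinMap (coact_linear LX).
Let snoc_bil : bilinear_map snoc := @snoc_bilinear k A L.
Let hbase_lin : linmap hbase := @linmap_hbase k A L.
Let hproj_lin : linmap hproj := @linmap_hproj k A L.
Let unsnoc_lin : linmap unsnoc := @linmap_unsnoc k A L.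
Let hsign_lin : linmap hsign := @linmap_hsign k A L.
Let hcoact_lin : linmap hcoact := linmap_hcoact LX.
Let hmul_bil : bilinear_map hmul := hmul_bilinear LX.
Local Hint Resolve act_bil coact_lin snoc_bil hbase_lin hproj_lin unsnoc_lin
  hsign_lin hcoact_lin hmul_bil : lin.

(* Induction on the number of letters, with the last letter u' of u read off  *)
(* from unsnoc u.                                                             *)
Lemma unsnoc_ind (P : H -> Prop) :
  (forall c u v, P u -> P v -> P (c *: u + v)) ->
  (forall u, (forall (M : lmodType k) (f g : H -> L -> M),
      bilinear_map f -> bilinear_map g ->
      (forall u' x, P u' -> f u' x = g u' x) ->
      tsum (unsnoc u) f = tsum (unsnoc u) g) -> P u) ->
  forall u, P u.
Proof.
move=> PL IH; apply: letter_ind => // [a|u x Pu]; apply: IH => M f g fL gL fg.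
  by rewrite unsnoc_base !tsum0.
by rewrite unsnoc_snoc !tsum_pure // fg.
Qed.

(** The decomposition of [letter_split], tensored with [N]: it detects equality in H (x) N, as
    [tensor_hextr] does in N (x) H. *)
Lemma tensor_hext (N : lmodType k) (X Y : tensor H N) :
  \sw_(u, n <- X) hproj u \ot n = \sw_(u, n <- Y) hproj u \ot n ->
  \sw_(u, n <- X) \sw_(u', x <- unsnoc u) u' \ot (x \ot n) =
  \sw_(u, n <- Y) \sw_(u', x <- unsnoc u) u' \ot (x \ot n) -> X = Y.
Proof.
pose g1 (z : tensor A N) := \sw_(a, n <- z) hbase a \ot n.
pose g2 (z : tensor H (tensor L N)) := \sw_(u, t <- z) \sw_(x, n <- t) snoc u x \ot n.
have E (Z : tensor H N) : Z = g1 (\sw_(u, n <- Z) hproj u \ot n) +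
    g2 (\sw_(u, n <- Z) \sw_(u', x <- unsnoc u) u' \ot (x \ot n)).
  rewrite /g1 /g2 !tsum_tsum; try by lin.
  rewrite -tsum_add -[LHS]tsum_pure_id; apply: eq_tsum => u n.
  rewrite tsum_pure ?tsum_tsum; try by lin.
  rewrite [X in X \ot _ = _]letter_split (bilDl _ _ _ (pure_bilinear _ _)); congr (_ + _).
  rewrite (@linear_of_tsum _ _ _ _ _ (unsnoc u) _ (fun z => z \ot n)); last by lin.
  by apply: eq_tsum => u' x; rewrite !tsum_pure //; lin.
by move=> h1 h2; rewrite (E X) (E Y) h1 h2.
Qed.

Lemma tensor_hextr (N : lmodType k) (X Y : tensor N H) :
  \sw_(n, u <- X) n \ot hproj u = \sw_(n, u <- Y) n \ot hproj u ->
  \sw_(n, u <- X) \sw_(u', x <- unsnoc u) n \ot (u' \ot x) =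
  \sw_(n, u <- Y) \sw_(u', x <- unsnoc u) n \ot (u' \ot x) -> X = Y.
Proof.
pose g1 (z : tensor N A) := \sw_(n, a <- z) n \ot hbase a.
pose g2 (z : tensor N (tensor H L)) := \sw_(n, t <- z) \sw_(u, x <- t) n \ot snoc u x.
have E (Z : tensor N H) : Z = g1 (\sw_(n, u <- Z) n \ot hproj u) +
    g2 (\sw_(n, u <- Z) \sw_(u', x <- unsnoc u) n \ot (u' \ot x)).
  rewrite /g1 /g2 !tsum_tsum; try by lin.
  rewrite -tsum_add -[LHS]tsum_pure_id; apply: eq_tsum => n u.
  rewrite tsum_pure ?tsum_tsum; try by lin.
  rewrite [X in _ \ot X = _]letter_split (bilDr _ _ _ (pure_bilinear _ _)); congr (_ + _).
  rewrite (@linear_of_tsum _ _ _ _ _ (unsnoc u) _ (fun z => n \ot z)); last by lin.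
  by apply: eq_tsum => u' x; rewrite !tsum_pure //; lin.
by move=> h1 h2; rewrite (E X) (E Y) h1 h2.
Qed.

Lemma hproj_hsign u : hproj (hsign u) = hproj u.
Proof.
elim/letter_ind: u => [c u v hu hv|a|u x _].
- have fL : linmap (fun u => hproj (hsign u)) by lin.
  exact: (linmap_comb fL hproj_lin hu hv).
- by rewrite hsign_base.
- by rewrite hsign_snoc (linN _ (linmapP hproj_lin)) !hproj_snoc oppr0.
Qed.

Lemma unsnoc_hsign u : unsnoc (hsign u) = - \sw_(u', x <- unsnoc u) hsign u' \ot x.
Proof.
have h : linmap (fun u => - \sw_(u', x <- unsnoc u) hsign u' \ot x) by lin.
elim/letter_ind: u => [c u v hu hv|a|u x _].
- have fL : linmap (fun u => unsnoc (hsign u)) by lin.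
  exact: (linmap_comb fL h hu hv).
- by rewrite hsign_base unsnoc_base tsum0 ?oppr0 //; lin.
- by rewrite hsign_snoc (linN _ (linmapP unsnoc_lin)) !unsnoc_snoc tsum_pure //; lin.
Qed.

Lemma hcoact_hsign u : hcoact (hsign u) = \sw_(u0, u1 <- hcoact u) hsign u0 \ot u1.
Proof.
have h : linmap (fun u => \sw_(u0, u1 <- hcoact u) hsign u0 \ot u1) by lin.
elim/letter_ind: u => [c u v hu hv|a|u x hu].
- have fL : linmap (fun u => hcoact (hsign u)) by lin.
  exact: (linmap_comb fL h hu hv).
- rewrite hsign_base hcoact_base // tsum_tsum; last by lin.
  by apply: eq_tsum => a1 a2; rewrite tsum_pure ?hsign_base //; lin.
- rewrite hsign_snoc (linN _ (linmapP hcoact_lin)) !hcoact_snoc // hu !tsum_tsum;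
    try by lin.
  rewrite -tsum_opp; apply: eq_tsum => u0 u1; rewrite tsum_pure; last by lin.
  rewrite tsum_tsum -?tsum_opp; last by lin.
  apply: eq_tsum => x0 x1; rewrite tsum_pure ?hsign_snoc; last by lin.
  by rewrite (bilNl _ _ (pure_bilinear _ _)).
Qed.

Lemma sw_hcoact_hsign (M : lmodType k) (f : H -> A -> M) u : bilinear_map f ->
  tsum (hcoact (hsign u)) f = \sw_(u0, u1 <- hcoact u) f (hsign u0) u1.
Proof.
move=> fL; rewrite hcoact_hsign tsum_tsum //.
by apply: eq_tsum => u0 u1; rewrite tsum_pure.
Qed.

Lemma sw_unsnoc_hsign (M : lmodType k) (f : H -> L -> M) u : bilinear_map f ->
  tsum (unsnoc (hsign u)) f = - \sw_(u', x <- unsnoc u) f (hsign u') x.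
Proof.
move=> fL; rewrite unsnoc_hsign tsumNl // tsum_tsum //; congr (- _).
by apply: eq_tsum => u0 u1; rewrite tsum_pure.
Qed.

Lemma sw_hcoact_hproj (M : lmodType k) (f : A -> A -> M) u : bilinear_map f ->
  \sw_(u0, u1 <- hcoact u) f (hproj u0) u1 = tsum (Delta (hproj u)) f.
Proof.
move=> fL; have fh : bilinear_map (fun u0 u1 => f (hproj u0) u1).
  by have fL' := fL; lin.
have lL : linmap (fun u => \sw_(u0, u1 <- hcoact u) f (hproj u0) u1) by lin.
have rL : linmap (fun u => tsum (Delta (hproj u)) f) by lin.
elim/letter_ind: u => [c u v hu hv|a|u x _].
- exact: (linmap_comb lL rL hu hv).
- rewrite hcoact_base // hproj_base tsum_tsum //.
  by apply: eq_tsum => a1 a2; rewrite tsum_pure // hproj_base.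
- rewrite hcoact_snoc // hproj_snoc (lin0 (linmapP (linmap_Delta A))) tsum0 //.
  rewrite tsum_tsum // -[RHS](tsum_zero _ (hcoact u)); apply: eq_tsum => u0 u1.
  rewrite tsum_tsum // -[RHS](tsum_zero _ (coact x)); apply: eq_tsum => x0 x1.
  by rewrite tsum_pure // hproj_snoc (bil0l _ fL).
Qed.

(** [unsnoc] is colinear for the diagonal coaction on H (x) L, because [hcoact] multiplies the
    A-legs of the letters from left to right. *)
Lemma sw_hcoact_unsnoc (M : lmodType k) (F : H -> L -> A -> M) u : trilinear_map F ->
  \sw_(u0, u1 <- hcoact u) \sw_(u', x <- unsnoc u0) F u' x u1 =
  \sw_(u', x <- unsnoc u) \sw_(u'0, u'1 <- hcoact u') \sw_(x0, x1 <- coact x)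
     F u'0 x0 (u'1 * x1).
Proof.
move=> FL.
have fh : bilinear_map (fun u0 u1 => \sw_(u', x <- unsnoc u0) F u' x u1) by lin.
have rh : bilinear_map (fun u' x => \sw_(u'0, u'1 <- hcoact u') \sw_(x0, x1 <- coact x)
     F u'0 x0 (u'1 * x1)) by lin.
elim/letter_ind: u => [c u v hu hv|a|u x _].
- exact: (linmap_comb (linmap_tsum fh hcoact_lin) (linmap_tsum rh unsnoc_lin) hu hv).
- rewrite hcoact_base // unsnoc_base [RHS]tsum0 // tsum_tsum //.
  rewrite -[RHS](tsum_zero _ (Delta a)); apply: eq_tsum => a1 a2.
  by rewrite tsum_pure // unsnoc_base tsum0 //; lin.
- rewrite hcoact_snoc // unsnoc_snoc [RHS]tsum_pure // tsum_tsum //.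
  apply: eq_tsum => u0 u1; rewrite tsum_tsum //; apply: eq_tsum => x0 x1.
  by rewrite tsum_pure // unsnoc_snoc tsum_pure //; lin.
Qed.

(** The crossed module condition without the antipode: the extra leg of [a] on the left cancels the
    factor S a_(1) in [coact_act]. *)
Lemma sw_coact_act (M : lmodType k) (F : L -> A -> M) x a : bilinear_map F ->
  \sw_(a1, a2 <- Delta a) \sw_(y0, y1 <- coact (act x a2)) F y0 (a1 * y1) =
  \sw_(x0, x1 <- coact x) \sw_(a1, a2 <- Delta a) F (act x0 a1) (x1 * a2).
Proof.
move=> FL.
transitivity (\sw_(x0, x1 <- coact x) \sw_(a1, a2 <- Delta a)
   \sw_(b1, b' <- Delta a2) \sw_(b2, b3 <- Delta b')
     F (act x0 b2) (a1 * antipode b1 * (x1 * b3))).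
  rewrite [RHS]tsumC; apply: eq_tsum => a1 a2; rewrite (coact_act LX) tsum_tsum;
    last by lin.
  apply: eq_tsum => x0 x1; rewrite tsum_tsum; last by lin.
  apply: eq_tsum => b1 b'; rewrite tsum_tsum; last by lin.
  apply: eq_tsum => b2 b3; rewrite tsum_pure; last by lin.
  by rewrite !mulrA.
apply: eq_tsum => x0 x1.
rewrite -(@sw_DeltaA _ _ _ (fun a1 b1 b' => \sw_(b2, b3 <- Delta b')
     F (act x0 b2) (a1 * antipode b1 * (x1 * b3))) a); last by lin.
rewrite -[RHS](@sw_epsl _ _ _ (fun a => \sw_(a1, a2 <- Delta a) F (act x0 a1) (x1 *
  a2))); last by lin.
apply: eq_tsum => a1 a2.
rewrite (@sw_antipoder _ _ _ (fun z => \sw_(b2, b3 <- Delta a2) F (act x0 b2) (z * (x1 *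
  b3)))); last by lin.
by congr (_ *: _); apply: eq_tsum => b2 b3; rewrite mul1r.
Qed.

Lemma sw_coactA (M : lmodType k) (F : L -> A -> A -> M) x : trilinear_map F ->
  \sw_(x0, x1 <- coact x) \sw_(y0, y1 <- coact x0) F y0 y1 x1 =
  \sw_(x0, x1 <- coact x) \sw_(a, b <- Delta x1) F x0 a b.
Proof.
move=> FL; rewrite -(tsum3E _ _ (fun _ _ b _ => b) (fun _ _ _ c => c) (fun _ a2 _ _ =>
  a2) FL).
by rewrite (coactA LX) tsum3E.
Qed.

Lemma sw_DeltaM (M : lmodType k) (F : A -> A -> M) a b : bilinear_map F ->
  tsum (Delta (a * b)) F =
  \sw_(a1, a2 <- Delta a) \sw_(b1, b2 <- Delta b) F (a1 * b1) (a2 * b2).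
Proof.
move=> FL; rewrite DeltaM tsum_tsum //; apply: eq_tsum => a1 a2.
by rewrite tsum_tsum //; apply: eq_tsum => b1 b2; rewrite tsum_pure.
Qed.

Lemma sw_hcoactA (M : lmodType k) (F : H -> A -> A -> M) u : trilinear_map F ->
  \sw_(u0, u1 <- hcoact u) \sw_(v0, v1 <- hcoact u0) F v0 v1 u1 =
  \sw_(u0, u1 <- hcoact u) \sw_(a, b <- Delta u1) F u0 a b.
Proof.
move: M F; elim/letter_ind: u => [c u v hu hv|a|u x hu] M F FL.
- have lL : linmap (fun u => \sw_(u0, u1 <- hcoact u) \sw_(v0, v1 <- hcoact u0) F v0 v1
    u1) by lin.
  have rL : linmap (fun u => \sw_(u0, u1 <- hcoact u) \sw_(a, b <- Delta u1) F u0 a b)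
    by lin.
  exact: (linmap_comb lL rL (hu M F FL) (hv M F FL)).
- rewrite hcoact_base // !tsum_tsum; try by lin.
  rewrite -[RHS](@eq_tsum _ _ _ _ (fun a1 a2 => \sw_(b, c <- Delta a2) F (hbase a1) b
    c)); last first.
    by move=> a1 a2; rewrite tsum_pure //; lin.
  rewrite -(@sw_DeltaA _ _ _ (fun a b c => F (hbase a) b c)); last by lin.
  apply: eq_tsum => a1 a2; rewrite tsum_pure ?hcoact_base ?tsum_tsum //; try by lin.
  by apply: eq_tsum => b1 b2; rewrite tsum_pure //; lin.
- rewrite hcoact_snoc // !tsum_tsum; try by lin.
  transitivity (\sw_(u0, u1 <- hcoact u) \sw_(v0, v1 <- hcoact u0)
     \sw_(x0, x1 <- coact x) \sw_(y0, y1 <- coact x0) F (snoc v0 y0) (v1 * y1) (u1 * x1)).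
    apply: eq_tsum => u0 u1; rewrite tsum_tsum; last by lin.
    rewrite [RHS]tsumC; apply: eq_tsum => x0 x1;
      rewrite tsum_pure ?hcoact_snoc ?tsum_tsum //; try by lin.
    apply: eq_tsum => v0 v1; rewrite tsum_tsum; last by lin.
    by apply: eq_tsum => y0 y1; rewrite tsum_pure //; lin.
  rewrite hu; last by lin.
  apply: eq_tsum => u0 u1; rewrite tsum_tsum; last by lin.
  rewrite tsumC; transitivity (\sw_(x0, x1 <- coact x) \sw_(b1, b2 <- Delta x1)
     \sw_(a, b <- Delta u1) F (snoc u0 x0) (a * b1) (b * b2)); last first.
    apply: eq_tsum => x0 x1; rewrite tsum_pure; last by lin.
    rewrite sw_DeltaM; last by lin.
    exact: tsumC.
  rewrite -(@sw_coactA _ (fun x0 b1 b2 => \sw_(a, b <- Delta u1) F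
    (snoc u0 x0) (a * b1) (b * b2))); last by lin.
  by apply: eq_tsum => x0 x1; exact: tsumC.
Qed.

Lemma sw_hcoact_eps u : \sw_(u0, u1 <- hcoact u) eps u1 *: u0 = u.
Proof.
have lL : linmap (fun u => \sw_(u0, u1 <- hcoact u) eps u1 *: u0) by lin.
elim/letter_ind: u => [c u v hu hv|a|u x hu].
- exact: (linmap_comb lL (linmap_id _) hu hv).
- rewrite hcoact_base // tsum_tsum; last by lin.
  rewrite -[RHS](@sw_epsr _ _ _ hbase a); last by lin.
  by apply: eq_tsum => a1 a2; rewrite tsum_pure //; lin.
- rewrite hcoact_snoc // tsum_tsum; last by lin.
  rewrite -[in RHS]hu (@linear_of_tsum _ _ _ _ _ _ _ (fun u => snoc u x)); last by lin.
  apply: eq_tsum => u0 u1; rewrite -[in RHS](coact_eps LX x).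
  rewrite (@linear_of_tsum _ _ _ _ _ _ _ (fun x => snoc (eps u1 *: u0) x)); last by lin.
  rewrite tsum_tsum; last by lin.
  apply: eq_tsum => x0 x1; rewrite tsum_pure; last by lin.
  by rewrite epsM (bilZl _ _ _ snoc_bil) (bilZr _ _ _ snoc_bil) scalerA.
Qed.

Lemma sw_unsnoc_hmul (M : lmodType k) (F : H -> L -> M) u v : bilinear_map F ->
  tsum (unsnoc (hmul u v)) F =
  \sw_(v', y <- unsnoc v) F (hmul u v') y
  + \sw_(u', x <- unsnoc u) \sw_(v0, v1 <- hcoact v) F (hmul u' (hsign v0)) (act x v1).
Proof.
move=> FL; rewrite unsnoc_hmul // tsumDl // !tsum_tsum //; congr (_ + _).
  by apply: eq_tsum => v' y; rewrite tsum_pure.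
apply: eq_tsum => u' x; rewrite tsum_tsum // sw_hcoact_hsign //; last by lin.
by apply: eq_tsum => v0 v1; rewrite tsum_pure.
Qed.

(** The pattern for all identities of products: an outer induction on [u] for all [v], an inner one
    on [v] for fixed [u]. Terms whose last letter comes from [v] use the inner hypothesis, those
    whose letter comes from [u] the outer one. For the latter, [sw_coact_act] compares the coaction
    of a letter acted on by A with the two separate coactions. *)
Lemma hcoact_hmul u v : hcoact (hmul u v) =
  \sw_(u0, u1 <- hcoact u) \sw_(v0, v1 <- hcoact v) hmul u0 v0 \ot (u1 * v1).
Proof.
have lL : bilinear_map (fun u v => hcoact (hmul u v)) by lin.
have rL : bilinear_map (fun u v => \sw_(u0, u1 <- hcoact u) \sw_(v0, v1 <- hcoact v)
   hmul u0 v0 \ot (u1 * v1)) by lin.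
elim/unsnoc_ind: u v => [c u u' hu hu' v|u hu v].
  exact: (linear_comb (lL.1 v) (rL.1 v) (hu v) (hu' v)).
elim/unsnoc_ind: v => [c v v' hv hv'|v hv].
  exact: (linear_comb (lL.2 u) (rL.2 u) hv hv').
apply: tensor_hext.
  rewrite (sw_hcoact_hproj (f := fun a b => a \ot b)) //; last by lin.
  rewrite hproj_hmul // sw_DeltaM; last by lin.
  rewrite -(sw_hcoact_hproj (f := fun a b => \sw_(b1, b2 <- Delta (hproj v)) (a * b1)
    \ot (b * b2))) //; last by lin.
  rewrite tsum_tsum; last by lin.
  apply: eq_tsum => u0 u1; rewrite tsum_tsum; last by lin.
  rewrite -(sw_hcoact_hproj (f := fun b1 b2 => (hproj u0 * b1) \ot (u1 * b2))) //;
    last by lin.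
  by apply: eq_tsum => v0 v1; rewrite tsum_pure ?hproj_hmul //; lin.
rewrite (sw_hcoact_unsnoc (F := fun u x a => u \ot (x \ot a))) //; last by lin.
rewrite sw_unsnoc_hmul; last by lin.
transitivity (\sw_(u0, u1 <- hcoact u) \sw_(v0, v1 <- hcoact v)
   ((\sw_(v', y <- unsnoc v0) hmul u0 v' \ot (y \ot (u1 * v1)))
   + \sw_(u', x <- unsnoc u0) \sw_(v00, v01 <- hcoact v0) hmul u' (hsign v00) \ot (act x
     v01 \ot (u1 * v1)))); last first.
  rewrite tsum_tsum; last by lin.
  apply: eq_tsum => u0 u1; rewrite tsum_tsum; last by lin.
  apply: eq_tsum => v0 v1; rewrite tsum_pure; last by lin.
  by rewrite sw_unsnoc_hmul //; lin.
under [RHS]eq_tsum => u0 u1 do rewrite tsum_add.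
rewrite tsum_add; congr (_ + _).
  rewrite (hv _ _ (fun v' y => \sw_(v'0, v'1 <- \sw_(u0, u1 <- hcoact u) \sw_(v0, v1 <-
    hcoact v')
   hmul u0 v0 \ot (u1 * v1)) \sw_(x0, x1 <- coact y) v'0 \ot (x0 \ot (v'1 * x1))));
     first last.
  - by move=> v' y ->.
  - by lin.
  - by lin.
  transitivity (\sw_(u0, u1 <- hcoact u) \sw_(v', y <- unsnoc v) \sw_(v0, v1 <- hcoact v')
     \sw_(y0, y1 <- coact y) hmul u0 v0 \ot (y0 \ot (u1 * (v1 * y1)))).
    rewrite [RHS]tsumC; apply: eq_tsum => v' y; rewrite tsum_tsum; last by lin.
    apply: eq_tsum => u0 u1; rewrite tsum_tsum; last by lin.
    apply: eq_tsum => v0 v1; rewrite tsum_pure; last by lin.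
    by apply: eq_tsum => y0 y1; rewrite mulrA.
  apply: eq_tsum => u0 u1.
  by rewrite (sw_hcoact_unsnoc (F := fun v' y v1 => hmul u0 v' \ot (y \ot (u1 * v1))))
    //; lin.
(* On the right-hand side [v] coacts twice, the inner A-leg acting on the letter of [u].
   Coassociativity turns this into one coaction whose A-leg is split by Delta. *)
transitivity (\sw_(u', x <- unsnoc u) \sw_(u'0, u'1 <- hcoact u') \sw_(x0, x1 <- coact x)
    \sw_(v0, v1 <- hcoact v) \sw_(a1, a2 <- Delta v1)
      hmul u'0 (hsign v0) \ot (act x0 a1 \ot ((u'1 * x1) * a2))); last first.
  pose K (u' : H) (x : L) (b : A) := \sw_(v0, v1 <- hcoact v) \sw_(a1, a2 <- Delta v1)
      hmul u' (hsign v0) \ot (act x a1 \ot (b * a2)).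
  have KL : trilinear_map K by rewrite /K; lin.
  rewrite -(sw_hcoact_unsnoc u KL); apply: eq_tsum => u0 u1.
  rewrite [RHS]tsumC; apply: eq_tsum => u' x; rewrite /K.
  rewrite -(sw_hcoactA (F := fun v0 a1 a2 => hmul u' (hsign v0) \ot (act x a1 \ot (u1 *
    a2)))) //.
  by lin.
apply: hu => [||u' x hu]; [by lin | by lin |].
transitivity (\sw_(v0, v1 <- hcoact v) \sw_(u'0, u'1 <- hcoact u') \sw_(w0, w1 <- hcoact v0)
    \sw_(x0, x1 <- coact (act x v1)) hmul u'0 (hsign w0) \ot (x0 \ot (u'1 * (w1 * x1)))).
  apply: eq_tsum => v0 v1; rewrite hu tsum_tsum; last by lin.
  apply: eq_tsum => u0 u1; rewrite tsum_tsum; last by lin.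
  rewrite (sw_hcoact_hsign); last by lin.
  apply: eq_tsum => w0 w1; rewrite tsum_pure; last by lin.
  by apply: eq_tsum => x0 x1; rewrite mulrA.
rewrite tsumC; apply: eq_tsum => u0 u1.
rewrite (sw_hcoactA (F := fun w0 w1 v1 => \sw_(x0, x1 <- coact (act x v1))
   hmul u0 (hsign w0) \ot (x0 \ot (u1 * (w1 * x1))))); last by lin.
rewrite [RHS]tsumC; apply: eq_tsum => v0 v1.
rewrite (sw_coact_act (F := fun x0 x1 => hmul u0 (hsign v0) \ot (x0 \ot (u1 * x1))));
  last by lin.
by apply: eq_tsum => x0 x1; apply: eq_tsum => a1 a2; rewrite mulrA.
Qed.

Lemma hsign_hmul u v : hsign (hmul u v) = hmul (hsign u) (hsign v).
Proof.
have lL : bilinear_map (fun u v => hsign (hmul u v)) by lin.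
have rL : bilinear_map (fun u v => hmul (hsign u) (hsign v)) by lin.
elim/unsnoc_ind: u v => [c u u' hu hu' v|u hu v].
  exact: (linear_comb (lL.1 v) (rL.1 v) (hu v) (hu' v)).
elim/unsnoc_ind: v => [c v v' hv hv'|v hv].
  exact: (linear_comb (lL.2 u) (rL.2 u) hv hv').
apply: hproj_unsnoc_inj; first by rewrite !(hproj_hmul, hproj_hsign).
rewrite -[LHS]tsum_pure_id -[RHS]tsum_pure_id sw_unsnoc_hsign ?sw_unsnoc_hmul //;
  try by lin.
rewrite !sw_unsnoc_hsign; try by lin.
rewrite opprD; congr (- _ + - _).
  by apply: hv => [||v' y ->]; [lin|lin|].
apply: hu => [||u' x hu]; [by lin|by lin|].
rewrite sw_hcoact_hsign //; last by lin.
by apply: eq_tsum => v0 v1; rewrite hu.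
Qed.

(** Both bracketings take their last letter from [w], [v] or [u]. A letter of [u] is acted on by the
    A-leg of v w on one side and by those of [v] and [w] in turn on the other; these agree since
    [hcoact] and [hsign] are multiplicative. *)
Lemma hmulA : associative hmul.
Proof.
elim/unsnoc_ind => [c u u' hu hu' v w|u hu v w].
  by apply: (linmap_comb (f := fun u => hmul u (hmul v w))
    (g := fun u => hmul (hmul u v) w)) => //; lin.
elim/unsnoc_ind: v w => [c v v' hv hv' w|v hv w].
  by apply: (linmap_comb (f := fun v => hmul u (hmul v w))
    (g := fun v => hmul (hmul u v) w)) => //; lin.
elim/unsnoc_ind: w => [c w w' hw hw'|w hw].
  by apply: (linmap_comb (f := fun w => hmul u (hmul v w))) => //; lin.
apply: hproj_unsnoc_inj; first by rewrite !hproj_hmul // mulrA.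
rewrite -[LHS]tsum_pure_id -[RHS]tsum_pure_id !sw_unsnoc_hmul; try by lin.
rewrite -addrA; congr (_ + _); first by apply: hw => [||w' z ->]; [lin|lin|].
congr (_ + _).
  apply: hv => [||v' y hv]; [by lin | by lin |].
  by apply: eq_tsum => w0 w1; rewrite hv.
apply: hu => [||u' x hu]; [by lin | by lin |].
rewrite hcoact_hmul tsum_tsum; last by lin.
apply: eq_tsum => v0 v1; rewrite tsum_tsum; last by lin.
apply: eq_tsum => w0 w1; rewrite tsum_pure; last by lin.
by rewrite hsign_hmul hu (actM LX).
Qed.

Lemma hmul1x u : hmul (hbase 1) u = u.
Proof.
elim/letter_ind: u => [c u v hu hv|a|u x hu].
- exact: (linear_comb (hmul_bil.2 _) (linmapP (linmap_id _)) hu hv).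
- by rewrite hmul_base // mul1r.
- by rewrite hmul_base_snoc // hu.
Qed.

Lemma hcoact1 : hcoact (hbase 1) = hbase 1 \ot 1.
Proof. by rewrite hcoact_base // Delta1 tsum_pure //; lin. Qed.

Lemma hmulx1 u : hmul u (hbase 1) = u.
Proof.
elim/letter_ind: u => [c u v hu hv|a|u x hu].
- exact: (linear_comb (hmul_bil.1 _) (linmapP (linmap_id _)) hu hv).
- by rewrite hmul_base // mulr1.
- rewrite hmul_snoc // unsnoc_base tsum0 ?add0r; last by lin.
  rewrite hsign_base hcoact1 tsum_pure; last by lin.
  by rewrite hu (act1 LX).
Qed.

(** * The coproduct *)

Fact hDelta_key : unit. Proof. exact: tt. Qed.
Definition hDelta : H -> tensor H H := locked_with hDelta_key (@boson_Delta k A (Sh L)).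

Lemma hDeltaE : hDelta = @boson_Delta k A (Sh L).
Proof. exact: locked_withE. Qed.

Let sh_Delta_lin : linmap (@sh_Delta k A L) := LinMap (@sh_Delta_linear k A L).
Let wcoact_lin : linmap (@coact k A (tspace_crossed L)) := LinMap (sh_coact_linear LX).
Local Hint Resolve sh_Delta_lin wcoact_lin : lin.

Lemma linmap_hDelta : linmap hDelta.
Proof.
have h : linmap (fun u : H => \sw_(a, eta <- u) \sw_(a1, a2 <- Delta a)
  \sw_(eta1, eta2 <- @sh_Delta k A L eta)
  \sw_(eta10, eta11 <- @coact k A (tspace_crossed L) eta1)
    (a1 \ot eta10) \ot ((a2 * eta11) \ot eta2)) by lin.
by rewrite hDeltaE; exact: h.
Qed.
Local Hint Resolve linmap_hDelta : lin.

Lemma hDelta_pure a x : hDelta (a \ot x) =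
  \sw_(a1, a2 <- Delta a) \sw_(x1, x2 <- @sh_Delta k A L x)
  \sw_(x10, x11 <- @coact k A (tspace_crossed L) x1)
    (a1 \ot x10) \ot ((a2 * x11) \ot x2).
Proof.
rewrite hDeltaE; apply: (@boson_Delta_pure k A (Sh L)).
  exact: sh_coact_linear.
exact: sh_Delta_linear.
Qed.

Lemma sh_Delta1 : @sh_Delta k A L (tw [::]) = tw [::] \ot tw [::].
Proof. by rewrite sh_Delta_tw big_ord1. Qed.

Lemma sh_Delta_snoc x v : @sh_Delta k A L (tcat x (tw [:: v])) =
  \sw_(x1, x2 <- @sh_Delta k A L x) x1 \ot tcat x2 (tw [:: v])
  + tcat x (tw [:: v]) \ot tw [::].
Proof.
have rL : linmap (fun x => \sw_(x1, x2 <- @sh_Delta k A L x) x1 \ot tcat x2 (tw [:: v])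
  + tcat x (tw [:: v]) \ot tw [::]) by lin.
apply: (tspace_ext (f := fun x => @sh_Delta k A L (tcat x (tw [:: v]))) _ rL); first by lin.
move=> s; rewrite -tw_rcons !sh_Delta_tw size_rcons big_ord_recr /=; congr (_ + _);
  last first.
  by rewrite -(size_rcons s v) take_size drop_size.
have h : linmap (fun z : tensor T T => \sw_(x1, x2 <- z) x1 \ot tcat x2 (tw [:: v])) by lin.
rewrite (lin_sum _ _ _ (linmapP h)); apply: eq_bigr => i _.
rewrite tsum_pure; last by lin.
have le_is : (i <= size s)%N by rewrite -ltnS.
rewrite -tw_rcons -!cats1 takel_cat // drop_cat.
case: ltnP => // le_si; have -> : nat_of_ord i = size s by apply/eqP; rewrite eqn_leq le_is.
by rewrite subnn drop_size.
Qed.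

Lemma hDelta_base a : hDelta (hbase a) = \sw_(a1, a2 <- Delta a) hbase a1 \ot hbase a2.
Proof.
rewrite hDelta_pure; apply: eq_tsum => a1 a2; rewrite sh_Delta1 tsum_pure; last by lin.
by rewrite wcoact1 // tsum_pure ?mulr1 //; lin.
Qed.

(** A cut of the word either comes before the last letter, which then stays at the end of the right
    leg, or after it. In the latter case only the A-leg of the coaction is left on the right. *)
Lemma hDelta_snoc u v : hDelta (snoc u v) =
  \sw_(u1, u2 <- hDelta u) u1 \ot snoc u2 v
  + \sw_(u0, u1 <- hcoact (snoc u v)) u0 \ot hbase u1.
Proof.
have linmap_hDelta := linmap_hDelta.
pose f u := hDelta (snoc u v).
pose g u := \sw_(u1, u2 <- hDelta u) u1 \ot snoc u2 v
  + \sw_(u0, u1 <- hcoact (snoc u v)) u0 \ot hbase u1.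
have fL : linmap f by rewrite /f; lin.
have gL : linmap g by rewrite /g; lin.
rewrite -/(f u) -/(g u); elim/tensor_ind: u => [c u u' hu hu'|a x].
  exact: (linmap_comb fL gL hu hu').
rewrite /f /g snoc_pure !hDelta_pure hcoact_pure // !tsum_tsum; try by lin.
rewrite -tsum_add; apply: eq_tsum => a1 a2.
rewrite sh_Delta_snoc tsumDl; last by lin.
rewrite !tsum_tsum; try by lin.
congr (_ + _).
  apply: eq_tsum => x1 x2; rewrite tsum_pure ?tsum_tsum; try by lin.
  by apply: eq_tsum => x10 x11; rewrite tsum_pure ?snoc_pure //; lin.
rewrite tsum_pure; last by lin.
by apply: eq_tsum => x0 x1; rewrite tsum_pure //; lin.
Qed.

Lemma sw_hDelta_base (M : lmodType k) (F : H -> H -> M) a : bilinear_map F ->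
  tsum (hDelta (hbase a)) F = \sw_(a1, a2 <- Delta a) F (hbase a1) (hbase a2).
Proof.
by move=> FL; rewrite hDelta_base // tsum_tsum //; apply: eq_tsum => a1 a2;
  rewrite tsum_pure.
Qed.

Lemma sw_hDelta_snoc (M : lmodType k) (F : H -> H -> M) u x : bilinear_map F ->
  tsum (hDelta (snoc u x)) F = \sw_(u1, u2 <- hDelta u) F u1 (snoc u2 x)
  + \sw_(u0, u1 <- hcoact (snoc u x)) F u0 (hbase u1).
Proof.
move=> FL; rewrite hDelta_snoc // tsumDl // !tsum_tsum //.
by congr (_ + _); apply: eq_tsum => u1 u2; rewrite tsum_pure.
Qed.

Lemma sw_hcoact_base (M : lmodType k) (F : H -> A -> M) a : bilinear_map F ->
  tsum (hcoact (hbase a)) F = \sw_(a1, a2 <- Delta a) F (hbase a1) a2.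
Proof.
by move=> FL; rewrite hcoact_base // tsum_tsum //; apply: eq_tsum => a1 a2;
  rewrite tsum_pure.
Qed.

Lemma sw_hcoact_snoc (M : lmodType k) (F : H -> A -> M) u x : bilinear_map F ->
  tsum (hcoact (snoc u x)) F =
  \sw_(u0, u1 <- hcoact u) \sw_(x0, x1 <- coact x) F (snoc u0 x0) (u1 * x1).
Proof.
move=> FL; rewrite hcoact_snoc // tsum_tsum //; apply: eq_tsum => u0 u1.
by rewrite tsum_tsum //; apply: eq_tsum => x0 x1; rewrite tsum_pure.
Qed.

Lemma sw_hDelta_hproj (M : lmodType k) (f : H -> A -> M) u : bilinear_map f ->
  \sw_(u1, u2 <- hDelta u) f u1 (hproj u2) = tsum (hcoact u) f.
Proof.
move=> fL; apply: (letter_ext (f := fun u => \sw_(u1, u2 <- hDelta u) f u1 (hproj u2))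
  (g := fun u => tsum (hcoact u) f)); try by lin.
  move=> a; rewrite sw_hDelta_base ?sw_hcoact_base //; last by lin.
  by apply: eq_tsum => a1 a2; rewrite hproj_base.
move=> {}u x _; rewrite sw_hDelta_snoc; last by lin.
rewrite -[RHS]add0r; congr (_ + _); last by apply: eq_tsum => u0 u1; rewrite hproj_base.
rewrite -[RHS](tsum_zero _ (hDelta u)); apply: eq_tsum => u1 u2.
by rewrite hproj_snoc (bil0r _ fL).
Qed.

Lemma sw_hDelta_unsnoc (M : lmodType k) (F : H -> H -> L -> M) u : trilinear_map F ->
  \sw_(u1, u2 <- hDelta u) \sw_(u', x <- unsnoc u2) F u1 u' x =
  \sw_(u', x <- unsnoc u) \sw_(u1, u2 <- hDelta u') F u1 u2 x.
Proof.
move=> FL; apply: (letter_ext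
  (f := fun u => \sw_(u1, u2 <- hDelta u) \sw_(u', x <- unsnoc u2) F u1 u' x)
  (g := fun u => \sw_(u', x <- unsnoc u) \sw_(u1, u2 <- hDelta u') F u1 u2 x)); try by lin.
  move=> a; rewrite unsnoc_base [RHS]tsum0; last by lin.
  rewrite sw_hDelta_base; last by lin.
  rewrite -[RHS](tsum_zero _ (Delta a)); apply: eq_tsum => a1 a2.
  by rewrite unsnoc_base tsum0 //; lin.
move=> {}u x _; rewrite sw_hDelta_snoc; last by lin.
rewrite unsnoc_snoc [RHS]tsum_pure; last by lin.
rewrite -[RHS]addr0; congr (_ + _).
  by apply: eq_tsum => u1 u2; rewrite unsnoc_snoc tsum_pure //; lin.
rewrite -[RHS](tsum_zero _ (hcoact (snoc u x))); apply: eq_tsum => u0 u1.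
by rewrite unsnoc_base tsum0 //; lin.
Qed.

(** Coassociativity with the last leg projected to A. It is established separately because it
    settles, in [sw_hDeltaA], the terms whose first cut comes after the last letter. *)
Lemma sw_hDelta_hcoact (M : lmodType k) (F : H -> H -> A -> M) u : trilinear_map F ->
  \sw_(u0, u1 <- hcoact u) \sw_(v1, v2 <- hDelta u0) F v1 v2 u1 =
  \sw_(u1, u2 <- hDelta u) \sw_(v0, v1 <- hcoact u2) F u1 v0 v1.
Proof.
move: M F; elim/letter_ind: u => [c u v hu hv|a|u x hu] M F FL.
- have lL : linmap (fun u => \sw_(u0, u1 <- hcoact u) \sw_(v1, v2 <- hDelta u0) F v1 v2
    u1) by lin.
  have rL : linmap (fun u => \sw_(u1, u2 <- hDelta u) \sw_(v0, v1 <- hcoact u2) F u1 v0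
    v1) by lin.
  exact: (linmap_comb lL rL (hu M F FL) (hv M F FL)).
- rewrite sw_hDelta_base ?sw_hcoact_base; try by lin.
  transitivity (\sw_(a1, a2 <- Delta a) \sw_(b, c <- Delta a1) F (hbase b) (hbase c) a2).
    by apply: eq_tsum => a1 a2; rewrite sw_hDelta_base //; lin.
  rewrite (@sw_DeltaA _ _ _ (fun a b c => F (hbase a) (hbase b) c)); last by lin.
  by apply: eq_tsum => a1 a2; rewrite sw_hcoact_base //; lin.
- transitivity (\sw_(u0, u1 <- hcoact u) \sw_(v1, v2 <- hDelta u0) \sw_(x0, x1 <- coact x)
        F v1 (snoc v2 x0) (u1 * x1)
      + \sw_(u0, u1 <- hcoact (snoc u x)) \sw_(w0, w1 <- hcoact u0) F w0 (hbase w1) u1).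
    rewrite !sw_hcoact_snoc; try by lin.
    rewrite -tsum_add; apply: eq_tsum => u0 u1.
    rewrite [X in _ = X + _]tsumC -tsum_add; apply: eq_tsum => x0 x1.
    by rewrite sw_hDelta_snoc //; lin.
  rewrite (sw_hcoactA (F := fun a b c => F a (hbase b) c)); last by lin.
  rewrite sw_hDelta_snoc; last by lin.
  congr (_ + _).
    rewrite (hu _ (fun v1 v2 u1 => \sw_(x0, x1 <- coact x) F v1
      (snoc v2 x0) (u1 * x1))); last by lin.
    by apply: eq_tsum => u1 u2; rewrite sw_hcoact_snoc //; lin.
  by apply: eq_tsum => u0 u1; rewrite sw_hcoact_base //; lin.
Qed.

Lemma sw_hDeltaA (M : lmodType k) (F : H -> H -> H -> M) u : trilinear_map F ->
  \sw_(u1, u2 <- hDelta u) \sw_(v1, v2 <- hDelta u1) F v1 v2 u2 =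
  \sw_(u1, u2 <- hDelta u) \sw_(v1, v2 <- hDelta u2) F u1 v1 v2.
Proof.
move: M F; elim/letter_ind: u => [c u v hu hv|a|u x hu] M F FL.
- have lL : linmap (fun u => \sw_(u1, u2 <- hDelta u) \sw_(v1, v2 <- hDelta u1) F v1 v2
    u2) by lin.
  have rL : linmap (fun u => \sw_(u1, u2 <- hDelta u) \sw_(v1, v2 <- hDelta u2) F u1 v1
    v2) by lin.
  exact: (linmap_comb lL rL (hu M F FL) (hv M F FL)).
- rewrite !sw_hDelta_base; try by lin.
  transitivity (\sw_(a1, a2 <- Delta a) \sw_(b, c <- Delta a1) F (hbase b) (hbase c)
    (hbase a2)).
    by apply: eq_tsum => a1 a2; rewrite sw_hDelta_base //; lin.
  rewrite (@sw_DeltaA _ _ _ (fun a b c => F (hbase a) (hbase b) (hbase c))); last by lin.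
  by apply: eq_tsum => a1 a2; rewrite sw_hDelta_base //; lin.
- rewrite sw_hDelta_snoc; last by lin.
  rewrite (hu _ (fun v1 v2 u2 => F v1 v2 (snoc u2 x))); last by lin.
  rewrite (sw_hDelta_hcoact (F := fun v1 v2 u1 => F v1 v2 (hbase u1))); last by lin.
  rewrite !sw_hDelta_snoc; try by lin.
  rewrite addrA -tsum_add; congr (_ + _); apply: eq_tsum => u1 u2.
    by rewrite sw_hDelta_snoc //; lin.
  by rewrite sw_hcoact_base ?sw_hDelta_base //; lin.
Qed.

Lemma hDelta_counitr u : \sw_(u1, u2 <- hDelta u) eps (hproj u2) *: u1 = u.
Proof.
rewrite (sw_hDelta_hproj (f := fun u a => eps a *: u)); last by lin.
exact: sw_hcoact_eps.
Qed.

Lemma hDelta_counitl u : \sw_(u1, u2 <- hDelta u) eps (hproj u1) *: u2 = u.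
Proof.
apply: (letter_ext (f := fun u => \sw_(u1, u2 <- hDelta u) eps (hproj u1) *: u2) (g := id));
  try by lin.
  move=> a; rewrite sw_hDelta_base /=; last by lin.
  rewrite -[RHS](@sw_epsl _ _ _ hbase); last by lin.
  by apply: eq_tsum => a1 a2; rewrite hproj_base.
move=> {}u x hu /=; rewrite sw_hDelta_snoc; last by lin.
rewrite (sw_hcoact_hproj (f := fun a b => eps a *: hbase b)); last by lin.
rewrite hproj_snoc (lin0 (linmapP (linmap_Delta A))) tsum0 ?addr0; last by lin.
rewrite -[in RHS]hu (@linear_of_tsum _ _ _ _ _ _ _ (fun z => snoc z x)); last by lin.
by apply: eq_tsum => u1 u2; rewrite (bilZl _ _ _ snoc_bil).
Qed.

Lemma hDelta_hsign u : hDelta (hsign u) = \sw_(u1, u2 <- hDelta u) hsign u1 \ot hsign u2.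
Proof.
apply: (letter_ext (f := fun u => hDelta (hsign u))
  (g := fun u => \sw_(u1, u2 <- hDelta u) hsign u1 \ot hsign u2)); try by lin.
  move=> a; rewrite hsign_base hDelta_base // tsum_tsum; last by lin.
  by apply: eq_tsum => a1 a2; rewrite tsum_pure ?hsign_base //; lin.
move=> {}u x hu; rewrite hsign_snoc (linN _ (linmapP linmap_hDelta)) hDelta_snoc // hu.
rewrite sw_hDelta_snoc; last by lin.
rewrite opprD tsum_tsum -?tsum_opp; last by lin.
congr (_ + _).
  apply: eq_tsum => u1 u2; rewrite tsum_pure; last by lin.
  by rewrite hsign_snoc (bilNr _ _ (pure_bilinear _ _)).
rewrite -[snoc _ _]opprK -hsign_snoc (linN _ (linmapP hcoact_lin)) tsumNl; last by lin.
rewrite tsum_opp opprK hcoact_hsign // tsum_tsum; last by lin.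
by apply: eq_tsum => u0 u1; rewrite tsum_pure ?hsign_base //; lin.
Qed.

(** * The grading, the super flip and the multiplicativity of the coproduct *)

Fact hcomp_key : unit. Proof. exact: tt. Qed.
Definition hcomp (n : nat) : H -> H := locked_with hcomp_key (@boson_comp k A (Sh L) n).

Lemma hcompE n : hcomp n = @boson_comp k A (Sh L) n.
Proof. exact: locked_withE. Qed.

Let tproj_lin n : linmap (@tspace_proj k L n) := linmap_tspace_proj L n.
Let tsign_lin : linmap (@tsign k A L) := linmap_tsign L.
Local Hint Resolve tproj_lin tsign_lin : lin.

Lemma linmap_hcomp n : linmap (hcomp n).
Proof.
have h : linmap (fun u : H => \sw_(a, x <- u) a \ot @tspace_proj k L n x) by lin.
by rewrite hcompE; exact: h.
Qed.
Local Hint Resolve linmap_hcomp : lin.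

Lemma hcomp_pure n a x : hcomp n (a \ot x) = a \ot tspace_proj n x.
Proof.
rewrite hcompE; apply: (tsum_pure (f := fun a x => a \ot @tspace_proj k L n x)).
by lin.
Qed.

Lemma hcomp0_base a : hcomp 0 (hbase a) = hbase a.
Proof. by rewrite hcomp_pure tspace_proj_tw. Qed.

Lemma hcompS_base n a : hcomp n.+1 (hbase a) = 0.
Proof. by rewrite hcomp_pure tspace_proj_tw /= (bil0r _ (pure_bilinear _ _)). Qed.

Lemma hcomp0_snoc u x : hcomp 0 (snoc u x) = 0.
Proof.
elim/tensor_ind: u => [c u v hu hv|a y].
  by rewrite snoc_bil.1 (linmapP (linmap_hcomp _)) hu hv scaler0 addr0.
by rewrite snoc_pure hcomp_pure tspace_proj0S (bil0r _ (pure_bilinear _ _)).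
Qed.

Lemma hcompS_snoc n u x : hcomp n.+1 (snoc u x) = snoc (hcomp n u) x.
Proof.
elim/tensor_ind: u => [c u v hu hv|a y].
  by rewrite snoc_bil.1 !(linmapP (linmap_hcomp _)) hu hv snoc_bil.1.
by rewrite snoc_pure !hcomp_pure tspace_projS snoc_pure.
Qed.

Lemma hcomp_comp m n u : hcomp m (hcomp n u) = if m == n then hcomp n u else 0.
Proof.
elim/letter_ind: u m n => [c u v hu hv|a|u x hu] m n.
- rewrite !(linmapP (linmap_hcomp _)) hu hv.
  by case: ifP => _; rewrite ?scaler0 ?addr0.
- case: n => [|n]; rewrite ?hcomp0_base ?hcompS_base; last first.
    by rewrite (lin0 (linmapP (linmap_hcomp _))) if_same.
  by case: m => [|m]; rewrite ?hcomp0_base ?hcompS_base.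
- case: n => [|n]; rewrite ?hcomp0_snoc ?hcompS_snoc.
    by rewrite (lin0 (linmapP (linmap_hcomp _))) if_same.
  case: m => [|m]; rewrite ?hcomp0_snoc ?hcompS_snoc // hu eqSS.
  by case: ifP => _ //; rewrite (bil0l _ snoc_bil).
Qed.

(** Every later bound is allowed too, so that the bounds of two elements can be merged by taking
    their maximum. *)
Lemma hcomp_sum u : exists N, forall M, (N <= M)%N -> u = \sum_(n < M) hcomp n u.
Proof.
elim/letter_ind: u => [c u v [N hN] [N' hN']|a|u x [N hN]].
- exists (maxn N N') => M; rewrite geq_max => /andP[hM hM'].
  rewrite {1}(hN M hM) {1}(hN' M hM') scaler_sumr -big_split; apply: eq_bigr => i _.
  by rewrite (linmapP (linmap_hcomp _)).
- exists 1%N => -[//|M] _; rewrite big_ord_recl hcomp0_base big1 ?addr0 // => i _.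
  by rewrite hcompS_base.
- exists N.+1 => -[//|M] hM; rewrite big_ord_recl hcomp0_snoc add0r.
  have h := @linmap_bill _ _ _ _ _ snoc id x snoc_bil (linmap_id _).
  rewrite {1}(hN M hM) (lin_sum _ _ _ (linmapP h)); apply: eq_bigr => i _.
  by rewrite hcompS_snoc.
Qed.

Lemma hcomp0E u : hcomp 0 u = hbase (hproj u).
Proof.
apply: (letter_ext (f := hcomp 0) (g := fun u => hbase (hproj u))); try by lin.
  by move=> a; rewrite hcomp0_base hproj_base.
by move=> {}u x _; rewrite hcomp0_snoc hproj_snoc (lin0 (linmapP hbase_lin)).
Qed.

Lemma hproj_hcompS n u : hproj (hcomp n.+1 u) = 0.
Proof.
apply: (letter_ext (f := fun u => hproj (hcomp n.+1 u)) (g := fun=> 0)); try by lin.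
  by move=> a; rewrite hcompS_base (lin0 (linmapP hproj_lin)).
by move=> {}u x _; rewrite hcompS_snoc hproj_snoc.
Qed.

Lemma sw_unsnoc_hcompS (M : lmodType k) (F : H -> L -> M) n u : bilinear_map F ->
  tsum (unsnoc (hcomp n.+1 u)) F = \sw_(u', x <- unsnoc u) F (hcomp n u') x.
Proof.
move=> FL; apply: (letter_ext (f := fun u => tsum (unsnoc (hcomp n.+1 u)) F)
  (g := fun u => \sw_(u', x <- unsnoc u) F (hcomp n u') x)); try by lin.
  by move=> a; rewrite hcompS_base unsnoc_base (lin0 (linmapP unsnoc_lin)) !tsum0 //; lin.
by move=> {}u x _; rewrite hcompS_snoc !unsnoc_snoc !tsum_pure //; lin.
Qed.

Lemma unsnoc_hcomp0 u : unsnoc (hcomp 0 u) = 0.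
Proof. by rewrite hcomp0E unsnoc_base. Qed.

Lemma hcoact_hcomp n u : hcoact (hcomp n u) = \sw_(u0, u1 <- hcoact u) hcomp n u0 \ot u1.
Proof.
elim/letter_ind: u n => [c u v hu hv|a|u x hu] n.
- have fL : linmap (fun u => hcoact (hcomp n u)) by lin.
  have gL : linmap (fun u => \sw_(u0, u1 <- hcoact u) hcomp n u0 \ot u1) by lin.
  exact: (linmap_comb fL gL (hu n) (hv n)).
- rewrite sw_hcoact_base //; last by lin.
  case: n => [|n].
    by rewrite hcomp0_base hcoact_base //; apply: eq_tsum => *; rewrite hcomp0_base.
  rewrite hcompS_base (lin0 (linmapP hcoact_lin)) -[LHS](tsum_zero _ (Delta a)).
  by apply: eq_tsum => *; rewrite hcompS_base (bil0l _ (pure_bilinear _ _)).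
- rewrite sw_hcoact_snoc //; last by lin.
  case: n => [|n].
    rewrite hcomp0_snoc (lin0 (linmapP hcoact_lin)) -[LHS](tsum_zero _ (hcoact u)).
    apply: eq_tsum => u0 u1; rewrite -[LHS](tsum_zero _ (coact x)); apply: eq_tsum => *.
    by rewrite hcomp0_snoc (bil0l _ (pure_bilinear _ _)).
  rewrite hcompS_snoc hcoact_snoc // hu tsum_tsum; last by lin.
  apply: eq_tsum => u0 u1; rewrite tsum_pure; last by lin.
  by apply: eq_tsum => *; rewrite hcompS_snoc.
Qed.

Lemma hsign_hcomp n u : hsign (hcomp n u) = (-1) ^+ n *: hcomp n u.
Proof.
elim/letter_ind: u n => [c u v hu hv|a|u x hu] n.
- have fL : linmap (fun u => hsign (hcomp n u)) by lin.
  have gL : linmap (fun u => (-1) ^+ n *: hcomp n u) by lin.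
  exact: (linmap_comb fL gL (hu n) (hv n)).
- case: n => [|n]; rewrite ?hcomp0_base ?hcompS_base.
    by rewrite hsign_base expr0 scale1r.
  by rewrite (lin0 (linmapP hsign_lin)) scaler0.
- case: n => [|n]; rewrite ?hcomp0_snoc ?hcompS_snoc.
    by rewrite (lin0 (linmapP hsign_lin)) scaler0.
  by rewrite hsign_snoc hu (bilZl _ _ _ snoc_bil) exprS mulN1r scaleNr.
Qed.

Lemma hcomp_hsign n u : hcomp n (hsign u) = hsign (hcomp n u).
Proof.
elim/letter_ind: u n => [c u v hu hv|a|u x hu] n.
- have fL : linmap (fun u => hcomp n (hsign u)) by lin.
  have gL : linmap (fun u => hsign (hcomp n u)) by lin.
  exact: (linmap_comb fL gL (hu n) (hv n)).
- by case: n => [|n]; rewrite hsign_base ?hcomp0_base ?hcompS_base ?hsign_base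
    ?(lin0 (linmapP hsign_lin)).
- rewrite hsign_snoc (linN _ (linmapP (linmap_hcomp _))).
  case: n => [|n]; rewrite ?hcomp0_snoc ?hcompS_snoc ?hsign_snoc ?hu //.
  by rewrite oppr0 (lin0 (linmapP hsign_lin)).
Qed.

Lemma hcomp_hmul m n u v :
  hcomp (m + n)%N (hmul (hcomp m u) (hcomp n v)) = hmul (hcomp m u) (hcomp n v).
Proof.
have lL p q : bilinear_map (fun u v => hcomp (p + q)%N (hmul (hcomp p u) (hcomp q v)))
  by lin.
have rL p q : bilinear_map (fun u v => hmul (hcomp p u) (hcomp q v)) by lin.
elim/unsnoc_ind: u m n v => [c u u' hu hu' m n v|u hu m n v].
  exact: (linear_comb ((lL m n).1 v) ((rL m n).1 v) (hu m n v) (hu' m n v)).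
elim/unsnoc_ind: v m n => [c v v' hv hv' m n|v hv m n].
  exact: (linear_comb ((lL m n).2 u) ((rL m n).2 u) (hv m n) (hv' m n)).
apply: hproj_unsnoc_inj.
  case: m => [|m]; last by rewrite addSn hproj_hcompS hproj_hmul // hproj_hcompS mul0r.
  case: n => [|n]; last by rewrite addnS hproj_hcompS hproj_hmul // hproj_hcompS mulr0.
  by rewrite add0n [hcomp 0 (hmul _ _)]hcomp0E hproj_base.
rewrite -[LHS]tsum_pure_id -[RHS]tsum_pure_id.
have FL := pure_bilinear H L.
(* In [h1] the last letter comes from [v], in [h2] from [u]. If that factor has degree zero the sum
   is empty; otherwise its degree drops by one and the induction hypothesis applies. *)
have h1 q : (m + n)%N = q.+1 ->
    \sw_(v', y <- unsnoc (hcomp n v)) hcomp q (hmul (hcomp m u) v') \ot y =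
    \sw_(v', y <- unsnoc (hcomp n v)) hmul (hcomp m u) v' \ot y.
  case: n hv => [|n] hv; first by rewrite unsnoc_hcomp0 !tsum0 //; lin.
  rewrite addnS => -[<-]; rewrite !sw_unsnoc_hcompS; try by lin.
  by apply: hv => [||v' y ->] //; lin.
have h2 q : (m + n)%N = q.+1 ->
    \sw_(u', x <- unsnoc (hcomp m u)) \sw_(v0, v1 <- hcoact (hcomp n v))
      hcomp q (hmul u' (hsign v0)) \ot act x v1 =
    \sw_(u', x <- unsnoc (hcomp m u)) \sw_(v0, v1 <- hcoact (hcomp n v))
      hmul u' (hsign v0) \ot act x v1.
  case: m hu {h1} => [|m] hu; first by rewrite unsnoc_hcomp0 !tsum0 //; lin.
  rewrite addSn => -[<-]; rewrite !sw_unsnoc_hcompS; try by lin.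
  apply: hu => [||u' x hu]; [by lin|by lin|].
  rewrite hcoact_hcomp !tsum_tsum; try by lin.
  apply: eq_tsum => v0 v1; rewrite !tsum_pure; try by lin.
  by rewrite -hcomp_hsign hu.
rewrite [RHS]sw_unsnoc_hmul //.
case E : (m + n)%N => [|q].
  rewrite unsnoc_hcomp0 tsum0 //.
  by move/eqP: E; rewrite addn_eq0 => /andP[/eqP -> /eqP ->];
    rewrite !unsnoc_hcomp0 !tsum0 ?addr0 //; lin.
rewrite sw_unsnoc_hcompS // sw_unsnoc_hmul //; last by lin.
by rewrite h1 // h2.
Qed.

Lemma hDelta_hcomp n u : hDelta (hcomp n u) =
  \sum_(i < n.+1) \sw_(u1, u2 <- hDelta u) hcomp i u1 \ot hcomp (n - i)%N u2.
Proof.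
have FL i j : bilinear_map (fun u1 u2 => hcomp i u1 \ot hcomp j u2) by lin.
elim/letter_ind: u n => [c u v hu hv|a|u x hu] n.
- have fL : linmap (fun u => hDelta (hcomp n u)) by lin.
  have gL : linmap (fun u => \sum_(i < n.+1)
    \sw_(u1, u2 <- hDelta u) hcomp i u1 \ot hcomp (n - i)%N u2) by lin.
  exact: (linmap_comb fL gL (hu n) (hv n)).
- case: n => [|n].
    rewrite big_ord1 /= sub0n hcomp0_base hDelta_base // tsum_tsum; last by lin.
    by apply: eq_tsum => *; rewrite tsum_pure ?hcomp0_base //; lin.
  rewrite hcompS_base (lin0 (linmapP linmap_hDelta)) big1 // => i _.
  rewrite sw_hDelta_base //; try by lin.
  rewrite -[RHS](tsum_zero _ (Delta a)); apply: eq_tsum => a1 a2.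
  case: i => -[|i] /= _; rewrite ?subn0 ?hcompS_base.
    by rewrite (bil0r _ (pure_bilinear _ _)).
  by rewrite (bil0l _ (pure_bilinear _ _)).
- have z0 i : \sw_(u0, u1 <- hcoact (snoc u x)) hcomp i u0 \ot hbase u1
     = \sw_(u0, u1 <- hcoact (hcomp i (snoc u x))) u0 \ot hbase u1.
    rewrite hcoact_hcomp tsum_tsum; last by lin.
    by apply: eq_tsum => *; rewrite tsum_pure //; lin.
  case: n => [|n].
    rewrite big_ord1 /= sub0n hcomp0_snoc (lin0
      (linmapP linmap_hDelta)) sw_hDelta_snoc //; try by lin.
    rewrite -[LHS]addr0; congr (_ + _).
      rewrite -[LHS](tsum_zero _ (hDelta u)); apply: eq_tsum => *.
      by rewrite hcomp0_snoc (bil0r _ (pure_bilinear _ _)).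
    transitivity (\sw_(u0, u1 <- hcoact (snoc u x)) hcomp 0 u0 \ot hbase u1).
      by rewrite z0 hcomp0_snoc (lin0 (linmapP hcoact_lin)) tsum0 //; lin.
    by apply: eq_tsum => *; rewrite hcomp0_base.
  (* The top summand, with right leg in degree zero, is the cut after the last letter; in all others
     [x] stays in the right leg. *)
  rewrite hcompS_snoc hDelta_snoc // hu [RHS]big_ord_recr /= subnn.
  congr (_ + _).
    have h : linmap (fun z : tensor H H => \sw_(u1, u2 <- z) u1 \ot snoc u2 x) by lin.
    rewrite (lin_sum _ _ _ (linmapP h)); apply: eq_bigr => i _.
    rewrite sw_hDelta_snoc ?tsum_tsum //; try by lin.
    rewrite -[LHS]addr0 subSn -1?ltnS //; congr (_ + _).
      by apply: eq_tsum => *; rewrite hcompS_snoc tsum_pure //; lin.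
    rewrite -[LHS](tsum_zero _ (hcoact (snoc u x))); apply: eq_tsum => *.
    by rewrite hcompS_base (bil0r _ (pure_bilinear _ _)).
  rewrite sw_hDelta_snoc //; try by lin.
  rewrite -hcompS_snoc -[LHS]add0r; congr (_ + _).
    rewrite -[LHS](tsum_zero _ (hDelta u)); apply: eq_tsum => *.
    by rewrite hcomp0_snoc (bil0r _ (pure_bilinear _ _)).
  by rewrite -z0; apply: eq_tsum => *; rewrite hcomp0_base.
Qed.

(* The super flip b (x) c |-> (-1)^{|b||c|} b (x) c, computed by letting each *)
(* letter of b act on c by the parity sign.                                   *)
Definition koszul_word (a : A) (s : seq L) (c : H) : tensor H H :=
  (a \ot tw s : H) \ot iter (size s) hsign c.

Definition koszul_def (b c : H) : tensor H H :=
  \sw_(a, x <- b) \words_(s <- x) koszul_word a s c.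

Fact koszul_key : unit. Proof. exact: tt. Qed.
Definition koszul : H -> H -> tensor H H := locked_with koszul_key koszul_def.

Lemma linmap_iter_hsign n : linmap (iter n hsign).
Proof. by elim: n => [|n IHn]; [exact: linmap_id|exact: (linmap_comp hsign_lin IHn)]. Qed.
Local Hint Extern 1 (linmap (iter _ _)) => exact: linmap_iter_hsign : lin.

Let koszul_word_multilinear a c : multilinear (fun s => koszul_word a s c).
Proof.
move=> s t e v w; rewrite /koszul_word !size_cat /= tw_multilinear.
by rewrite (pure_bilinear _ _).2 (pure_bilinear _ _).1.
Qed.

Lemma koszul_tw a s c : koszul (a \ot tw s) c = (a \ot tw s : H) \ot iter (size s) hsign c.
Proof.
have fL : bilinear_map (fun a (x : T) => \words_(s <- x) koszul_word a s c).
  split=> [x|a']; last by apply: wsum_linear; exact: koszul_word_multilinear.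
  apply: (wsum_family (F := fun a s => koszul_word a s c)) => r.
  by rewrite /koszul_word; lin.
rewrite (locked_withE koszul_key koszul_def) /koszul_def tsum_pure //.
by rewrite wsum_tw //; exact: koszul_word_multilinear.
Qed.

Lemma koszul_bilinear : bilinear_map koszul.
Proof.
have -> : koszul = koszul_def by exact: locked_withE.
split=> [c|b].
  apply: tsum_linear; split=> [x|a']; last by apply: wsum_linear;
    exact: koszul_word_multilinear.
  apply: (wsum_family (F := fun a s => koszul_word a s c)) => r.
  by rewrite /koszul_word; lin.
apply: tsum_family => a x.
apply: (wsum_family (F := fun c s => koszul_word a s c)) => r.
by rewrite /koszul_word; lin.
Qed.
Local Hint Resolve koszul_bilinear : lin.

Lemma koszul_base a c : koszul (hbase a) c = hbase a \ot c.
Proof. exact: koszul_tw. Qed.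

Lemma koszul_snoc b x c :
  koszul (snoc b x) c = \sw_(b', c' <- koszul b (hsign c)) snoc b' x \ot c'.
Proof.
pose f b := koszul (snoc b x) c.
pose g b := \sw_(b', c' <- koszul b (hsign c)) snoc b' x \ot c'.
have fL : linmap f by rewrite /f; lin.
have gL : linmap g by rewrite /g; lin.
rewrite -/(f b) -/(g b); elim/tensor_ind: b => [e u v hu hv|a y].
  exact: (linmap_comb fL gL hu hv).
have fL' : linmap (fun y => f (a \ot y)) by lin.
have gL' : linmap (fun y => g (a \ot y)) by lin.
apply: (tspace_ext fL' gL') => s; rewrite /f /g snoc_pure -tw_rcons !koszul_tw.
rewrite size_rcons iterSr tsum_pure; last by lin.
by rewrite snoc_pure tw_rcons.
Qed.

(** Each of the i letters of [b] applies [hsign] once to an element of degree j, and so contributes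
    (-1)^j. *)
Lemma koszul_hcomp i j b c :
  koszul (hcomp i b) (hcomp j c) = (-1) ^+ (i * j) *: (hcomp i b \ot hcomp j c).
Proof.
elim/letter_ind: b i c => [e u v hu hv|a|b x hb] i c.
- have fL : linmap (fun u => koszul (hcomp i u) (hcomp j c)) by lin.
  have gL : linmap (fun u => (-1) ^+ (i * j) *: (hcomp i u \ot hcomp j c)) by lin.
  exact: (linmap_comb fL gL (hu i c) (hv i c)).
- case: i => [|i].
    by rewrite hcomp0_base koszul_base mul0n expr0 scale1r.
  by rewrite hcompS_base (bil0l _ koszul_bilinear) (bil0l _ (pure_bilinear _ _)) scaler0.
- case: i => [|i].
    by rewrite hcomp0_snoc (bil0l _ koszul_bilinear) (bil0l _ (pure_bilinear _ _)) scaler0.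
  rewrite hcompS_snoc koszul_snoc -hcomp_hsign hb hcomp_hsign hsign_hcomp.
  rewrite tsumZl ?tsum_pure; try by lin.
  by rewrite (bilZr _ _ _ (pure_bilinear _ _)) scalerA -exprD mulSn addnC.
Qed.

Lemma sw_koszul_hproj (M : lmodType k) (f : A -> H -> M) b c : bilinear_map f ->
  \sw_(b', c' <- koszul b c) f (hproj b') c' = f (hproj b) c.
Proof.
move=> fL; apply: (letter_ext (f := fun b => \sw_(b', c' <- koszul b c) f (hproj b') c')
  (g := fun b => f (hproj b) c)); try by lin.
  by move=> a; rewrite koszul_base tsum_pure //; lin.
move=> {}b x _; rewrite koszul_snoc hproj_snoc (bil0l _ fL) tsum_tsum; last by lin.
rewrite -[RHS](tsum_zero _ (koszul b (hsign c))); apply: eq_tsum => b' c'.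
by rewrite tsum_pure ?hproj_snoc ?(bil0l _ fL) //; lin.
Qed.

Lemma sw_koszul_unsnoc (M : lmodType k) (F : H -> L -> H -> M) b c : trilinear_map F ->
  \sw_(b', c' <- koszul b c) \sw_(b'', x <- unsnoc b') F b'' x c' =
  \sw_(b', x <- unsnoc b) \sw_(b'', c' <- koszul b' (hsign c)) F b'' x c'.
Proof.
move=> FL; apply: (letter_ext
  (f := fun b => \sw_(b', c' <- koszul b c) \sw_(b'', x <- unsnoc b') F b'' x c')
  (g := fun b => \sw_(b', x <- unsnoc b) \sw_(b'', c' <- koszul b' (hsign c)) F b'' x c'));
  try by lin.
  by move=> a; rewrite koszul_base tsum_pure ?unsnoc_base ?tsum0 //; lin.
move=> {}b x _; rewrite koszul_snoc unsnoc_snoc [RHS]tsum_pure ?tsum_tsum; try by lin.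
by apply: eq_tsum => b' c'; rewrite tsum_pure ?unsnoc_snoc ?tsum_pure //; lin.
Qed.

(** The super product on H (x) H without sums over degrees, hence open to induction on letters;
    [super_mulE] identifies it with [super_mul]. *)
Definition hsmul_def (X Y : tensor H H) : tensor H H :=
  \sw_(a, b <- X) \sw_(c, d <- Y) \sw_(b', c' <- koszul b c) hmul a c' \ot hmul b' d.
Fact hsmul_key : unit. Proof. exact: tt. Qed.
Definition hsmul : tensor H H -> tensor H H -> tensor H H := locked_with hsmul_key
  hsmul_def.

Lemma sw_hsmul (M : lmodType k) (F : H -> H -> M) X Y : bilinear_map F ->
  tsum (hsmul X Y) F = \sw_(a, b <- X) \sw_(c, d <- Y) \sw_(b', c' <- koszul b c)
    F (hmul a c') (hmul b' d).
Proof.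
move=> FL; rewrite (locked_withE hsmul_key hsmul_def) /hsmul_def tsum_tsum //.
apply: eq_tsum => a b; rewrite tsum_tsum //; apply: eq_tsum => c d.
by rewrite tsum_tsum //; apply: eq_tsum => b' c'; rewrite tsum_pure.
Qed.

(** Compare the right legs on both sides. Their last letters come from [v] or from [u], and in both
    cases removing the letter commutes with Delta by [sw_hDelta_unsnoc], leaving shorter
    products. *)
Lemma hDelta_hmul u v : hDelta (hmul u v) = hsmul (hDelta u) (hDelta v).
Proof.
have E X : X = hsmul (hDelta u) (hDelta v) <-> X = \sw_(u1, u2 <- hDelta u)
   \sw_(v1, v2 <- hDelta v) \sw_(u', v' <- koszul u2 v1) hmul u1 v' \ot hmul u' v2.
  by rewrite -[hsmul _ _]tsum_pure_id sw_hsmul //; lin.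
apply/E => {E}.
have lL : bilinear_map (fun u v => hDelta (hmul u v)) by lin.
have rL : bilinear_map (fun u v => \sw_(u1, u2 <- hDelta u)
   \sw_(v1, v2 <- hDelta v) \sw_(u', v' <- koszul u2 v1) hmul u1 v' \ot hmul u' v2) by lin.
elim/unsnoc_ind: u v => [c u u' hu hu' v|u hu v].
  exact: (linear_comb (lL.1 v) (rL.1 v) (hu v) (hu' v)).
elim/unsnoc_ind: v => [c v v' hv hv'|v hv].
  exact: (linear_comb (lL.2 u) (rL.2 u) hv hv').
(* Projecting the right leg to A turns Delta into the coaction, so the first goal is
   [hcoact_hmul]. *)
apply: tensor_hextr.
  rewrite (sw_hDelta_hproj (f := fun u a => u \ot a)); last by lin.
  rewrite tsum_pure_id hcoact_hmul //.
  rewrite -(sw_hDelta_hproj (f := fun u0 u1 => \sw_(v0, v1 <- hcoact v) hmul u0 v0 \ot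
    (u1 * v1))); last by lin.
  rewrite tsum_tsum; last by lin.
  apply: eq_tsum => u1 u2; rewrite tsum_tsum; last by lin.
  rewrite -(sw_hDelta_hproj (f := fun v0 v1 => hmul u1 v0 \ot (hproj u2 * v1)));
    last by lin.
  apply: eq_tsum => v1 v2; rewrite tsum_tsum; last by lin.
  rewrite -(sw_koszul_hproj (f := fun a c => hmul u1 c \ot (a * hproj v2))); last by lin.
  by apply: eq_tsum => u' v'; rewrite tsum_pure ?hproj_hmul //; lin.
rewrite (sw_hDelta_unsnoc (F := fun u v x => u \ot (v \ot x))); last by lin.
rewrite sw_unsnoc_hmul //; last by lin.
transitivity (\sw_(u1, u2 <- hDelta u) \sw_(v1, v2 <- hDelta v) \sw_(u', v' <- koszul u2 v1)
   ((\sw_(v2', y <- unsnoc v2) hmul u1 v' \ot (hmul u' v2' \ot y))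
   + \sw_(u'', x <- unsnoc u') \sw_(v20, v21 <- hcoact v2)
        hmul u1 v' \ot (hmul u'' (hsign v20) \ot act x v21))); last first.
  rewrite tsum_tsum; last by lin.
  apply: eq_tsum => u1 u2; rewrite tsum_tsum; last by lin.
  apply: eq_tsum => v1 v2; rewrite tsum_tsum; last by lin.
  apply: eq_tsum => u' v'; rewrite tsum_pure; last by lin.
  by rewrite sw_unsnoc_hmul //; lin.
under [RHS]eq_tsum => u1 u2 do (under eq_tsum => v1 v2 do rewrite tsum_add;
  rewrite tsum_add).
rewrite tsum_add; congr (_ + _).
  transitivity (\sw_(u1, u2 <- hDelta u) \sw_(v', y <- unsnoc v) \sw_(v1, v2 <- hDelta v')
     \sw_(u', v'' <- koszul u2 v1) hmul u1 v'' \ot (hmul u' v2 \ot y)).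
    rewrite [RHS]tsumC; apply: hv => [||v' y hv]; [by lin|by lin|].
    rewrite hv tsum_tsum; last by lin.
    apply: eq_tsum => u1 u2; rewrite tsum_tsum; last by lin.
    apply: eq_tsum => v1 v2; rewrite tsum_tsum; last by lin.
    by apply: eq_tsum => *; rewrite tsum_pure //; lin.
  apply: eq_tsum => u1 u2.
  rewrite -(sw_hDelta_unsnoc (F := fun v1 v2 y => \sw_(u', v'' <- koszul u2 v1)
    hmul u1 v'' \ot (hmul u' v2 \ot y))); last by lin.
  by apply: eq_tsum => v1 v2; exact: tsumC.
(* The letter [x] comes from [u]. The super flip past it puts a sign on [v1], the product rule one
   on [v2]; together they are the coproduct of [hsign v]. *)
transitivity (\sw_(u', x <- unsnoc u) \sw_(u1, u2 <- hDelta u') \sw_(v1, v2 <- hDelta v)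
   \sw_(u'', v' <- koszul u2 (hsign v1)) \sw_(v20, v21 <- hcoact v2)
        hmul u1 v' \ot (hmul u'' (hsign v20) \ot act x v21)); last first.
  rewrite -(sw_hDelta_unsnoc (F := fun u1 u2 x => \sw_(v1, v2 <- hDelta v)
   \sw_(u'', v' <- koszul u2 (hsign v1)) \sw_(v20, v21 <- hcoact v2)
        hmul u1 v' \ot (hmul u'' (hsign v20) \ot act x v21))); last by lin.
  apply: eq_tsum => u1 u2; rewrite tsumC; apply: eq_tsum => v1 v2.
  by rewrite -(sw_koszul_unsnoc (F := fun u'' x v' => \sw_(v20, v21 <- hcoact v2)
        hmul u1 v' \ot (hmul u'' (hsign v20) \ot act x v21))) //; lin.
apply: hu => [||u' x hu]; [by lin|by lin|].
transitivity (\sw_(u1, u2 <- hDelta u') \sw_(v0, v1 <- hcoact v) \sw_(w1, w2 <- hDelta v0)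
   \sw_(u'', v' <- koszul u2 (hsign w1)) hmul u1 v' \ot (hmul u'' (hsign w2) \ot act x v1)).
  rewrite [RHS]tsumC; apply: eq_tsum => v0 v1; rewrite hu tsum_tsum; last by lin.
  apply: eq_tsum => u1 u2; rewrite tsum_tsum ?hDelta_hsign ?tsum_tsum //; try by lin.
  apply: eq_tsum => w1 w2; rewrite tsum_pure ?tsum_tsum; try by lin.
  by apply: eq_tsum => *; rewrite tsum_pure //; lin.
apply: eq_tsum => u1 u2.
rewrite (sw_hDelta_hcoact (F := fun w1 w2 v1 => \sw_(u'', v' <- koszul u2 (hsign w1))
   hmul u1 v' \ot (hmul u'' (hsign w2) \ot act x v1))); last by lin.
by apply: eq_tsum => v1 v2; exact: tsumC.
Qed.

(** * The differential *)

Variable omega : aug A -> L.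
Hypothesis omegaX : @crossed_morphism k A (aug_crossed A) L omega.

(** The Maurer-Cartan map of the calculus, omega after pi: it is defined on all of A, and d a =
    a_(1) (x) [germ] a_(2). *)
Definition germ (a : A) : L := omega (aug_proj a).

Lemma linmap_germ : linmap germ.
Proof.
by split=> c a b; rewrite /germ aug_proj_linear (crossed_morphism_linear omegaX).
Qed.
Local Hint Resolve linmap_germ : lin.

Lemma germ1 : germ 1 = 0.
Proof.
have -> : germ 1 = omega 0.
  by congr omega; apply: val_inj; rewrite /= eps1 scale1r subrr.
exact: (lin0 (crossed_morphism_linear omegaX)).
Qed.

(** The cocycle identity: pi(a b) = pi(a) b + eps(a) pi(b), and omega is a module map. *)
Lemma germM a b : germ (a * b) = act (germ a) b + eps a *: germ b.
Proof.
rewrite /germ -(crossed_morphism_act omegaX).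
rewrite -(linZ _ _ (crossed_morphism_linear omegaX)).
rewrite -(linD _ _ (crossed_morphism_linear omegaX)).
congr omega; apply: val_inj; rewrite /= epsM mulrBl -scalerAl mul1r scalerBr scalerA.
by rewrite addrA subrK.
Qed.

(** The right-hand side is linear in [a] and vanishes at 1, as [germ 1] is 0. So it only sees pi(a),
    where it is the comodule property of omega. *)
Lemma coact_germ a : coact (germ a) =
  \sw_(a1, a' <- Delta a) \sw_(a2, a3 <- Delta a') germ a2 \ot (antipode a1 * a3).
Proof.
pose G a := \sw_(a1, a' <- Delta a) \sw_(a2, a3 <- Delta a') germ a2 \ot (antipode a1 * a3).
have GL : linmap G by rewrite /G; lin.
have omL : linmap (omega : aug A -> L) := LinMap (crossed_morphism_linear omegaX).
have -> : coact (germ a) = G (aug_val (aug_proj a)).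
  rewrite /germ (crossed_morphism_coact omegaX) /= /aug_coact tsum_tsum; last by lin.
  apply: eq_tsum => a1 a'; rewrite tsum_tsum; last by lin.
  by apply: eq_tsum => a2 a3; rewrite tsum_pure //; lin.
rewrite /= (linD _ _ (linmapP GL)) (linN _ (linmapP GL)) (linZ _ _ (linmapP GL)).
rewrite [G 1]/G Delta1 tsum_pure; last by lin.
rewrite Delta1 tsum_pure; last by lin.
by rewrite germ1 (bil0l _ (pure_bilinear _ _)) scaler0 subr0.
Qed.

(** As in [sw_coact_act], the extra leg on the left cancels the antipode. In this form the comodule
    property of omega makes d colinear. *)
Lemma sw_coact_germ (M : lmodType k) (F : L -> A -> M) a : bilinear_map F ->
  \sw_(a1, a2 <- Delta a) \sw_(y0, y1 <- coact (germ a2)) F y0 (a1 * y1) =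
  \sw_(a1, a2 <- Delta a) F (germ a1) a2.
Proof.
move=> FL.
transitivity (\sw_(a1, a2 <- Delta a) \sw_(b1, b' <- Delta a2)
   \sw_(b2, b3 <- Delta b') F (germ b2) (a1 * antipode b1 * b3)).
  apply: eq_tsum => a1 a2; rewrite coact_germ tsum_tsum; last by lin.
  apply: eq_tsum => b1 b'; rewrite tsum_tsum; last by lin.
  apply: eq_tsum => b2 b3; rewrite tsum_pure; last by lin.
  by rewrite mulrA.
rewrite -(@sw_DeltaA _ _ _ (fun a1 b1 b' => \sw_(b2, b3 <- Delta b')
     F (germ b2) (a1 * antipode b1 * b3)) a); last by lin.
rewrite -[RHS](@sw_epsl _ _ _ (fun a => \sw_(a1, a2 <- Delta a) F (germ a1) a2));
  last by lin.
apply: eq_tsum => a1 a2.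
rewrite (@sw_antipoder _ _ _ (fun z => \sw_(b2, b3 <- Delta a2) F (germ b2) (z * b3)));
  last by lin.
by congr (_ *: _); apply: eq_tsum => b2 b3; rewrite mul1r.
Qed.

Fact hd_key : unit. Proof. exact: tt. Qed.
Definition hd : H -> H := locked_with hd_key (@sh_d k A L omega).

Lemma hdE : hd = @sh_d k A L omega.
Proof. exact: locked_withE. Qed.

Let sh_mul_bil : bilinear_map (@sh_mul k A L) := sh_mul_bilinear LX.
Let sh_delta_lin : linmap (sh_delta omega) := LinMap (sh_delta_linear LX omegaX).
Local Hint Resolve sh_mul_bil sh_delta_lin tsign_lin wcoact_lin : lin.

Lemma hd_pure a x : hd (a \ot x) =
  (\sw_(a1, a2 <- Delta a) a1 \ot sh_mul (tw [:: germ a2]) x) + a \ot sh_delta omega x.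
Proof. by rewrite hdE sh_d_pure. Qed.

Lemma linmap_hd : linmap hd.
Proof.
have h : linmap (fun u : H => \sw_(a, x <- u)
    ((\sw_(a1, a2 <- Delta a) a1 \ot sh_mul (tw [:: germ a2]) x)
     + a \ot sh_delta omega x)) by lin.
by rewrite hdE; exact: h.
Qed.
Local Hint Resolve linmap_hd : lin.

Lemma hd_base a : hd (hbase a) = \sw_(a1, a2 <- Delta a) snoc (hbase a1) (germ a2).
Proof.
rewrite hd_pure sh_delta_nil // (bil0r _ (pure_bilinear _ _)) addr0.
apply: eq_tsum => a1 a2; rewrite snoc_pure.
by rewrite (sh_mul_rcons1 LX [::]) sh_mul1x.
Qed.

Lemma sh_delta_snoc x v : sh_delta omega (tcat x (tw [:: v])) =
  tcat (sh_delta omega x) (tw [:: v])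
  + \sw_(y, b <- @coact k A (tspace_crossed L) (tsign (tcat x (tw [:: v]))))
      tcat y (tw [:: germ b]).
Proof.
apply: (tspace_ext (f := fun x => sh_delta omega (tcat x (tw [:: v])))
  (g := fun x => tcat (sh_delta omega x) (tw [:: v])
  + \sw_(y, b <- @coact k A (tspace_crossed L) (tsign (tcat x (tw [:: v]))))
      tcat y (tw [:: germ b]))); try by lin.
move=> s; rewrite -tw_rcons sh_delta_rcons // tsign_tw size_rcons.
by rewrite (linZ _ _ (sh_coact_linear LX)) tsumZl ?sh_coact_tw //; lin.
Qed.

(** Both summands of [sh_d] append a letter: the shuffle product with [germ] a_(2) appends [germ]
    a_(2) acted on by the A-leg of the word, and delta appends [germ] of that A-leg. The cocycle
    identity merges the two. *)
Lemma hd_snoc u x : hd (snoc u x) =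
  snoc (hd u) x + \sw_(u0, u1 <- hcoact (hsign (snoc u x))) snoc u0 (germ u1).
Proof.
pose g u := snoc (hd u) x + \sw_(u0, u1 <- hcoact (hsign (snoc u x))) snoc u0 (germ u1).
have fL : linmap (fun u => hd (snoc u x)) by lin.
have gL : linmap g by rewrite /g; lin.
rewrite -/(g u); elim/tensor_ind: u => [c u v hu hv|a X].
  exact: (linmap_comb fL gL hu hv).
rewrite /g snoc_pure !hd_pure hsign_pure hcoact_pure // sh_delta_snoc.
rewrite tsum_tsum; last by lin.
have mulE a2 : sh_mul (tw [:: germ a2]) (tcat X (tw [:: x])) =
    tcat (sh_mul (tw [:: germ a2]) X) (tw [:: x]) +
    \sw_(y0, y1 <- @coact k A (tspace_crossed L) (tsign (tcat X (tw [:: x]))))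
      tcat y0 (tw [:: act (germ a2) y1]).
  rewrite -(tcat1x (tw [:: germ a2])) sh_mul_snoc // tunsnoc_tcat tsum_pure; last by lin.
  by congr (_ + _); apply: eq_tsum => *; rewrite sh_mul1x.
under eq_tsum => a1 a2 do rewrite mulE (bilDr _ _ _ (pure_bilinear A T)).
rewrite tsum_add (bilDr _ _ _ (pure_bilinear A T)) addrACA; congr (_ + _).
  rewrite (bilDl _ _ _ snoc_bil) snoc_pure; congr (_ + _).
  rewrite (@linear_of_tsum _ _ _ _ _ _ _ (fun u => snoc u x)); last by lin.
  by apply: eq_tsum => *; rewrite snoc_pure.
(* The term from delta is spread over Delta a by the counit, which produces the factor eps a_(2)
   needed by [germM]. *)
rewrite -[in X in _ + X](@sw_epsr _ A _ (fun a => a \ot \sw_(y, b <- _) tcat y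
  (tw [:: germ b])) a); last by lin.
rewrite -tsum_add; apply: eq_tsum => a1 a2.
rewrite (@linear_of_tsum _ _ _ _ _ _ _ (fun u => a1 \ot u)); last by lin.
rewrite (@linear_of_tsum _ _ _ _ _ _ _ (fun u => a1 \ot u)); last by lin.
rewrite -tsum_scale -tsum_add tsum_tsum; last by lin.
apply: eq_tsum => y0 y1; rewrite tsum_pure; last by lin.
rewrite germM snoc_pure (linD _ _ (@tw1_linear _ L)) (bilDr _ _ _ (tcat_bilinear L)).
rewrite (bilDr _ _ _ (pure_bilinear A T)); congr (_ + _).
by rewrite (linZ _ _ (@tw1_linear _ L)) (bilZr _ _ _
  (tcat_bilinear L)) (bilZr _ _ _ (pure_bilinear A T)).
Qed.

Lemma hproj_hd u : hproj (hd u) = 0.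
Proof.
apply: (letter_ext (f := fun u => hproj (hd u)) (g := fun=> 0)); try by lin.
  move=> a; rewrite hd_base // (hproj_sum (Delta a)) -[RHS](tsum_zero _ (Delta a)).
  by apply: eq_tsum => *; rewrite hproj_snoc.
move=> {}u x _; rewrite hd_snoc // (linD _ _ (linmapP hproj_lin)) hproj_snoc add0r.
rewrite (hproj_sum (hcoact _)) -[RHS](tsum_zero _ (hcoact (hsign (snoc u x)))).
by apply: eq_tsum => *; rewrite hproj_snoc.
Qed.

Lemma sw_unsnoc_hd (M : lmodType k) (F : H -> L -> M) u : bilinear_map F ->
  tsum (unsnoc (hd u)) F =
  \sw_(u', x <- unsnoc u) F (hd u') x + \sw_(u0, u1 <- hcoact u) F (hsign u0) (germ u1).
Proof.
move=> FL; apply: (letter_ext (f := fun u => tsum (unsnoc (hd u)) F)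
  (g := fun u => \sw_(u', x <- unsnoc u) F (hd u') x
    + \sw_(u0, u1 <- hcoact u) F (hsign u0) (germ u1))); try by lin.
  move=> a; rewrite hd_base // unsnoc_base tsum0 ?add0r; last by lin.
  rewrite (unsnoc_sum (Delta a)) tsum_tsum // sw_hcoact_base //; last by lin.
  by apply: eq_tsum => *; rewrite unsnoc_snoc tsum_pure // hsign_base.
move=> {}u x _; rewrite hd_snoc // (linD _ _ (linmapP unsnoc_lin)) tsumDl //.
rewrite !unsnoc_snoc !tsum_pure //; last by lin.
rewrite (unsnoc_sum (hcoact _)) tsum_tsum //; congr (_ + _).
rewrite sw_hcoact_hsign //; last by lin.
by apply: eq_tsum => *; rewrite unsnoc_snoc tsum_pure.
Qed.

Lemma hd_hsign u : hd (hsign u) = - hsign (hd u).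
Proof.
elim/unsnoc_ind: u => [c u v hu hv|u hu].
  have fL : linmap (fun u => hd (hsign u)) by lin.
  have gL : linmap (fun u => - hsign (hd u)) by lin.
  exact: (linmap_comb fL gL hu hv).
apply: hproj_unsnoc_inj.
  by rewrite (linN _ (linmapP hproj_lin)) hproj_hsign !hproj_hd oppr0.
rewrite (linN _ (linmapP unsnoc_lin)) -[LHS]tsum_pure_id -[unsnoc (hsign (hd
  u))]tsum_pure_id.
rewrite sw_unsnoc_hsign ?sw_unsnoc_hd; try by lin.
rewrite sw_unsnoc_hsign ?sw_hcoact_hsign //; try by lin.
rewrite opprK; congr (_ + _).
rewrite -tsum_opp; apply: hu => [||u' x ->]; [by lin|by lin|].
by rewrite (bilNl _ _ (pure_bilinear _ _)) opprK.
Qed.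

(** Appended letters are the new point: coassociativity brings the A-leg of the preceding letters
    next to the coaction of [germ], where [sw_coact_germ] applies. *)
Lemma hcoact_hd u : hcoact (hd u) = \sw_(u0, u1 <- hcoact u) hd u0 \ot u1.
Proof.
elim/unsnoc_ind: u => [c u v hu hv|u hu].
  have fL : linmap (fun u => hcoact (hd u)) by lin.
  have gL : linmap (fun u => \sw_(u0, u1 <- hcoact u) hd u0 \ot u1) by lin.
  exact: (linmap_comb fL gL hu hv).
apply: tensor_hext.
  rewrite (sw_hcoact_hproj (f := fun a b => a \ot b)); last by lin.
  rewrite hproj_hd (lin0 (linmapP (linmap_Delta A))) tsum0 ?tsum_tsum; try by lin.
  rewrite -[LHS](tsum_zero _ (hcoact u)); apply: eq_tsum => *.
  by rewrite tsum_pure ?hproj_hd ?(bil0l _ (pure_bilinear _ _)) //; lin.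
rewrite (sw_hcoact_unsnoc (F := fun u x a => u \ot (x \ot a))); last by lin.
rewrite sw_unsnoc_hd ?tsum_tsum; try by lin.
transitivity (\sw_(u0, u1 <- hcoact u) (\sw_(u', x <- unsnoc u0) hd u' \ot (x \ot u1)
   + \sw_(u00, u01 <- hcoact u0) hsign u00 \ot (germ u01 \ot u1))); last first.
  apply: eq_tsum => u0 u1; rewrite tsum_pure; last by lin.
  by rewrite sw_unsnoc_hd //; lin.
rewrite tsum_add; congr (_ + _).
  rewrite (sw_hcoact_unsnoc (F := fun u' x u1 => hd u' \ot (x \ot u1))); last by lin.
  apply: hu => [||u' x hu]; [by lin|by lin|].
  rewrite hu tsum_tsum; last by lin.
  by apply: eq_tsum => *; rewrite tsum_pure //; lin.
rewrite (sw_hcoactA (F := fun a b c => hsign a \ot (germ b \ot c))); last by lin.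
transitivity (\sw_(u0, u1 <- hcoact u) \sw_(v0, v1 <- hcoact u0) \sw_(y0, y1 <- coact
  (germ u1))
   hsign v0 \ot (y0 \ot (v1 * y1))).
  by apply: eq_tsum => *; rewrite sw_hcoact_hsign //; lin.
rewrite (sw_hcoactA (F := fun a b c => \sw_(y0, y1 <- coact (germ c)) hsign a \ot (y0
  \ot (b * y1)))); last by lin.
apply: eq_tsum => u0 u1.
by rewrite (sw_coact_germ (F := fun y b => hsign u0 \ot (y \ot b))) //; lin.
Qed.

(** Both sides have six kinds of last letter terms. A letter appended by d is [germ] of a product of
    A-legs and splits by [germM]; the remaining terms match by induction, since d is colinear and
    anticommutes with [hsign]. *)
Lemma hd_hmul u v : hd (hmul u v) = hmul (hd u) v + hmul (hsign u) (hd v).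
Proof.
have lL : bilinear_map (fun u v => hd (hmul u v)) by lin.
have rL : bilinear_map (fun u v => hmul (hd u) v + hmul (hsign u) (hd v)) by lin.
elim/unsnoc_ind: u v => [c u u' hu hu' v|u hu v].
  exact: (linear_comb (lL.1 v) (rL.1 v) (hu v) (hu' v)).
elim/unsnoc_ind: v => [c v v' hv hv'|v hv].
  exact: (linear_comb (lL.2 u) (rL.2 u) hv hv').
apply: hproj_unsnoc_inj.
  rewrite hproj_hd (linD _ _ (linmapP hproj_lin)) !hproj_hmul // !hproj_hd.
  by rewrite mul0r mulr0 addr0.
rewrite (linD _ _ (linmapP unsnoc_lin)) -[LHS]tsum_pure_id.
rewrite -[X in _ = X + _]tsum_pure_id -[X in _ = _ + X]tsum_pure_id.
have PL := pure_bilinear H L.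
rewrite sw_unsnoc_hd // !sw_unsnoc_hmul //; try by lin.
rewrite !sw_unsnoc_hd; try by lin.
rewrite sw_unsnoc_hsign; last by lin.
(* In the second term of [germM] the factor eps u1 collapses the coaction of [u] back to [u]. *)
have -> : \sw_(u0, u1 <- hcoact (hmul u v)) hsign u0 \ot germ u1 =
   \sw_(u0, u1 <- hcoact u) \sw_(v0, v1 <- hcoact v) hmul (hsign u0) (hsign v0) \ot act
     (germ u1) v1
   + \sw_(v0, v1 <- hcoact v) hmul (hsign u) (hsign v0) \ot germ v1.
  have h : linmap (fun u => \sw_(v0, v1 <- hcoact v) hmul (hsign u) (hsign v0) \ot germ
    v1) by lin.
  rewrite -[in X in _ = _ + X](sw_hcoact_eps u) (linear_of_tsum _ _ (linmapP h)).
  rewrite -tsum_add hcoact_hmul // tsum_tsum; last by lin.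
  apply: eq_tsum => u0 u1; rewrite (linZ _ _ (linmapP h)) -tsum_scale -tsum_add
    tsum_tsum; last by lin.
  apply: eq_tsum => v0 v1; rewrite tsum_pure; last by lin.
  by rewrite germM // hsign_hmul // (bilDr _ _ _ PL) (bilZr _ _ _ PL).
have -> : \sw_(v', y <- unsnoc v) hd (hmul u v') \ot y =
   \sw_(v', y <- unsnoc v) hmul (hd u) v' \ot y + \sw_(v', y <- unsnoc v) hmul (hsign u)
     (hd v') \ot y.
  rewrite -tsum_add; apply: hv => [||v' y ->]; [by lin|by lin|].
  by rewrite (bilDl _ _ _ PL).
(* The minus sign arises from moving d past [hsign] on [v0]. *)
have -> : \sw_(u', x <- unsnoc u) \sw_(v0, v1 <- hcoact v) hd (hmul u' (hsign v0)) \ot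
  act x v1 =
   \sw_(u', x <- unsnoc u) \sw_(v0, v1 <- hcoact v) hmul (hd u') (hsign v0) \ot act x v1
   - \sw_(u', x <- unsnoc u) \sw_(v0, v1 <- hcoact (hd v)) hmul (hsign u') (hsign v0)
       \ot act x v1.
  rewrite -tsum_opp -tsum_add; apply: hu => [||u' x hu]; [by lin|by lin|].
  rewrite hcoact_hd tsum_tsum -?tsum_opp; last by lin.
  rewrite -tsum_add; apply: eq_tsum => v0 v1; rewrite tsum_pure; last by lin.
  rewrite hu hd_hsign (bilNr _ _ hmul_bil) (bilDl _ _ _ PL).
  by rewrite (bilNl _ _ PL).
by rewrite (AC (2*2*2) ((1*(3*5))*((2*6)*4))).
Qed.

(** A letter kept from [u] is settled by induction. An appended letter arises from the inner d
    followed by d on the rest, or from the outer d after the inner one; the two differ by a sign by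
    [hd_hsign]. *)
Lemma hd_hd u : hd (hd u) = 0.
Proof.
elim/unsnoc_ind: u => [c u v hu hv|u hu].
  have fL : linmap (fun u => hd (hd u)) by lin.
  exact: (linmap_comb fL (@linmap_zero k _ _) hu hv).
apply: hproj_unsnoc_inj; first by rewrite hproj_hd (lin0 (linmapP hproj_lin)).
rewrite (lin0 (linmapP unsnoc_lin)) -[LHS]tsum_pure_id !sw_unsnoc_hd; try by lin.
rewrite hcoact_hd tsum_tsum; last by lin.
rewrite -addrA -tsum_add -[RHS]addr0; congr (_ + _).
  rewrite -[RHS](tsum_zero _ (unsnoc u)); apply: hu => [||u' x ->]; [by lin|by lin|].
  exact: (bil0l _ (pure_bilinear _ _)).
rewrite -[RHS](tsum_zero _ (hcoact u)); apply: eq_tsum => u0 u1.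
rewrite tsum_pure; last by lin.
by rewrite hd_hsign (bilNl _ _ (pure_bilinear _ _)) addNr.
Qed.

(** With the right leg in A this is colinearity of d. On last letters, d acts before the letter, by
    induction, or appends one, and then [sw_hDelta_hcoact] moves the coaction to the right leg. *)
Lemma hDelta_hd u : hDelta (hd u) =
  \sw_(u1, u2 <- hDelta u) (hd u1 \ot u2 + hsign u1 \ot hd u2).
Proof.
elim/unsnoc_ind: u => [c u v hu hv|u hu].
  have fL : linmap (fun u => hDelta (hd u)) by lin.
  have gL : linmap (fun u => \sw_(u1, u2 <- hDelta u) (hd u1 \ot u2 + hsign u1 \ot hd
    u2)) by lin.
  exact: (linmap_comb fL gL hu hv).
apply: tensor_hextr.
  rewrite (sw_hDelta_hproj (f := fun a b => a \ot b)); last by lin.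
  rewrite tsum_pure_id hcoact_hd -(sw_hDelta_hproj (f := fun a b => hd a \ot b));
    last by lin.
  rewrite tsum_tsum; last by lin.
  apply: eq_tsum => u1 u2; rewrite tsumDl ?tsum_pure; try by lin.
  by rewrite hproj_hd (bil0r _ (pure_bilinear _ _)) addr0.
rewrite (sw_hDelta_unsnoc (F := fun u v x => u \ot (v \ot x))); last by lin.
rewrite sw_unsnoc_hd; last by lin.
transitivity (\sw_(u1, u2 <- hDelta u) (\sw_(u', x <- unsnoc u2) (hd u1 \ot (u' \ot x) +
     hsign u1 \ot (hd u' \ot x))
   + \sw_(u20, u21 <- hcoact u2) hsign u1 \ot (hsign u20 \ot germ u21))); last first.
  rewrite tsum_tsum; last by lin.
  apply: eq_tsum => u1 u2; rewrite tsumDl ?tsum_pure; try by lin.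
  by rewrite sw_unsnoc_hd ?tsum_add ?addrA //; lin.
rewrite tsum_add; congr (_ + _).
  rewrite (sw_hDelta_unsnoc (F := fun u1 u' x => hd u1 \ot (u' \ot x) +
     hsign u1 \ot (hd u' \ot x))); last by lin.
  apply: hu => [||u' x ->]; [by lin|by lin|].
  rewrite tsum_tsum; last by lin.
  by apply: eq_tsum => u1 u2; rewrite tsumDl ?tsum_pure //; lin.
rewrite -(sw_hDelta_hcoact (F := fun u1 u20 u21 => hsign u1 \ot (hsign u20 \ot germ
  u21))); last by lin.
apply: eq_tsum => u0 u1; rewrite hDelta_hsign // tsum_tsum; last by lin.
by apply: eq_tsum => *; rewrite tsum_pure //; lin.
Qed.

Lemma hcomp_hd n u : hcomp n.+1 (hd u) = hd (hcomp n u).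
Proof.
elim/unsnoc_ind: u n => [c u v hu hv n|u hu n].
  have fL : linmap (fun u => hcomp n.+1 (hd u)) by lin.
  have gL : linmap (fun u => hd (hcomp n u)) by lin.
  exact: (linmap_comb fL gL (hu n) (hv n)).
apply: hproj_unsnoc_inj; first by rewrite hproj_hcompS hproj_hd.
rewrite -[LHS]tsum_pure_id -[RHS]tsum_pure_id sw_unsnoc_hcompS ?sw_unsnoc_hd; try by lin.
congr (_ + _); last first.
  rewrite hcoact_hcomp // tsum_tsum; last by lin.
  by apply: eq_tsum => u0 u1; rewrite tsum_pure ?hcomp_hsign //; lin.
case: n => [|n].
  rewrite unsnoc_hcomp0 [RHS]tsum0; last by lin.
  rewrite -[RHS](tsum_zero _ (unsnoc u)); apply: eq_tsum => *.
  by rewrite hcomp0E hproj_hd (lin0 (linmapP hbase_lin)) (bil0l _ (pure_bilinear _ _)).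
rewrite sw_unsnoc_hcompS; last by lin.
by apply: hu => [||u' x ->]; [by lin|by lin|].
Qed.

Lemma germ_aug (a : aug A) : germ (aug_val a) = omega a.
Proof.
rewrite /germ; congr omega; apply: val_inj => /=; case: a => a /= /eqP ->.
by rewrite scale0r subr0.
Qed.

(** * Inner differentials *)

Section Inner.
Variable theta : L.
Local Notation Theta := (snoc (hbase 1) theta).

Lemma hcoact_letter v : hcoact (snoc (hbase 1) v) =
  \sw_(v0, v1 <- coact v) snoc (hbase 1) v0 \ot v1.
Proof.
rewrite hcoact_snoc // hcoact1 // tsum_pure; last by lin.
by apply: eq_tsum => *; rewrite mul1r.
Qed.

Lemma sw_unsnoc_theta_hmul (M : lmodType k) (F : H -> L -> M) u : bilinear_map F ->
  tsum (unsnoc (hmul Theta u)) F = \sw_(u', x <- unsnoc u) F (hmul Theta u') x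
   + \sw_(u0, u1 <- hcoact u) F (hsign u0) (act theta u1).
Proof.
move=> FL; rewrite sw_unsnoc_hmul // unsnoc_snoc tsum_pure; last by lin.
by congr (_ + _); apply: eq_tsum => *; rewrite hmul1x.
Qed.

Lemma sw_unsnoc_hmul_theta (M : lmodType k) (F : H -> L -> M) u : bilinear_map F ->
  tsum (unsnoc (hmul u Theta)) F = F u theta
   - \sw_(u', x <- unsnoc u) \sw_(t0, t1 <- coact theta)
       F (hmul u' (snoc (hbase 1) t0)) (act x t1).
Proof.
move=> FL; rewrite sw_unsnoc_hmul // unsnoc_snoc tsum_pure; last by lin.
rewrite hmulx1 // -tsum_opp; congr (_ + _); apply: eq_tsum => u' x.
rewrite hcoact_letter tsum_tsum -?tsum_opp; last by lin.
apply: eq_tsum => t0 t1; rewrite tsum_pure; last by lin.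
by rewrite hsign_snoc hsign_base (bilNr _ _ hmul_bil) (bilNl _ _ FL).
Qed.

(** The letter appended by d is theta acted on by the A-leg minus eps times theta: the first part is
    the last letter theta of theta u carried past [u], the second the final theta of u theta. The
    other last letters agree by induction. *)
Lemma inner_hd : inner_fo_calculus omega theta ->
  (forall v : L, braid (v \ot theta) = theta \ot v) ->
  forall u, hd u = hmul Theta u - hmul (hsign u) Theta.
Proof.
move=> om_inner braid_theta.
have germE a : germ a = act theta a - eps a *: theta.
  rewrite /germ om_inner /= (bilDr _ _ _ act_bil) (bilNr _ _ act_bil).
  by rewrite (bilZr _ _ _ act_bil) (act1 LX).
elim/unsnoc_ind => [c u v hu hv|u hu].
  have fL : linmap hd by lin.
  have gL : linmap (fun u => hmul Theta u - hmul (hsign u) Theta) by lin.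
  exact: (linmap_comb fL gL hu hv).
apply: hproj_unsnoc_inj.
  rewrite hproj_hd // (linD _ _ (linmapP hproj_lin)) (linN _ (linmapP hproj_lin)).
  by rewrite !hproj_hmul // hproj_snoc mul0r mulr0 subrr.
rewrite (linD _ _ (linmapP unsnoc_lin)) (linN _ (linmapP unsnoc_lin)).
rewrite -[LHS]tsum_pure_id -[X in _ = X - _]tsum_pure_id -[X in _ = _ - X]tsum_pure_id.
rewrite sw_unsnoc_hd ?sw_unsnoc_theta_hmul ?sw_unsnoc_hmul_theta //; try by lin.
rewrite sw_unsnoc_hsign; last by lin.
(* The summand is a bilinear image of Psi(x (x) theta), so the hypothesis on the braiding puts [x]
   back unchanged as the last letter. *)
have -> : \sw_(u', x <- unsnoc u) \sw_(t0, t1 <- coact theta)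
     hmul (hsign u') (snoc (hbase 1) t0) \ot act x t1 =
   \sw_(u', x <- unsnoc u) hmul (hsign u') Theta \ot x.
  apply: eq_tsum => u' x.
  have FL : bilinear_map (fun t y : L => hmul (hsign u') (snoc (hbase 1) t) \ot y) by lin.
  rewrite -[RHS](tsum_pure FL) -braid_theta braid_pure // tsum_tsum //.
  by apply: eq_tsum => *; rewrite tsum_pure.
rewrite opprK; have -> : \sw_(u', x <- unsnoc u) hd u' \ot x =
  \sw_(u', x <- unsnoc u) hmul Theta u' \ot x - \sw_(u', x <- unsnoc u) hmul (hsign u')
    Theta \ot x.
  rewrite -tsum_opp -tsum_add; apply: hu => [||u' x ->]; [by lin|by lin|].
  by rewrite (bilDl _ _ _ (pure_bilinear _ _)) (bilNl _ _ (pure_bilinear _ _)).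
have -> : \sw_(u0, u1 <- hcoact u) hsign u0 \ot germ u1 =
  \sw_(u0, u1 <- hcoact u) hsign u0 \ot act theta u1 - hsign u \ot theta.
  have h : linmap (fun u => hsign u \ot theta) by lin.
  rewrite -[in X in _ = _ - X](sw_hcoact_eps u) (linear_of_tsum _ _ (linmapP h)).
  rewrite -tsum_opp -tsum_add; apply: eq_tsum => u0 u1.
  rewrite (linZ _ _ (linmapP h)) germE (bilDr _ _ _ (pure_bilinear _ _)).
  by rewrite (bilNr _ _ (pure_bilinear _ _)) (bilZr _ _ _ (pure_bilinear _ _)).
by rewrite opprD (AC (2*2) ((1*3)*(4*2))).
Qed.

(** Only the component of degree one contributes, since [hproj] kills prefixes with letters; its
    A-part is evaluated by the counit. There the last letter is also the first. *)
Let first_letter (u : H) : L := \sw_(u', x <- unsnoc u) eps (hproj u') *: x.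

Let first_letter_lin : linmap first_letter.
Proof. by rewrite /first_letter; lin. Qed.

Let first_letter_snoc a x : first_letter (snoc (hbase a) x) = eps a *: x.
Proof. by rewrite /first_letter unsnoc_snoc tsum_pure ?hproj_base //; lin. Qed.

(** Apply [first_letter] to the inner formula in degree zero. *)
Lemma inner_germ : (forall a, hd (hbase a) = hmul Theta (hbase a) - hmul (hbase a) Theta) ->
  forall a, germ a = act theta a - eps a *: theta.
Proof.
move=> hin a; have := congr1 first_letter (hin a).
rewrite hd_base // (linear_of_tsum _ _ (linmapP first_letter_lin)).
rewrite (linD _ _ (linmapP first_letter_lin)) (linN _ (linmapP first_letter_lin)).
have FL : bilinear_map (fun u (x : L) => eps (hproj u) *: x) by lin.
rewrite /first_letter sw_unsnoc_theta_hmul // sw_unsnoc_hmul_theta //.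
rewrite unsnoc_base !tsum0; try by lin.
rewrite hproj_base add0r subr0.
rewrite sw_hcoact_base //; last by lin.
have E (f : A -> L) : linmap f ->
    \sw_(a1, a2 <- Delta a) eps (hproj (hsign (hbase a1))) *: f a2 = f a.
  move=> [fL]; rewrite -[RHS](sw_epsl a fL); apply: eq_tsum => *.
  by rewrite hsign_base hproj_base.
rewrite E; last by lin.
move=> <-; rewrite -[LHS](sw_epsl a (linmapP linmap_germ)); apply: eq_tsum => a1 a2.
by rewrite unsnoc_snoc tsum_pure ?hproj_base.
Qed.

(** Reading the inner formula in degree one through its two letters gives an identity in L (x) L.
    The terms with [germ] cancel by [germE], leaving theta (x) v - Psi(v (x) theta) = 0. *)
Lemma inner_braid (v : L) :
  (forall a, germ a = act theta a - eps a *: theta) ->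
  hd (snoc (hbase 1) v) = hmul Theta (snoc (hbase 1) v) + hmul (snoc (hbase 1) v) Theta ->
  braid (v \ot theta) = theta \ot v.
Proof.
move=> germE hin.
pose r2 (z : tensor H L) : tensor L L := \sw_(w, x <- z) first_letter w \ot x.
have FL : bilinear_map (fun w x => first_letter w \ot x) by lin.
have := congr1 (fun w => r2 (unsnoc w)) hin.
rewrite /r2 (linD _ _ (linmapP unsnoc_lin)) tsumDl // sw_unsnoc_hd //.
rewrite sw_unsnoc_theta_hmul // sw_unsnoc_hmul_theta // unsnoc_snoc.
rewrite !tsum_pure; try by lin.
have sumE (f : L -> A -> tensor L L) : bilinear_map f ->
    \sw_(u0, u1 <- hcoact (snoc (hbase 1) v)) f (first_letter (hsign u0)) u1 =
    - \sw_(v0, v1 <- coact v) f v0 v1.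
  move=> fL; rewrite hcoact_letter tsum_tsum -?tsum_opp; last by lin.
  apply: eq_tsum => v0 v1; rewrite tsum_pure; last by lin.
  rewrite hsign_snoc hsign_base (linN _ (linmapP first_letter_lin)) first_letter_snoc.
  by rewrite eps1 scale1r (bilNl _ _ fL).
rewrite (sumE (fun x a => x \ot germ a)); last by lin.
rewrite (sumE (fun x a => x \ot act theta a)); last by lin.
rewrite hd_base // Delta1 tsum_pure; last by lin.
rewrite germ1 // (bil0r _ snoc_bil) (lin0 (linmapP first_letter_lin)).
rewrite (bil0l _ (pure_bilinear _ _)) add0r hmulx1 // !first_letter_snoc eps1 !scale1r.
have -> : \sw_(v0, v1 <- coact v) v0 \ot germ v1 =
    \sw_(v0, v1 <- coact v) v0 \ot act theta v1 - v \ot theta.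
  have h : linmap (fun v : L => v \ot theta) by lin.
  rewrite -[in X in _ = _ - X](coact_eps LX v) (linear_of_tsum _ _ (linmapP h)).
  rewrite -tsum_opp -tsum_add; apply: eq_tsum => v0 v1.
  rewrite (linZ _ _ (linmapP h)) germE (bilDr _ _ _ (pure_bilinear _ _)).
  by rewrite (bilNr _ _ (pure_bilinear _ _)) (bilZr _ _ _ (pure_bilinear _ _)).
have -> : \sw_(t0, t1 <- coact theta)
    first_letter (hmul (hbase 1) (snoc (hbase 1) t0)) \ot act v t1 = braid (v \ot theta).
  rewrite braid_pure //; apply: eq_tsum => t0 t1.
  by rewrite hmul1x // first_letter_snoc eps1 scale1r.
rewrite opprB [X in _ = X](AC (2*2) ((3*2)*(1*4))) -[LHS]addr0 => /addrI/esym/eqP.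
by rewrite subr_eq0 => /eqP ->.
Qed.
End Inner.

(** * Identification with the structure maps of [Omega_sh], and the theorem *)

Let hpure_theta v : (1 : A) \ot tw [:: v] = snoc (hbase 1) v.
Proof. by rewrite snoc_pure tcat1x. Qed.

Lemma hcomp_bound u : exists N,
  u = \sum_(n < N) hcomp n u /\ forall n, (N <= n)%N -> hcomp n u = 0.
Proof.
have [N hN] := hcomp_sum u; exists N; split=> [|n le_Nn]; first exact: hN.
rewrite (hN N (leqnn N)) (lin_sum _ _ _ (linmapP (linmap_hcomp n))) big1 // => i _.
by rewrite hcomp_comp gtn_eqF // (leq_trans _ le_Nn).
Qed.

Local Notation Omega := (Omega_sh L).

Lemma gcompE : @gcomp k Omega = hcomp.
Proof. by apply/funext => n; rewrite hcompE. Qed.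

Lemma gmulE : @gmul k Omega = hmul.
Proof. by rewrite hmulE. Qed.

Lemma gDeltaE : @gDelta k Omega = hDelta.
Proof. by rewrite hDeltaE. Qed.

Lemma gepsE : @geps k Omega = (fun u => eps (hproj u)).
Proof.
apply/funext => u; rewrite hprojE /hproj_def.
have epsL : @linmap k A k^o eps by exact: linmap_eps.
rewrite (linear_of_tsum (M := A) (N := k^o) _ _ (linmapP epsL)).
rewrite [LHS]/(@boson_eps k A (Sh L) u) /boson_eps.
refine (@eq_tsum k A T k^o _ _ u _) => a x.
by rewrite linearZ /= mulrC.
Qed.

Lemma Omega_grading : grading Omega.
Proof.
split; rewrite gcompE.
- by move=> n; exact: linmapP (linmap_hcomp n).
- exact: hcomp_comp.
- by move=> u; have [N hN] := hcomp_sum u; exists N; exact: hN.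
Qed.

Lemma gsignE : @gsign k Omega = hsign.
Proof.
apply/funext; apply: (graded_ext (H := Omega) Omega_grading).
- by split; apply: (fsbig_gcomp_linear Omega_grading (G := fun n u => (-1) ^+ n *: u)) => n;
    exact: linmapP (linmap_scaler _ (linmap_id _)).
- exact: hsign_lin.
- move=> n u hu; rewrite (gsign_deg Omega_grading hu).
  by move: hu; rewrite /gdeg gcompE => <-; rewrite -hsign_hcomp.
Qed.

(** The sums over all degrees stop at bounds for [b] and [c]. Splitting [b] and [c] into components,
    [koszul_hcomp] supplies the signs. *)
Lemma super_mulE : @super_mul k Omega = hsmul.
Proof.
apply/funext => X; apply/funext => Y; rewrite -[RHS]tsum_pure_id sw_hsmul; last by lin.
apply: eq_tsum => a b; apply: eq_tsum => c d; rewrite gmulE gcompE.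
have [[M [bE b0]] [N [cE c0]]] := (hcomp_bound b, hcomp_bound c).
have FL : bilinear_map (fun b c => \sw_(b', c' <- koszul b c) hmul a c' \ot hmul b' d)
  by lin.
rewrite (@fsbig_nat_bound k _ M) => [|i /b0 ->]; last first.
  rewrite (@fsbig_nat_bound k _ 0) ?big_ord0 // => j _.
  by rewrite (bil0l _ hmul_bil) (bil0r _ (pure_bilinear _ _)) scaler0.
rewrite [in RHS]bE (lin_sum _ _ _ (FL.1 c)); apply: eq_bigr => i _.
rewrite (@fsbig_nat_bound k _ N) => [|j /c0 ->]; last first.
  by rewrite (bil0r _ hmul_bil) (bil0l _ (pure_bilinear _ _)) scaler0.
rewrite [in RHS]cE (lin_sum _ _ _ (FL.2 _)); apply: eq_bigr => j _.
by rewrite koszul_hcomp tsumZl ?tsum_pure //; lin.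
Qed.

Lemma Omega_algebra : graded_algebra Omega.
Proof.
split; rewrite ?gmulE ?gcompE.
- exact: hmul_bil.
- exact: hmulA.
- exact: hmul1x.
- exact: hmulx1.
- by rewrite /gdeg gcompE; exact: hcomp0_base.
- by move=> m n u v; rewrite /gdeg gcompE => <- <-; exact: hcomp_hmul.
Qed.

Lemma Omega_coalgebra : graded_coalgebra Omega.
Proof.
split; rewrite ?gDeltaE ?gepsE ?gcompE.
- by move=> c u v; exact: (linmapP linmap_hDelta c u v).
- by move=> c u v; rewrite (linmapP hproj_lin) linearP.
- by move=> u; apply: (sw_hDeltaA (F := fun a b c => a \ot (b \ot c))); lin.
- exact: hDelta_counitl.
- exact: hDelta_counitr.
- by move=> n u; rewrite /gdeg gcompE => hu; rewrite -{1}hu; exact: hDelta_hcomp.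
- move=> [//|n] u; rewrite /gdeg gcompE => <- _.
  by rewrite hproj_hcompS linear0.
Qed.

Lemma Omega_super_hopf : graded_super_hopf Omega.
Proof.
split; [exact: Omega_grading|exact: Omega_algebra|exact: Omega_coalgebra|..];
  rewrite ?gmulE ?gDeltaE ?gepsE ?super_mulE.
- by rewrite hDelta_base // Delta1 tsum_pure //; lin.
- exact: hDelta_hmul.
- by rewrite hproj_base eps1.
- by move=> u v; rewrite hproj_hmul // epsM.
(* The antipode of A, extended by 0 to positive degrees since [hproj] kills them, is the degree zero
   input of [graded_antipode]. *)
have S0L : linmap (fun u => hbase (antipode (hproj u))) by lin.
have S0D : graded_map (H := Omega) (fun u => hbase (antipode (hproj u))).
  move=> [|n] u; rewrite /gdeg gcompE => hu; first by rewrite hcomp0_base.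
  by rewrite -hu hproj_hcompS linear0 (lin0 (linmapP hbase_lin)) (lin0 (linmapP
    (linmap_hcomp _))).
have deg0E u : @gdeg k Omega 0 u -> u = hbase (hproj u).
  by rewrite /gdeg gcompE hcomp0E => {1}<-.
have eps_base u : eps (hproj u) *: hbase 1 = hbase (eps (hproj u))%:A.
  by rewrite (linZ _ _ (linmapP hbase_lin)).
have S0l u : @gdeg k Omega 0 u ->
    conv (H := Omega) (fun u => hbase (antipode (hproj u))) id u = conv1 (H := Omega) u.
  move=> /deg0E ->; rewrite /conv /conv1 gDeltaE gmulE gepsE sw_hDelta_base //; last by lin.
  rewrite [RHS]eps_base hproj_base -antipodel (linear_of_tsum _ _ (linmapP hbase_lin)).
  by apply: eq_tsum => *; rewrite hproj_base hmul_base.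
have S0r u : @gdeg k Omega 0 u ->
    conv (H := Omega) id (fun u => hbase (antipode (hproj u))) u = conv1 (H := Omega) u.
  move=> /deg0E ->; rewrite /conv /conv1 gDeltaE gmulE gepsE sw_hDelta_base //; last by lin.
  rewrite [RHS]eps_base hproj_base -antipoder (linear_of_tsum _ _ (linmapP hbase_lin)).
  by apply: eq_tsum => *; rewrite hproj_base hmul_base.
have [S [SL SD Sl Sr]] := graded_antipode Omega_grading Omega_algebra Omega_coalgebra
  S0L S0D S0l S0r.
exists S; split=> // u; [have := Sl u|have := Sr u];
  by rewrite /conv /conv1 gDeltaE gmulE gepsE.
Qed.

Lemma Omega_degree_zero : degree_zero_part (hbase : A -> Omega).
Proof.
split; rewrite ?gmulE ?gDeltaE ?gepsE.
- exact: linmapP hbase_lin.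
- by move=> a b /(congr1 hproj); rewrite !hproj_base.
- move=> u; rewrite /gdeg gcompE hcomp0E; split=> [<-|[a ->]]; first by exists (hproj u).
  by rewrite hproj_base.
- by [].
- by move=> a b; rewrite hmul_base.
- exact: hDelta_base.
- by move=> a; rewrite hproj_base.
Qed.

Lemma gdeg_hsign n u : @gdeg k Omega n u -> hsign u = (-1) ^+ n *: u.
Proof. by rewrite /gdeg gcompE => <-; exact: hsign_hcomp. Qed.

Lemma Omega_strongly_bicovariant :
  strongly_bicovariant (hbase : A -> Omega) (sh_d omega).
Proof.
have dE : @sh_d k A L omega = hd by rewrite hdE.
split; rewrite ?dE ?gmulE ?gDeltaE ?gsignE.
- exact: Omega_super_hopf.
- exact: Omega_degree_zero.
- exact: linmapP linmap_hd.
- by move=> n u; rewrite /gdeg gcompE => hu; rewrite hcomp_hd hu.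
- exact: hd_hd.
- move=> n u v /gdeg_hsign hu; rewrite hd_hmul hu.
  by rewrite (bilZl _ _ _ hmul_bil).
- exact: hDelta_hd.
Qed.

Lemma Omega_inner theta :
  inner_by (sh_d omega) ((1 : A) \ot tw [:: theta] : Omega) <->
  inner_fo_calculus omega theta /\ (forall v : L, braid (v \ot theta) = theta \ot v).
Proof.
have dE : @sh_d k A L omega = hd by rewrite hdE.
rewrite /inner_by gmulE dE hpure_theta; split=> [hin|[om_inner hbraid] n u /gdeg_hsign hu].
  have germE : forall a, germ a = act theta a - eps a *: theta.
    apply: inner_germ => a.
    by rewrite (hin 0%N) ?expr0 ?scale1r // /gdeg gcompE hcomp0_base.
  split=> [a|v].
    rewrite -germ_aug germE; case: a => a /= /eqP ->.
    by rewrite scale0r subr0.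
  apply: (inner_braid germE).
  (* In degree one the sign (-1)^1 turns the graded commutator into an anticommutator, as
     [inner_braid] expects. *)
  rewrite (hin 1%N) ?expr1 ?scaleN1r ?opprK // /gdeg gcompE.
  by rewrite hcompS_snoc hcomp0_base.
by rewrite (inner_hd om_inner hbraid) hu (bilZl _ _ _ hmul_bil).
Qed.
End Calculus.

Theorem proposition3p12 (k : fieldType) (k_char : 2%N \notin [pchar k])
  (A : hopfAlgebra k) (S_bij : bijective (antipode : A -> A))
  (L : crossedData A) (omega : aug A -> L)
  (L_calculus : generalised_fo_calculus omega) :
  strongly_bicovariant (fun a : A => a \ot tw [::] : Omega_sh L) (sh_d omega)
  /\
  (forall theta : L,
     inner_by (sh_d omega) ((1 : A) \ot tw [:: theta] : Omega_sh L)
     <->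
     inner_fo_calculus omega theta
     /\ (forall v : L, braid (v \ot theta) = theta \ot v)).
Proof.
have [LX omegaX] := L_calculus; split.
  exact: (Omega_strongly_bicovariant LX omegaX).
by move=> theta; exact: (Omega_inner LX omegaX theta).
Qed.
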